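(* Let $g$ be a Riemannian metric on $\mathbb{S}^2$ and let $r \colon \mathbb{S}^2 \to \mathbb{R}_+$ be a smooth function with $\|\nabla r\|_g < 1$ everywhere. Then the Hilbert-Einstein functional of $(P_r, \widetilde g_r)$ satisfies $$\mathrm{HE}(r) = \int_{M_r} h\,(K + \det B)\,\mathrm{darea},$$ where $K$ is the Gauss curvature of $M_r$ (with its induced metric), $B$ is its shape operator and $h = r\cos\alpha$.
   Context: On $\mathbb{R}_+\times\mathbb{S}^2$ (with $\mathbb{R}_+=(0,\infty)$ and coordinate $\rho$ on $\mathbb{R}_+$) consider the Riemannian metric $\widetilde g_r = d\rho^2 + \left(\frac{\rho}{r}\right)^2 (g - dr\otimes dr)$. Put $M_r = \{(r(x),x) : x\in\mathbb{S}^2\}$ and $P_r = \{(\rho,x) : \rho\le r(x)\}$. The map $\phi_r(x) = (r(x),x)$ is an isometric embedding of $(\mathbb{S}^2,g)$ onto $M_r$ with the metric induced by $\widetilde g_r$; functions on $M_r$ and on $\mathbb{S}^2$ are identified through $\phi_r$ (in particular $r$ is also the function $\rho|_{M_r}$). Let $\nu$ be the unit normal field of $M_r$ pointing out of $P_r$, $\widetilde\nabla$ the Levi-Civita connection of $\widetilde g_r$, $B(X) = \widetilde\nabla_X\nu$ the shape operator on $TM_r$, and $H = \frac12\operatorname{tr}B$. Let $\alpha \colon M_r\to[0,\frac{\pi}{2})$ be the angle between $\partial_\rho$ and $\nu$. $\mathrm{darea}$ is the area element of $M_r$. The Hilbert-Einstein functional is $\mathrm{HE}(r) = \frac12\int_{P_r}\mathrm{scal}\,\mathrm{dvol}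 + 2\int_{M_r}H\,\mathrm{darea}$, where $\mathrm{scal}$ is the scalar curvature of $\widetilde g_r$ (the first integral converges although $P_r$ is not compact). *)

(* Defs.v *)
From HB Require Import structures.
From mathcomp Require Import all_boot all_order all_algebra.
From mathcomp Require Import all_classical all_reals all_analysis.
Set Implicit Arguments.
Unset Strict Implicit.
Unset Printing Implicit Defensive.
Import Order.TTheory GRing.Theory Num.Theory.
Import numFieldNormedType.Exports.
Local Open Scope classical_set_scope.
Local Open Scope ring_scope.

(** * Riemannian geometry in coordinates

    Points and tangent vectors of R^n are row vectors.  A metric is a field
    G : 'rV_n -> 'M_n of Gram matrices, and the Jacobian ['J F u] acts on row
    vectors from the right, so that its i-th row is the i-th partial derivative
    of F at u. *)

Definition partial (R : realType) n (i : 'I_n) (f : 'rV[R]_n -> R)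
  (p : 'rV[R]_n) : R := 'D_(delta_mx 0 i) f p.

Fixpoint Ck (R : realType) n (k : nat) (f : 'rV[R]_n -> R) : Prop :=
  if k is k'.+1
  then (forall p, differentiable f p) /\ (forall i, Ck k' (partial i f))
  else continuous f.

Definition smooth (R : realType) n (f : 'rV[R]_n -> R) : Prop :=
  forall k, Ck k f.

Definition ip (R : realType) n (G : 'M[R]_n) (v w : 'rV[R]_n) : R :=
  (v *m G *m w^T) 0 0.

Definition ipnorm (R : realType) n (G : 'M[R]_n) (v : 'rV[R]_n) : R :=
  Num.sqrt (ip G v v).

Definition angle (R : realType) n (G : 'M[R]_n) (v w : 'rV[R]_n) : R :=
  acos (ip G v w / (ipnorm G v * ipnorm G w)).

Definition dvol (R : realType) n (G : 'M[R]_n) : R := Num.sqrt (\det G).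

Definition pullback (R : realType) m n (F : 'rV[R]_m -> 'rV[R]_n)
  (G : 'rV[R]_n -> 'M[R]_n) (u : 'rV[R]_m) : 'M[R]_m :=
  'J F u *m G (F u) *m ('J F u)^T.

Definition differential (R : realType) n (f : 'rV[R]_n -> R) (p : 'rV[R]_n) :
  'rV[R]_n := \row_i partial i f p.

Definition grad (R : realType) n (G : 'rV[R]_n -> 'M[R]_n) (f : 'rV[R]_n -> R)
  (p : 'rV[R]_n) : 'rV[R]_n := differential f p *m invmx (G p).

(** [christoffel G k i j] is $\Gamma^k_{ij}$, the k-th component of
    $\nabla_{\partial_i}\partial_j$ for the Levi-Civita connection of G. *)
Definition christoffel (R : realType) n (G : 'rV[R]_n -> 'M[R]_n)
  (k i j : 'I_n) (p : 'rV[R]_n) : R :=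
  2^-1 * \sum_l invmx (G p) k l *
    (partial i (fun q => G q j l) p + partial j (fun q => G q i l) p
     - partial l (fun q => G q i j) p).

(** [curvature G l i j k] is the l-th component of
    $R(\partial_i,\partial_j)\partial_k$, where
    $R(X,Y) = \nabla_X\nabla_Y - \nabla_Y\nabla_X - \nabla_{[X,Y]}$. *)
Definition curvature (R : realType) n (G : 'rV[R]_n -> 'M[R]_n)
  (l i j k : 'I_n) (p : 'rV[R]_n) : R :=
  partial i (christoffel G l j k) p - partial j (christoffel G l i k) p
  + \sum_m (christoffel G m j k p * christoffel G l i m p
            - christoffel G m i k p * christoffel G l j m p).

Definition ricci (R : realType) n (G : 'rV[R]_n -> 'M[R]_n) (j k : 'I_n)
  (p : 'rV[R]_n) : R := \sum_i curvature G i i j k p.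

Definition scal (R : realType) n (G : 'rV[R]_n -> 'M[R]_n) (p : 'rV[R]_n) : R :=
  \sum_j \sum_k invmx (G p) j k * ricci G j k p.

(** $\langle R(\partial_1,\partial_2)\partial_2,\partial_1\rangle$ divided by
    the squared area of the coordinate parallelogram. *)
Definition gauss_curvature (R : realType) (G : 'rV[R]_2 -> 'M[R]_2)
  (u : 'rV[R]_2) : R :=
  (\sum_l curvature G l ord0 ord_max ord_max u * G u l ord0) / \det (G u).

(** Covariant derivative of a vector field V along the map F: row i is
    $\nabla_{\partial_i F} V$. *)
Definition covder (R : realType) m n (G : 'rV[R]_n -> 'M[R]_n)
  (F V : 'rV[R]_m -> 'rV[R]_n) (u : 'rV[R]_m) : 'M[R]_(m, n) :=
  'J V u + \matrix_(i, k) \sum_j \sum_l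
    christoffel G k j l (F u) * 'J F u i j * V u 0 l.

(** * The sphere

    Functions and tensors on the unit sphere of R^3 are represented by total
    functions on R^3, whose values off the sphere (and, for a bilinear form,
    off the tangent planes) are irrelevant. *)

Definition sphere2 (R : realType) : set 'rV[R]_3 := [set x | x *m x^T = 1%:M].

(** Inverse stereographic projections from the north pole ([s = false]) and
    from the south pole ([s = true]); together they cover the sphere. *)
Definition stereo (R : realType) (s : bool) (u : 'rV[R]_2) : 'rV[R]_3 :=
  let q := (u *m u^T) 0 0 in
  (1 + q)^-1 *: row_mx (2 *: u : 'rV[R]_2) ((-1) ^+ s * (q - 1))%:M.

Definition smooth_on_sphere (R : realType) (f : 'rV[R]_3 -> R) : Prop :=
  forall s, smooth (f \o stereo s).

Definition riemannian_metric (R : realType) (g : 'rV[R]_3 -> 'M[R]_3) : Prop :=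
  [/\ forall x v w, sphere2 x -> v *m x^T = 0 -> w *m x^T = 0 ->
        ip (g x) v w = ip (g x) w v,
      forall x v, sphere2 x -> v *m x^T = 0 -> v != 0 -> 0 < ip (g x) v v
    & forall s i j, smooth (fun u => pullback (stereo s) g u i j)].

(** $\|\nabla f\|_g$ at the point [stereo s u]. *)
Definition grad_norm (R : realType) (g : 'rV[R]_3 -> 'M[R]_3)
  (f : 'rV[R]_3 -> R) (s : bool) (u : 'rV[R]_2) : R :=
  let G := pullback (stereo s) g in
  ipnorm (G u) (grad G (f \o stereo s) u).

(** * The hypersurface $M_r$ in $(\mathbb R_+\times\mathbb S^2,\tilde g_r)$

    Everything below is computed in the coordinates (rho, u), where u is the
    stereographic coordinate from the north pole.  This chart misses a single
    point of the sphere, hence only null sets of $M_r$ and of $P_r$. *)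

Definition sphere_metric (R : realType) (g : 'rV[R]_3 -> 'M[R]_3) :
  'rV[R]_2 -> 'M[R]_2 := pullback (stereo false) g.

Definition radius (R : realType) (r : 'rV[R]_3 -> R) : 'rV[R]_2 -> R :=
  r \o stereo false.

Definition rho (R : realType) (p : 'rV[R]_(1 + 2)) : R := lsubmx p 0 0.

Definition gtilde (R : realType) (g : 'rV[R]_3 -> 'M[R]_3) (r : 'rV[R]_3 -> R)
  (p : 'rV[R]_(1 + 2)) : 'M[R]_(1 + 2) :=
  let u := rsubmx p in
  let dr := differential (radius r) u in
  block_mx 1%:M 0
    0 ((rho p / radius r u) ^+ 2 *: (sphere_metric g u - dr^T *m dr)).

Definition P_ (R : realType) (r : 'rV[R]_3 -> R) : set 'rV[R]_(1 + 2) :=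
  [set p | 0 < rho p <= radius r (rsubmx p)].

Definition phi (R : realType) (r : 'rV[R]_3 -> R) (u : 'rV[R]_2) :
  'rV[R]_(1 + 2) := row_mx (radius r u)%:M u.

Definition induced_metric (R : realType) (g : 'rV[R]_3 -> 'M[R]_3)
  (r : 'rV[R]_3 -> R) : 'rV[R]_2 -> 'M[R]_2 := pullback (phi r) (gtilde g r).

Definition outer_unit_normal (R : realType) (g : 'rV[R]_3 -> 'M[R]_3)
  (r : 'rV[R]_3 -> R) (u : 'rV[R]_2) : set 'rV[R]_(1 + 2) :=
  [set v | [/\ forall w, ip (gtilde g r (phi r u)) v (w *m 'J (phi r) u) = 0,
               ipnorm (gtilde g r (phi r u)) v = 1
             & \forall t \near 0^'+, ~ P_ r (phi r u + t *: v)]].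

Definition nu (R : realType) (g : 'rV[R]_3 -> 'M[R]_3) (r : 'rV[R]_3 -> R)
  (u : 'rV[R]_2) : 'rV[R]_(1 + 2) := get (outer_unit_normal g r u).

(** Matrix of $X\mapsto\tilde\nabla_X\nu$ in the frame formed by the rows of
    ['J (phi r) u]; [pinvmx] reads off the coefficients of a vector of their
    span. *)
Definition shape_operator (R : realType) (g : 'rV[R]_3 -> 'M[R]_3)
  (r : 'rV[R]_3 -> R) (u : 'rV[R]_2) : 'M[R]_2 :=
  covder (gtilde g r) (phi r) (nu g r) u *m pinvmx ('J (phi r) u).

Definition mean_curvature (R : realType) (g : 'rV[R]_3 -> 'M[R]_3)
  (r : 'rV[R]_3 -> R) (u : 'rV[R]_2) : R := 2^-1 * \tr (shape_operator g r u).

Definition alpha (R : realType) (g : 'rV[R]_3 -> 'M[R]_3) (r : 'rV[R]_3 -> R)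
  (u : 'rV[R]_2) : R :=
  angle (gtilde g r (phi r u)) (delta_mx 0 0) (nu g r u).

Definition height (R : realType) (g : 'rV[R]_3 -> 'M[R]_3) (r : 'rV[R]_3 -> R)
  (u : 'rV[R]_2) : R := radius r u * cos (alpha g r u).

Definition point2 (R : realType) (a : R * R) : 'rV[R]_2 :=
  row_mx (a.1%:M : 'M[R]_1) (a.2%:M : 'M[R]_1).

Definition point3 (R : realType) (a : R * (R * R)) : 'rV[R]_(1 + 2) :=
  row_mx a.1%:M (point2 a.2).

Definition integral_M (R : realType) (g : 'rV[R]_3 -> 'M[R]_3)
  (r : 'rV[R]_3 -> R) (f : 'rV[R]_2 -> R) : \bar R :=
  (\int[lebesgue_measure \x lebesgue_measure]_(a in setT)
    (f (point2 a) * dvol (induced_metric g r (point2 a)))%:E)%E.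

Definition integral_P (R : realType) (g : 'rV[R]_3 -> 'M[R]_3)
  (r : 'rV[R]_3 -> R) (f : 'rV[R]_(1 + 2) -> R) : \bar R :=
  (\int[lebesgue_measure \x (lebesgue_measure \x lebesgue_measure)]_
    (a in @point3 R @^-1` P_ r)
    (f (point3 a) * dvol (gtilde g r (point3 a)))%:E)%E.

Definition HE (R : realType) (g : 'rV[R]_3 -> 'M[R]_3) (r : 'rV[R]_3 -> R) :
  \bar R :=
  ((2^-1)%:E * integral_P g r (scal (gtilde g r))
   + 2%:E * integral_M g r (mean_curvature g r))%E.

(* Main.v *)
(** Write f = r^2/2, b = g - Hess f and h^2 = 2 f - |grad f|^2, so that
    h = r cos(alpha).  The shape operator is h^-1 g^-1 b, and the metric on P_r is
    the cone over A = (g - dr dr)/r^2, whence scal = 2 (K_A - 1)/rho^2 with K_A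
    determined by K, det b and h.  After integration over rho, both sides of the
    theorem become integrals over the sphere of densities in g, f and b.  Their
    difference is the divergence of V = adj(b) grad f / h, by the Codazzi equation
    d_i b_jk - d_j b_ik = (Christoffel terms) + K (g_jk f_i - g_ik f_j).

    The stereographic chart misses one point of the sphere.  The inversion
    u -> u/|u|^2 passes to the opposite chart, where all densities and V are
    smooth; so in the first chart the densities are O(|u|^-4) and V is O(|u|^-2).
    Hence all integrals converge, and the flux of V through the boundary of
    [-n, n]^2 tends to 0.  That K transforms correctly under the inversion is
    read off the Codazzi equations of an ambient coordinate function. *)

Require Import Defs.
From HB Require Import structures.
From mathcomp Require Import all_boot all_order all_algebra.
From mathcomp Require Import all_classical all_reals all_analysis.
From mathcomp Require Import measurable_realfun.
From mathcomp Require Import ring lra.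
Set Implicit Arguments.
Unset Strict Implicit.
Unset Printing Implicit Defensive.
Import Order.TTheory GRing.Theory Num.Theory.
Import numFieldNormedType.Exports.
Local Open Scope classical_set_scope.
Local Open Scope ring_scope.

(** On a cone the function rho^2/2 has the metric as Hessian and the position field X = rho d/drho
    as gradient. Restricting it to M_r gives Hess f = g - h II, with II the second fundamental form;
    this is the origin of b = h II, and likewise h nu = X - grad f along M_r. The Codazzi equation
    in the form used is just the Ricci identity for df, valid for every smooth f on a surface. It
    serves three times: for div V, for the curvature of A and for K under a change of chart.

    The relation between K_A, K and det b is the Gauss equation of M_r: planes through d/drho are
    flat, and the tangent planes of M_r are inclined by alpha against the spherical ones.

    Tensor identities are checked in coordinates. Metric compatibility, Hess f = g - b and the
    Codazzi equation eliminate dependent derivatives; the others are treated as indeterminates, and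
    a polynomial or rational identity remains. For this reason determinants replace inverse
    matrices: h^2 appears as [height_det], which is h^2 det G, and V as the vector density sqrt(det
    G) V, whose coordinate divergence involves no Christoffel symbols. *)

Lemma addrCB (V : zmodType) (a b c d : V) : a - b - (c - d) = a - c - (b - d).
Proof. by rewrite !opprB addrACA [RHS]addrACA (addrC (- b)). Qed.

(** * Partial derivatives *)

Section Partial.
Context {R : realType} {n : nat}.
Implicit Types (f g : 'rV[R]_n -> R) (p : 'rV[R]_n) (i j : 'I_n).

Lemma partialD i f g p : differentiable f p -> differentiable g p ->
  partial i (fun q => f q + g q) p = partial i f p + partial i g p.
Proof. by move=> df dg; apply: deriveD; apply: diff_derivable. Qed.

Lemma partialN i f p : differentiable f p ->
  partial i (fun q => - f q) p = - partial i f p.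
Proof. by move=> df; apply: deriveN; apply: diff_derivable. Qed.

Lemma partialB i f g p : differentiable f p -> differentiable g p ->
  partial i (fun q => f q - g q) p = partial i f p - partial i g p.
Proof. by move=> df dg; apply: deriveB; apply: diff_derivable. Qed.

Lemma partialM i f g p : differentiable f p -> differentiable g p ->
  partial i (fun q => f q * g q) p = partial i f p * g p + f p * partial i g p.
Proof.
move=> df dg; rewrite [LHS]deriveM; try exact: diff_derivable.
by rewrite addrC /GRing.scale /=; congr (_ + _); exact: mulrC.
Qed.

Lemma partialV i f p : differentiable f p -> f p != 0 ->
  partial i (fun q => (f q)^-1) p = - (partial i f p / f p ^+ 2).
Proof.
move=> df f0; rewrite [LHS](@deriveV _ _ f)//; last exact: diff_derivable.
by rewrite /GRing.scale /= mulNr mulrC.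
Qed.

Lemma partial_cst i (c : R) p : partial i (fun=> c) p = 0.
Proof. exact: derive_cst. Qed.

Lemma partial_near i f g p : (\forall q \near p, f q = g q) ->
  partial i f p = partial i g p.
Proof. exact: near_eq_derive. Qed.

Lemma differentiable_mul f g p : differentiable f p -> differentiable g p ->
  differentiable (fun q => f q * g q) p.
Proof. exact: differentiableM. Qed.

Lemma differentiable_add f g p : differentiable f p -> differentiable g p ->
  differentiable (fun q => f q + g q) p.
Proof. exact: differentiableD. Qed.

Lemma differentiable_sub f g p : differentiable f p -> differentiable g p ->
  differentiable (fun q => f q - g q) p.
Proof. exact: differentiableB. Qed.

Lemma differentiable_inv f p : differentiable f p -> f p != 0 ->
  differentiable (fun q => (f q)^-1) p.
Proof. exact: differentiableV. Qed.

Lemma partial_div i f g p : differentiable f p -> differentiable g p ->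
  g p != 0 -> partial i (fun q => f q / g q) p =
    (partial i f p - f p / g p * partial i g p) / g p.
Proof.
move=> df dg g0; rewrite (partialM i df (differentiable_inv dg g0)) (partialV i dg g0).
by move: (partial _ _ _) (partial _ _ _) (f p) (g p) g0 => a b c d d0; field.
Qed.

Lemma differentiable_sqrt f p : differentiable f p -> 0 < f p ->
  differentiable (fun q => Num.sqrt (f q)) p.
Proof.
move=> df f0; apply: (@differentiable_comp _ _ _ _ f (@Num.sqrt R)) => //.
by apply/derivable1_diffP; case: (is_derive1_sqrt f0).
Qed.

Lemma partial_sqrt i f p : differentiable f p -> 0 < f p ->
  partial i (fun q => Num.sqrt (f q)) p = partial i f p / (2 * Num.sqrt (f p)).
Proof.
move=> df f0.
have ds : differentiable (@Num.sqrt R) (f p).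
  by apply/derivable1_diffP; case: (is_derive1_sqrt f0).
rewrite /partial deriveE; last exact: differentiable_sqrt.
rewrite (@diff_comp _ _ _ _ f (@Num.sqrt R))//= -[X in 'd _ (f p) X]mulr1.
rewrite -[X in 'd _ (f p) X]/('d f p (delta_mx 0 i) *: 1) linearZ/=.
rewrite -(deriveE _ ds) -(deriveE _ df) /GRing.scale/=.
by congr (_ * _); have [_ ->] := is_derive1_sqrt f0.
Qed.

End Partial.

(** * Jacobians and the chain rule *)

Section Jacobian.
Context {R : realType}.

Lemma row_sum_delta n (v : 'rV[R]_n) : v = \sum_i v 0 i *: delta_mx 0 i.
Proof.
apply/rowP => j; rewrite summxE (bigD1 j)//= big1 => [|i ij].
  by rewrite !mxE !eqxx mulr1 addr0.
by rewrite !mxE eqxx eq_sym (negbTE ij) mulr0.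
Qed.

Lemma differentiable_rV (V : normedModType R) n (F : V -> 'rV[R]_n) p :
  (forall j, differentiable (fun q => F q 0 j) p) -> differentiable F p.
Proof.
move=> dF.
rewrite (_ : F = \sum_j (fun q => F q 0 j *: (delta_mx 0 j : 'rV[R]_n))).
  apply: differentiable_sum => j; exact: differentiableZl.
by apply/funext => q; rewrite fct_sumE; exact: row_sum_delta.
Qed.

Lemma jacobianE m n (F : 'rV[R]_m -> 'rV[R]_n) p i j : differentiable F p ->
  'J F p i j = partial i (fun q => F q 0 j) p.
Proof.
move=> dF; have dd : derivable F p (delta_mx 0 i) by exact: diff_derivable.
have := deriveEjacobian (delta_mx 0 i) dF.
rewrite derive_mx// => /rowP/(_ j); rewrite mxE -rowE [RHS]mxE => <-.
by [].
Qed.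

Lemma jacobian_comp m n k (F : 'rV[R]_m -> 'rV[R]_n) (G : 'rV[R]_n -> 'rV[R]_k) p :
  differentiable F p -> differentiable G (F p) ->
  'J (G \o F) p = 'J F p *m 'J G (F p).
Proof.
move=> dF dG; apply/row_matrixP => i; rewrite !rowE mulmxA.
by rewrite /jacobian !mul_rV_lin1 (diff_comp dF dG).
Qed.

Lemma partial_comp m n (F : 'rV[R]_m -> 'rV[R]_n) (f : 'rV[R]_n -> R) p i :
  differentiable F p -> differentiable f (F p) ->
  partial i (fun q => f (F q)) p =
    \sum_j partial i (fun q => F q 0 j) p * partial j f (F p).
Proof.
move=> dF df; rewrite /partial deriveE; last exact: (differentiable_comp dF df).
rewrite (diff_comp dF df)/= -(deriveE _ dF).
set w := 'D_ _ F p.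
rewrite (row_sum_delta w) linear_sum; apply: eq_bigr => j _.
rewrite linearZ /= -(deriveE _ df) /GRing.scale/=; congr (_ * _).
by rewrite /w derive_mx ?mxE//; exact: diff_derivable.
Qed.

Lemma partial_coord n (i j : 'I_n) (p : 'rV[R]_n) :
  partial i (fun q => q 0 j) p = (i == j)%:R.
Proof.
rewrite /partial deriveE; last exact: differentiable_coord.
(* The coordinate is packaged as a linear map, so that it is its own differential. *)
have @f : {linear 'rV[R]_n -> R}.
  by exists (fun N : 'rV[R]_n => N 0 j); do 2![eexists]; do ?[constructor];
     rewrite ?mxE// => ? *; rewrite ?mxE//; move=> ?; rewrite !mxE.
rewrite (_ : (fun q : 'rV[R]_n => q 0 j) = f)//.
rewrite diff_lin; last exact: coord_continuous.
by rewrite /= mxE eqxx eq_sym.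
Qed.

End Jacobian.

(** * Calculus of smooth functions and symmetry of mixed partial derivatives *)

Section Smooth.
Context {R : realType} {n : nat}.
Implicit Types (f g : 'rV[R]_n -> R) (p : 'rV[R]_n).

Lemma Ck_continuous k f : Ck k f -> continuous f.
Proof. by case: k => // k [df _] p; apply: differentiable_continuous. Qed.

Lemma CkS k f : Ck k.+1 f -> Ck k f.
Proof.
elim: k f => [|k IH] f; first exact: Ck_continuous.
by case=> df dk; split => // i; apply: IH.
Qed.

Lemma Ck_cst k (c : R) : Ck k (fun _ : 'rV[R]_n => c).
Proof.
elim: k c => [|k IH] c /=; first exact: cst_continuous.
split=> [p|i]; first exact: differentiable_cst.
rewrite (_ : partial i _ = fun=> 0); first exact: IH.
by apply/funext => p; exact: partial_cst.
Qed.

Lemma CkD k f g : Ck k f -> Ck k g -> Ck k (fun q => f q + g q).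
Proof.
elim: k f g => [|k IH] f g /=; first by move=> cf cg p; exact: (continuousD (cf p) (cg p)).
move=> [df pf] [dg pg]; split=> [p|i]; first exact: differentiable_add.
rewrite (_ : partial i _ = fun q => partial i f q + partial i g q).
  exact: IH.
by apply/funext => q; rewrite partialD.
Qed.

Lemma CkM k f g : Ck k f -> Ck k g -> Ck k (fun q => f q * g q).
Proof.
elim: k f g => [|k IH] f g; first by move=> cf cg p; exact: (continuousM (cf p) (cg p)).
move=> Cf Cg; have [[df pf] [dg pg]] := (Cf, Cg).
split=> [p|i]; first exact: differentiable_mul.
rewrite (_ : partial i _ =
  fun q => partial i f q * g q + f q * partial i g q).
  by apply: CkD; apply: IH; [exact: pf|exact: CkS|exact: CkS|exact: pg].
by apply/funext => q; rewrite partialM.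
Qed.

Lemma CkN k f : Ck k f -> Ck k (fun q => - f q).
Proof.
move=> Cf; rewrite (_ : (fun q => _) = (fun q => -1 * f q)).
  by apply: (CkM (Ck_cst k (-1))).
by apply/funext => q; rewrite mulN1r.
Qed.

Lemma CkV k f : (forall q, f q != 0) -> Ck k f -> Ck k (fun q => (f q)^-1).
Proof.
move=> f0; elim: k => [|k IH]; first by move=> cf p; exact: (continuousV (f0 p) (cf p)).
move=> Cf; have [df pf] := Cf.
split=> [p|i]; first exact: differentiable_inv.
rewrite (_ : partial i _ =
    fun q => - (partial i f q * ((f q)^-1 * (f q)^-1))).
  by apply: CkN; apply: CkM; [exact: pf|apply: CkM; apply: IH; exact: CkS].
by apply/funext => q; rewrite partialV// expr2 invfM.
Qed.

Lemma Ck_sqrt k f : (forall q, 0 < f q) -> Ck k f ->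
  Ck k (fun q => Num.sqrt (f q)).
Proof.
move=> f0; elim: k => [cf p|k IH Cf].
  by apply: (@continuous_comp _ _ _ f (@Num.sqrt R)); [exact: cf|exact: sqrt_continuous].
have [df pf] := Cf.
split=> [p|i]; first exact: differentiable_sqrt.
rewrite (_ : partial i _ =
    fun q => partial i f q * (2 * Num.sqrt (f q))^-1).
  apply: CkM; [exact: pf|apply: CkV; last first].
    by apply: (CkM (Ck_cst k 2) (IH (CkS Cf))).
  by move=> q; rewrite mulf_neq0// gt_eqF// sqrtr_gt0.
by apply/funext => q; rewrite partial_sqrt.
Qed.

Lemma smooth_cst (c : R) : smooth (fun _ : 'rV[R]_n => c).
Proof. by move=> k; exact: Ck_cst. Qed.

Lemma smoothD f g : smooth f -> smooth g -> smooth (fun q => f q + g q).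
Proof. by move=> sf sg k; exact: CkD. Qed.

Lemma smoothM f g : smooth f -> smooth g -> smooth (fun q => f q * g q).
Proof. by move=> sf sg k; exact: CkM. Qed.

Lemma smoothN f : smooth f -> smooth (fun q => - f q).
Proof. by move=> sf k; exact: CkN. Qed.

Lemma smoothB f g : smooth f -> smooth g -> smooth (fun q => f q - g q).
Proof. by move=> sf sg; apply: smoothD => //; exact: smoothN. Qed.

Lemma smoothV f : (forall q, f q != 0) -> smooth f ->
  smooth (fun q => (f q)^-1).
Proof. by move=> f0 sf k; exact: CkV. Qed.

Lemma smooth_sqrt f : (forall q, 0 < f q) -> smooth f ->
  smooth (fun q => Num.sqrt (f q)).
Proof. by move=> f0 sf k; exact: Ck_sqrt. Qed.

Lemma smooth_coord (i : 'I_n) : smooth (fun q : 'rV[R]_n => q 0 i).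
Proof.
move=> [|k]; first by move=> p; exact: coord_continuous.
split=> [p|j]; first exact: differentiable_coord.
rewrite (_ : partial j _ = fun=> (j == i)%:R); first exact: Ck_cst.
by apply/funext => q; exact: partial_coord.
Qed.

Lemma smooth_sum m (f : 'I_m -> 'rV[R]_n -> R) : (forall i, smooth (f i)) ->
  smooth (fun q => \sum_i f i q).
Proof.
elim: m f => [|m IH] f sf.
  by under eq_fun do rewrite big_ord0; exact: smooth_cst.
under eq_fun do rewrite big_ord_recl.
exact: (smoothD (sf ord0) (IH _ (fun i => sf _))).
Qed.

Lemma smooth_partial i f : smooth f -> smooth (partial i f).
Proof. by move=> sf k; have [_ pf] := sf k.+1; exact: pf. Qed.

Lemma smooth_diff f p : smooth f -> differentiable f p.
Proof. by move=> sf; have [df _] := sf 1%N; exact: df. Qed.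

Lemma smooth_continuous f : smooth f -> continuous f.
Proof. by move=> sf; exact: (sf 0%N). Qed.

(** Restriction to a line makes the mean value theorem and the fundamental theorem of calculus of
    one variable available for partial derivatives. *)
Lemma is_derive_line f p (v : 'rV[R]_n) (t : R) :
  (forall q, differentiable f q) ->
  is_derive t (1 : R) (fun s => f (p + s *: v)) ('D_v f (p + t *: v)).
Proof.
move=> df.
have E : (fun h : R => h^-1 *: (((fun s => f (p + s *: v)) \o shift t) (h *: 1)
      - f (p + t *: v))) =
    (fun h => h^-1 *: ((f \o shift (p + t *: v)) (h *: v) - f (p + t *: v))).
  apply/funext => h /=; congr (_ *: (f _ - _)).
  by rewrite scaler1 scalerDl addrCA.
apply: DeriveDef.
  by rewrite /derivable E; exact: (@diff_derivable _ _ _ f _ v (df (p + t *: v))).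
by rewrite /derive E.
Qed.

(** The mean value theorem is applied twice: in direction i to the difference of f along two
    parallel edges of the square, then in direction j to the partial derivative so obtained. *)
Lemma mean_value_square f i j p (t : R) : smooth f -> 0 < t ->
  exists s s', [/\ 0 < s < t, 0 < s' < t &
   f (p + t *: delta_mx 0 i + t *: delta_mx 0 j) - f (p + t *: delta_mx 0 i)
    - (f (p + t *: delta_mx 0 j) - f p) =
   partial j (partial i f) (p + s *: delta_mx 0 i + s' *: delta_mx 0 j) * t * t].
Proof.
move=> sf t0.
set ei := delta_mx 0 i; set ej := delta_mx 0 j.
have df q : differentiable f q by exact: smooth_diff.
have dfi q : differentiable (partial i f) q.
  by apply: smooth_diff; exact: smooth_partial.
pose F s := f (p + t *: ej + s *: ei) - f (p + s *: ei).
have dF s : is_derive s (1 : R) F (partial i f (p + t *: ej + s *: ei)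
    - partial i f (p + s *: ei)).
  by apply: is_deriveB; exact: is_derive_line.
have [] := @MVT _ F _ 0 t t0 (fun s _ => dF s).
  apply: derivable_within_continuous => s _.
  by case: (dF s).
move=> s; rewrite in_itv/= => s0t; rewrite subr0 {1 2}/F scale0r !addr0 => Fs.
pose H s' := partial i f (p + s *: ei + s' *: ej).
have dH s' : is_derive s' (1 : R) H (partial j (partial i f) (p + s *: ei + s' *: ej)).
  exact: is_derive_line.
have [] := @MVT _ H _ 0 t t0 (fun s _ => dH s).
  apply: derivable_within_continuous => s' _.
  by case: (dH s').
move=> s'; rewrite in_itv/= => s'0t; rewrite subr0 {1 2}/H scale0r !addr0 => Hs.
exists s, s'; split => //.
rewrite -Hs -[p + t *: ei + _]addrA [t *: ei + _]addrC addrA.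
rewrite -[p + s *: ei + _]addrA [s *: ei + _]addrC addrA.
by rewrite -Fs addrCB.
Qed.

(** Schwarz's theorem. One second difference is expressed by either mixed derivative at points close
    to p; if the two differed at p, continuity would keep them apart there. *)
Lemma partialC i j f p : smooth f ->
  partial i (partial j f) p = partial j (partial i f) p.
Proof.
move=> sf; apply/eqP; rewrite -subr_eq0; apply/negPn/negP => ne.
set a := partial i (partial j f) in ne *.
set b := partial j (partial i f) in ne *.
have e0 : 0 < `|a p - b p| / 2 by rewrite divr_gt0// normr_gt0.
have ca : {for p, continuous a}.
  by apply: smooth_continuous; do 2 apply: smooth_partial.
have cb : {for p, continuous b}.
  by apply: smooth_continuous; do 2 apply: smooth_partial.
have /nbhs_ballP[d /= d0 Hd] : \forall q \near p,
    `|a p - a q| < `|a p - b p| / 2 /\ `|b p - b q| < `|a p - b p| / 2.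
  apply: filterI.
    by move/cvgrPdist_lt: ca; apply.
  by move/cvgrPdist_lt: cb; apply.
(* Each of the two displacements is shorter than t, and coordinate vectors have norm at most 1, so
   the intermediate points stay within 2 d / 3 of p. *)
pose t := d / 3.
have t0 : 0 < t by rewrite divr_gt0.
have near_p s s' k l : 0 < s < t -> 0 < s' < t ->
    ball p d (p + s *: delta_mx 0 k + s' *: delta_mx 0 l).
  move=> /andP[s0 st] /andP[s0' st'].
  rewrite -ball_normE/= -addrA opprD addrA subrr add0r normrN.
  rewrite (le_lt_trans (ler_normD _ _))// !normrZ !gtr0_norm//.
  have nd m : `|delta_mx 0 m : 'rV[R]_n| <= 1.
    rewrite [leLHS]/Num.Def.normr/= mx_normrE; apply: bigmax_le => // -[x y] _ /=.
    by rewrite mxE; case: (_ && _); rewrite ?normr1 ?normr0.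
  have /le_lt_trans -> // : s * `|delta_mx 0 k : 'rV[R]_n|
      + s' * `|delta_mx 0 l : 'rV[R]_n| <= t + t.
    by apply: lerD; rewrite -[leRHS]mulr1 ler_pM// ?ltW.
  by rewrite /t; lra.
have [s1 [s1' [h1 h1' E1]]] := mean_value_square i j p sf t0.
have [s2 [s2' [h2 h2' E2]]] := mean_value_square j i p sf t0.
(* By [addrCB] the second difference is symmetric in i and j; cancelling t twice equates the two
   mixed derivatives at their intermediate points. *)
have ab : a (p + s2 *: delta_mx 0 j + s2' *: delta_mx 0 i) =
          b (p + s1 *: delta_mx 0 i + s1' *: delta_mx 0 j).
  have tn0 : t != 0 by rewrite gt_eqF.
  move: E1; rewrite addrCB (addrAC p (t *: delta_mx 0 i)) E2 => ab.
  exact: (mulIf tn0 (mulIf tn0 ab)).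
have [A1 _] := Hd _ (near_p _ _ j i h2 h2').
have [_ B1] := Hd _ (near_p _ _ i j h1 h1').
have := ler_normB (a p - a (p + s2 *: delta_mx 0 j + s2' *: delta_mx 0 i))
  (b p - b (p + s1 *: delta_mx 0 i + s1' *: delta_mx 0 j)).
rewrite {1}ab opprB addrA subrK.
by move=> /le_lt_trans/(_ (ltrD A1 B1)); rewrite -splitr ltxx.
Unshelve. all: by end_near. Qed.

End Smooth.

Ltac smooth_tac := repeat first
  [ assumption
  | match goal with H : forall _, smooth _ |- _ => exact: H end
  | match goal with H : forall _ _, smooth _ |- _ => exact: H end
  | match goal with H : forall _ _ _, smooth _ |- _ => exact: H end
  | apply: smooth_cst | apply: smooth_coord | apply: smooth_partial
  | apply: smoothD | apply: smoothN | apply: smoothM ].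

Ltac diff_tac := solve [apply: smooth_diff; smooth_tac].

Lemma sum2 (V : nmodType) (F : 'I_2 -> V) : \sum_i F i = F ord0 + F ord_max.
Proof.
by rewrite !big_ord_recl big_ord0 addr0; congr (_ + F _); apply/val_inj.
Qed.

Lemma ord2 (i : 'I_2) : i = ord0 \/ i = ord_max.
Proof. by case: i => [[|[|//]]] ?; [left|right]; apply/val_inj. Qed.

(** * Riemannian surfaces in a chart *)

Section Christoffel.
Context {R : realType} {n : nat}.
Variables (G : 'rV[R]_n -> 'M[R]_n) (p : 'rV[R]_n).
Hypothesis G_unit : G p \in unitmx.

(** Uniqueness of the Levi-Civita connection, by the Koszul combination of three compatibility
    equations. It is pointwise: the symbols of a derived metric can be guessed and then verified at
    one point, without computing an inverse matrix. *)
Lemma christoffel_unique (C : 'I_n -> 'I_n -> 'I_n -> R) :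
  (forall i j, G p i j = G p j i) -> (forall k i j, C k i j = C k j i) ->
  (forall k i j, partial k (fun q => G q i j) p =
    \sum_m (C m k i * G p m j + C m k j * G p i m)) ->
  forall k i j, christoffel G k i j p = C k i j.
Proof.
move=> Gs Cs GC k i j.
have E l : partial i (fun q => G q j l) p + partial j (fun q => G q i l) p
    - partial l (fun q => G q i j) p = 2 * \sum_m G p l m * C m i j.
  rewrite !GC -big_split -sumrB mulr_sumr; apply: eq_bigr => m _ /=.
  rewrite (Cs m j i) (Cs m l i) (Cs m l j) (Gs l m).
  rewrite (Gs i m) (Gs j m).
  move: (C m i j) (C m i l) (C m j l) (G p m l) (G p m j) (G p m i).
  move=> a b c d e f; ring.
rewrite /christoffel.
under eq_bigr do rewrite E mulrCA mulr_sumr.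
rewrite -mulr_sumr mulrA mulVf ?pnatr_eq0// mul1r exchange_big/=.
under eq_bigr do under eq_bigr do rewrite mulrA.
under eq_bigr => m _.
  rewrite -mulr_suml (_ : \sum_l invmx (G p) k l * G p l m = (k == m)%:R).
  over.
  by have := mulVmx G_unit => /matrixP/(_ k m); rewrite !mxE.
rewrite (bigD1 k)//= eqxx mul1r big1 ?addr0// => m mk.
by rewrite eq_sym (negbTE mk) mul0r.
Qed.

Hypothesis G_sym : forall q i j, G q i j = G q j i.

Lemma christoffelC k i j : christoffel G k i j p = christoffel G k j i p.
Proof.
rewrite /christoffel; congr (_ * _); apply: eq_bigr => l _; congr (_ * _).
have -> : (fun q => G q i j) = (fun q => G q j i) by apply/funext => q; exact: G_sym.
by congr (_ - _); exact: addrC.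
Qed.

(** Lowering the upper index cancels the inverse matrix; in the sum of the two lowered symbols all
    derivatives but that of [G q i j] in direction k cancel. *)
Lemma christoffel_compat k i j : partial k (fun q => G q i j) p =
  \sum_m (christoffel G m k i p * G p m j + christoffel G m k j p * G p i m).
Proof.
have low a b c : \sum_m G p c m * christoffel G m a b p =
    2^-1 * (partial a (fun q => G q b c) p + partial b (fun q => G q a c) p
            - partial c (fun q => G q a b) p).
  rewrite /christoffel.
  under eq_bigr do rewrite mulrCA mulr_sumr.
  rewrite -mulr_sumr exchange_big/=; congr (_ * _).
  under eq_bigr do under eq_bigr do rewrite mulrA.
  under eq_bigr => l _.
    rewrite -mulr_suml (_ : \sum_m G p c m * invmx (G p) m l = (c == l)%:R).
    over.
    by have := mulmxV G_unit => /matrixP/(_ c l); rewrite !mxE.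
  rewrite (bigD1 c)//= eqxx mul1r big1 ?addr0// => m mk.
  by rewrite eq_sym (negbTE mk) mul0r.
rewrite big_split/=.
under eq_bigr do rewrite mulrC G_sym.
under [X in _ + X]eq_bigr do rewrite mulrC.
rewrite !low.
have -> : (fun q => G q k j) = (fun q => G q j k) by apply/funext.
have -> : (fun q => G q k i) = (fun q => G q i k) by apply/funext.
have -> : (fun q => G q j i) = (fun q => G q i j) by apply/funext.
move: (partial _ _ _) (partial _ _ _) (partial _ _ _) => a b c.
by field.
Qed.

End Christoffel.

(** Positive definiteness in dimension 2 is this positivity of the determinant together with that of
    one diagonal entry; the latter is a separate hypothesis where lengths are compared. *)
Definition smooth_metric (R : realType) (G : 'rV[R]_2 -> 'M[R]_2) : Prop :=
  [/\ forall u i j, G u i j = G u j i, forall i j, smooth (fun u => G u i j)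
    & forall u, 0 < \det (G u)].

Lemma det2 (R : comNzRingType) (M : 'M[R]_2) : \det M =
  M ord0 ord0 * M ord_max ord_max - M ord0 ord_max * M ord_max ord0.
Proof.
rewrite (expand_det_row _ ord0) sum2 /cofactor !det_mx11 !mxE/=.
have -> : lift ord0 ord0 = ord_max :> 'I_2 by apply/val_inj.
have -> : lift ord_max ord0 = ord0 :> 'I_2 by apply/val_inj.
by rewrite expr0 expr1 mul1r mulN1r mulrN.
Qed.

Lemma invmx2 (R : fieldType) (M : 'M[R]_2) : \det M != 0 ->
  [/\ invmx M ord0 ord0 = M ord_max ord_max / \det M,
      invmx M ord0 ord_max = - M ord0 ord_max / \det M,
      invmx M ord_max ord0 = - M ord_max ord0 / \det M &
      invmx M ord_max ord_max = M ord0 ord0 / \det M].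
Proof.
move=> M0; rewrite /invmx unitmxE unitfE M0 /adjugate /cofactor !mxE.
rewrite !det_mx11 !mxE/=.
have -> : lift ord0 ord0 = ord_max :> 'I_2 by apply/val_inj.
have -> : lift ord_max ord0 = ord0 :> 'I_2 by apply/val_inj.
by rewrite ?addn0 ?add0n ?expr0 ?expr1 expr2 !mulN1r opprK !mul1r ![_^-1 * _]mulrC.
Qed.

(** * The curvature tensor of a metric in a two-dimensional chart *)

Section Surface.
Context {R : realType}.
Variable G : 'rV[R]_2 -> 'M[R]_2.
Hypothesis mG : smooth_metric G.
Implicit Types (i j k l m : 'I_2) (u : 'rV[R]_2).

Lemma gram_sym u i j : G u i j = G u j i. Proof. by case: mG. Qed.

Lemma gram_smooth i j : smooth (fun u => G u i j). Proof. by case: mG. Qed.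

Lemma gram_det u : \det (G u) != 0. Proof. by case: mG => _ _ /(_ u)/lt0r_neq0. Qed.

Lemma gram_unit u : G u \in unitmx.
Proof. by rewrite unitmxE unitfE gram_det. Qed.

Lemma smooth_det : smooth (fun u => \det (G u)).
Proof.
rewrite (_ : (fun u => _) = fun u => G u ord0 ord0 * G u ord_max ord_max
   - G u ord0 ord_max * G u ord_max ord0).
  have := gram_smooth => s; smooth_tac.
by apply/funext => u; rewrite det2.
Qed.

Lemma smooth_invmx i j : smooth (fun u => invmx (G u) i j).
Proof.
have sdV : smooth (fun u => (\det (G u))^-1).
  by apply: smoothV; [exact: gram_det|exact: smooth_det].
have s := gram_smooth.
have [->|->] := ord2 i; have [->|->] := ord2 j.
- rewrite (_ : (fun u => _) = fun u => G u ord_max ord_max * (\det (G u))^-1).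
    smooth_tac.
  by apply/funext => u; have [] := invmx2 (gram_det u).
- rewrite (_ : (fun u => _) = fun u => - G u ord0 ord_max * (\det (G u))^-1).
    smooth_tac.
  by apply/funext => u; have [] := invmx2 (gram_det u).
- rewrite (_ : (fun u => _) = fun u => - G u ord_max ord0 * (\det (G u))^-1).
    smooth_tac.
  by apply/funext => u; have [] := invmx2 (gram_det u).
- rewrite (_ : (fun u => _) = fun u => G u ord0 ord0 * (\det (G u))^-1).
    smooth_tac.
  by apply/funext => u; have [] := invmx2 (gram_det u).
Qed.

Lemma smooth_christoffel k i j : smooth (christoffel G k i j).
Proof.
apply: (smoothM (smooth_cst _)); apply: smooth_sum => l.
have s := gram_smooth; have si := smooth_invmx.
apply: smoothM => //; smooth_tac.
Qed.

Lemma gram_partial k i j u : partial k (fun q => G q i j) u =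
  christoffel G ord0 k i u * G u ord0 j + christoffel G ord0 k j u * G u i ord0
  + (christoffel G ord_max k i u * G u ord_max j
     + christoffel G ord_max k j u * G u i ord_max).
Proof. by rewrite (christoffel_compat (gram_unit u) gram_sym) sum2. Qed.

(** The second derivatives of [G q k l] in directions i and j commute. Expanding both orders by
    metric compatibility, applied twice, leaves exactly the sum of the two lowered curvature
    components. *)
Lemma curvature_antisym i j k l u :
  \sum_m curvature G m i j k u * G u m l =
  - \sum_m curvature G m i j l u * G u m k.
Proof.
have sG := gram_smooth; have sC := smooth_christoffel.
have two a b : partial a (partial b (fun q => G q k l)) u =
    partial a (christoffel G ord0 b k) u * G u ord0 l
      + christoffel G ord0 b k u * partial a (fun q => G q ord0 l) u
    + (partial a (christoffel G ord0 b l) u * G u k ord0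
      + christoffel G ord0 b l u * partial a (fun q => G q k ord0) u)
    + (partial a (christoffel G ord_max b k) u * G u ord_max l
      + christoffel G ord_max b k u * partial a (fun q => G q ord_max l) u
    + (partial a (christoffel G ord_max b l) u * G u k ord_max
      + christoffel G ord_max b l u * partial a (fun q => G q k ord_max) u)).
  have -> : partial b (fun q => G q k l) = fun q =>
    christoffel G ord0 b k q * G q ord0 l + christoffel G ord0 b l q * G q k ord0
    + (christoffel G ord_max b k q * G q ord_max l
     + christoffel G ord_max b l q * G q k ord_max).
    by apply/funext => q; exact: gram_partial.
  rewrite !partialD; try diff_tac.
  have PM k1 i1 j1 i2 j2 : partial a (fun q => christoffel G k1 i1 j1 q * G q i2 j2) u =
      partial a (christoffel G k1 i1 j1) u * G u i2 j2 +
      christoffel G k1 i1 j1 u * partial a (fun q => G q i2 j2) u.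
    by rewrite (partialM a (smooth_diff u (sC _ _ _)) (smooth_diff u (sG _ _))).
  by rewrite !PM.
have := partialC i j u (sG k l).
rewrite !two !gram_partial !sum2 /curvature !sum2.
rewrite (gram_sym u ord0 l) (gram_sym u ord0 k) (gram_sym u ord_max l).
rewrite (gram_sym u ord_max k) (gram_sym u ord_max ord0).
move: (partial _ _ _) (partial _ _ _) (partial _ _ _) (partial _ _ _).
move=> a1 a2 a3 a4.
move: (partial _ _ _) (partial _ _ _) (partial _ _ _) (partial _ _ _).
move=> b1 b2 b3 b4.
set C := fun k i j => christoffel G k i j u.
rewrite -!/(C _ _ _).
move: C (G u) => C g E.
move/eqP: E; rewrite -subr_eq0 => /eqP E.
apply/eqP; rewrite -subr_eq0 -{}E; apply/eqP; ring.
Qed.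

(** The form R(X,Y)Z = K (<Y,Z> X - <X,Z> Y) of the curvature of a surface. By [curvature_antisym]
    the lowered tensor has a single independent component; raising the index again amounts to
    solving a 2 x 2 system, done after multiplication by [\det (G u)]. *)
Lemma curvatureE l k u : curvature G l ord0 ord_max k u =
  gauss_curvature G u * (G u ord_max k * (l == ord0)%:R - G u ord0 k * (l == ord_max)%:R).
Proof.
have A a b := curvature_antisym ord0 ord_max a b u.
have d0 := gram_det u.
move: (A ord0 ord0) (A ord0 ord_max) (A ord_max ord_max).
rewrite /gauss_curvature !sum2.
have E c : \det (G u) * c = (G u ord0 ord0 * G u ord_max ord_max
   - G u ord0 ord_max * G u ord_max ord0) * c by rewrite det2.
move: E d0; set D := \det _.
rewrite (gram_sym u ord_max ord0) => E D0.
set a := G u ord0 ord0 in E *; set b := G u ord0 ord_max in E *.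
set c := G u ord_max ord_max in E *.
set x00 := curvature G ord0 _ _ ord0 u; set x01 := curvature G ord0 _ _ ord_max u.
set x10 := curvature G ord_max _ _ ord0 u; set x11 := curvature G ord_max _ _ ord_max u.
move=> /eqP A00 A01 /eqP A11.
have {}A00 : x00 * a + x10 * b = 0.
  by apply/eqP; move: A00; rewrite -subr_eq0 opprK -mulr2n mulrn_eq0/=.
have {}A11 : x01 * b + x11 * c = 0.
  by apply/eqP; move: A11; rewrite -subr_eq0 opprK -mulr2n mulrn_eq0/=.
have [->|->] := ord2 l; have [->|->] := ord2 k; rewrite ?eqxx /= -/a -/b -/c;
  rewrite -?/x00 -?/x01 -?/x10 -?/x11 ?(gram_sym u ord_max ord0) -?/b;
  apply: (mulfI D0); rewrite [RHS]mulrA [D * (_ / _)]mulrC divfK// E.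
- have -> : (a * c - b * b) * x00 = c * (x00 * a + x10 * b) - b * (x00 * b + x10 * c) by ring.
  by rewrite A00 A01; ring.
- have -> : (a * c - b * b) * x01 = c * (x01 * a + x11 * b) - b * (x01 * b + x11 * c) by ring.
  by rewrite A11; ring.
- have -> : (a * c - b * b) * x10 = a * (x00 * b + x10 * c) - b * (x00 * a + x10 * b) by ring.
  by rewrite A00 A01; ring.
- have -> : (a * c - b * b) * x11 = a * (x01 * b + x11 * c) - b * (x01 * a + x11 * b) by ring.
  by rewrite A11; ring.
Qed.

End Surface.

(** * The tensor b = g - Hess f, its Codazzi equation and the divergence identity *)

Section SupportForm.
Context {R : realType}.
Local Opaque partial christoffel.
Variables (G : 'rV[R]_2 -> 'M[R]_2) (f : 'rV[R]_2 -> R).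
Hypotheses (mG : smooth_metric G) (sf : smooth f).
Implicit Types (i j k l m : 'I_2) (u : 'rV[R]_2).

Definition support_form i j u : R := G u i j - partial i (partial j f) u
  + (christoffel G ord0 i j u * partial ord0 f u
     + christoffel G ord_max i j u * partial ord_max f u).

Definition support_det u : R := support_form ord0 ord0 u *
  support_form ord_max ord_max u - support_form ord0 ord_max u ^+ 2.

(** This is det G times the trace of G^-1 b. *)
Definition adj_trace u : R :=
  G u ord_max ord_max * support_form ord0 ord0 u
  - 2 * G u ord0 ord_max * support_form ord0 ord_max u
  + G u ord0 ord0 * support_form ord_max ord_max u.

(** This is det G times |grad f|^2, see [adj_normE]. *)
Definition adj_norm u : R :=
  G u ord_max ord_max * partial ord0 f u ^+ 2
  - 2 * G u ord0 ord_max * partial ord0 f u * partial ord_max f u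
  + G u ord0 ord0 * partial ord_max f u ^+ 2.

(* [h^2 \det G] when [f = r^2/2] and [h = r cos alpha]. *)
Definition height_det u : R := 2 * f u * \det (G u) - adj_norm u.

Lemma support_formC i j u : support_form i j u = support_form j i u.
Proof.
rewrite /support_form (gram_sym mG) (partialC i j u sf).
by rewrite !(christoffelC u (gram_sym mG) _ i j).
Qed.

(** Used from left to right, it removes the second derivatives of f in favour of b, so that only G,
    its Christoffel symbols, df and b are left for [ring]. *)
Lemma hessE i j u : partial i (partial j f) u = G u i j - support_form i j u
  + (christoffel G ord0 i j u * partial ord0 f u
     + christoffel G ord_max i j u * partial ord_max f u).
Proof. by rewrite /support_form opprD [X in _ = X + _]addrA subKr subrK. Qed.

Lemma smooth_support_form i j : smooth (support_form i j).
Proof.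
have sG := gram_smooth mG; have sC := smooth_christoffel mG.
apply: smoothD; last apply: smoothD; first by smooth_tac.
  exact: (smoothM (sC _ _ _) (smooth_partial _ sf)).
exact: (smoothM (sC _ _ _) (smooth_partial _ sf)).
Qed.

Lemma smooth_support_det : smooth support_det.
Proof.
have sb := smooth_support_form.
by apply: smoothB; rewrite ?expr2; apply: smoothM.
Qed.

Lemma smooth_adj_trace : smooth adj_trace.
Proof.
have sG := gram_smooth mG; have sb := smooth_support_form.
apply: smoothD; last exact: smoothM.
apply: smoothB; first exact: smoothM.
by apply: smoothM => //; apply: smoothM => //; exact: smooth_cst.
Qed.

Lemma smooth_adj_norm : smooth adj_norm.
Proof. by have sG := gram_smooth mG; rewrite /adj_norm; smooth_tac. Qed.

Lemma smooth_height_det : smooth height_det.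
Proof.
apply: smoothB; last exact: smooth_adj_norm.
by apply: smoothM; [smooth_tac|exact: smooth_det].
Qed.

(** The third derivatives of f cancel by symmetry, and the derivatives of the Christoffel symbols
    combine to the curvature tensor contracted with df, which [curvatureE] reduces to K. *)
Lemma codazzi k u :
  partial ord0 (support_form ord_max k) u - partial ord_max (support_form ord0 k) u =
  christoffel G ord0 ord0 k u * support_form ord0 ord_max u
  + christoffel G ord_max ord0 k u * support_form ord_max ord_max u
  - christoffel G ord0 ord_max k u * support_form ord0 ord0 u
  - christoffel G ord_max ord_max k u * support_form ord0 ord_max u
  + gauss_curvature G u * (G u ord_max k * partial ord0 f u
                         - G u ord0 k * partial ord_max f u).
Proof.
have sG := gram_smooth mG; have sC := smooth_christoffel mG.
have Db i j : partial i (support_form j k) u = partial i (fun q => G q j k) u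
   - partial i (partial j (partial k f)) u
   + (partial i (christoffel G ord0 j k) u * partial ord0 f u
      + christoffel G ord0 j k u * partial i (partial ord0 f) u
     + (partial i (christoffel G ord_max j k) u * partial ord_max f u
      + christoffel G ord_max j k u * partial i (partial ord_max f) u)).
  have PM m : partial i (fun q => christoffel G m j k q * partial m f q) u =
      partial i (christoffel G m j k) u * partial m f u +
      christoffel G m j k u * partial i (partial m f) u.
    by rewrite (partialM i (smooth_diff u (sC _ _ _)) (smooth_diff u (smooth_partial m sf))).
  have dM m : differentiable (fun q => christoffel G m j k q * partial m f q) u.
    by apply: smooth_diff; exact: (smoothM (sC _ _ _) (smooth_partial _ sf)).
  have dB : differentiable (fun q => G q j k - partial j (partial k f) q) u.
    by diff_tac.
  rewrite (partialD i dB (differentiable_add (dM ord0) (dM ord_max))).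
  rewrite (partialD i (dM ord0) (dM ord_max)) !PM; congr (_ + _).
  by rewrite partialB//; diff_tac.
rewrite !Db (partialC ord0 ord_max u (smooth_partial k sf)) !hessE.
have := curvatureE mG ord0 k u; have := curvatureE mG ord_max k u.
rewrite /curvature !sum2 !eqxx !mulr1 !mulr0 subr0 sub0r.
rewrite !(gram_partial mG) (gram_sym mG u ord_max ord0).
rewrite (support_formC ord_max ord0).
move: (gauss_curvature G u) (partial ord_max _ u) => K D3.
rewrite (christoffelC u (gram_sym mG) ord0 ord_max ord0).
rewrite (christoffelC u (gram_sym mG) ord_max ord_max ord0).
move: (partial _ _ u) (partial _ _ u) (partial _ _ u) (partial _ _ u).
move=> c1 c2 c3 c4.
set C := fun k i j => christoffel G k i j u; set b := fun i j => support_form i j u.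
rewrite -!/(C _ _ _) -!/(b _ _).
move: C b (G u) (partial _ _ _) (partial _ _ _) => C b g f1 f2 E1 E2.
have -> : K * (g ord_max k * f2 - g ord0 k * f1) =
  K * g ord_max k * f2 + K * - g ord0 k * f1 by ring.
rewrite -E1 -E2; ring.
Qed.

(** The logarithmic derivative of det G is twice the trace of the Christoffel symbols; it accounts
    for the density factors below. *)
Lemma partial_det k u : partial k (fun q => \det (G q)) u =
  2 * (christoffel G ord0 ord0 k u + christoffel G ord_max ord_max k u)
  * \det (G u).
Proof.
have sG := gram_smooth mG.
rewrite (_ : (fun q => _) = fun q => G q ord0 ord0 * G q ord_max ord_max
   - G q ord0 ord_max * G q ord_max ord0); last first.
  by apply/funext => q; rewrite det2.
rewrite partialB; try diff_tac.
have PM i j k' l : partial k (fun q => G q i j * G q k' l) u =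
    partial k (fun q => G q i j) u * G u k' l +
      G u i j * partial k (fun q => G q k' l) u.
  by rewrite (partialM k (smooth_diff u (sG _ _)) (smooth_diff u (sG _ _))).
rewrite !PM !(gram_partial mG) det2 (gram_sym mG u ord_max ord0).
rewrite !(christoffelC u (gram_sym mG) _ k).
set C := fun k i j => christoffel G k i j u; rewrite -!/(C _ _ _).
move: C (G u) => C g; ring.
Qed.

(** For h^2 = 2 f - |grad f|^2 the equation Hess f = G - b gives d(h^2) = 2 b(grad f, .). The last
    summand comes from the factor det G in h^2 det G. *)
Lemma partial_height_det k u : partial k height_det u =
  2 * (support_form k ord0 u * (G u ord_max ord_max * partial ord0 f u
                              - G u ord0 ord_max * partial ord_max f u)
     + support_form k ord_max u * (G u ord0 ord0 * partial ord_max f u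
                              - G u ord0 ord_max * partial ord0 f u))
  + 2 * (christoffel G ord0 ord0 k u + christoffel G ord_max ord_max k u)
    * height_det u.
Proof.
have sG := gram_smooth mG; have sD := smooth_det mG.
have dG i j : differentiable (fun q => G q i j) u by exact: smooth_diff.
have df i : differentiable (partial i f) u by diff_tac.
have PM (g h : 'rV[R]_2 -> R) (dg : differentiable g u) (dh : differentiable h u) :=
  partialM k dg dh.
have dM := @differentiable_mul R 2 _ _ u.
have d2 : differentiable (fun=> 2 : R) u by exact: differentiable_cst.
rewrite /height_det /adj_norm.
rewrite partialB; first last.
- by diff_tac.
- by apply: smooth_diff; apply: smoothM => //; smooth_tac.
rewrite partialD; [|by diff_tac..].
rewrite partialB; [|by diff_tac..].
rewrite (PM _ _ (dM _ _ d2 (smooth_diff u sf)) (smooth_diff u sD)).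
rewrite (PM _ _ d2 (smooth_diff u sf)) partial_cst partial_det.
have Psq i : partial k (fun q => partial i f q ^+ 2) u =
    2 * partial k (partial i f) u * partial i f u.
  rewrite (_ : (fun q => _) = fun q => partial i f q * partial i f q) //.
  rewrite (PM _ _ (df i) (df i)); set a := partial k _ _; set b := partial i f u.
  ring.
have dsq i : differentiable (fun q => partial i f q ^+ 2) u.
  exact: (dM _ _ (df i) (df i)).
rewrite (PM _ _ (dG ord0 ord0) (dsq ord_max)) !Psq.
rewrite (PM _ _ (dG ord_max ord_max) (dsq ord0)) !Psq.
have dG01 := dM _ _ d2 (dG ord0 ord_max).
rewrite (PM _ _ (dM _ _ dG01 (df ord0)) (df ord_max)).
rewrite (PM _ _ dG01 (df ord0)) (PM _ _ d2 (dG ord0 ord_max)) partial_cst.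
rewrite !hessE !(gram_partial mG) det2 (gram_sym mG u ord_max ord0).
rewrite !(christoffelC u (gram_sym mG) _ k).
rewrite (gram_sym mG u k ord0) (gram_sym mG u k ord_max).
rewrite [support_form k ord0]lock [support_form k ord_max]lock.
have [->|->] := ord2 k; rewrite -?lock ?(gram_sym mG u ord_max ord0);
  rewrite ?(support_formC ord_max ord0);
  rewrite ?(christoffelC u (gram_sym mG) _ ord_max ord0);
  set C := fun k i j => christoffel G k i j u; rewrite -!/(C _ _ _);
  set b := fun i j => support_form i j u; rewrite -!/(b _ _);
  move: C b (G u) (f u) (partial _ _ u) (partial _ _ u) => C b g f0 p q; ring.
Qed.

(** With [flux1], the components of adj(b) df / (h sqrt(det G)). This is sqrt(det G) V: raising the
    indices of adj(b) df contributes a factor 1 / det G. *)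
Definition flux0 u : R := (support_form ord_max ord_max u * partial ord0 f u
  - support_form ord0 ord_max u * partial ord_max f u) / Num.sqrt (height_det u).

Definition flux1 u : R := (support_form ord0 ord0 u * partial ord_max f u
  - support_form ord0 ord_max u * partial ord0 f u) / Num.sqrt (height_det u).

Local Opaque support_form.

(** Up to the density factor there are three contributions. Differentiating b gives K |grad f|^2 by
    Codazzi; differentiating df gives tr adj(b) - 2 det b, as Hess f = G - b; differentiating 1/h
    gives - det b |grad f|^2 / h^2, as adj(b) b = det b. Then |grad f|^2 = 2 f - h^2 is
    substituted. *)
Lemma div_flux u : (forall q, 0 < height_det q) ->
  partial ord0 flux0 u + partial ord_max flux1 u =
  2 * f u * \det (G u) * (gauss_curvature G u - support_det u / height_det u)
      / Num.sqrt (height_det u)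
  + adj_trace u / Num.sqrt (height_det u)
  - (gauss_curvature G u * Num.sqrt (height_det u)
     + support_det u / Num.sqrt (height_det u)).
Proof.
move=> Y0; have sb := smooth_support_form.
have db i j : differentiable (support_form i j) u by exact: smooth_diff.
have df i : differentiable (partial i f) u by diff_tac.
have PM (k : 'I_2) (g h : 'rV[R]_2 -> R) (dg : differentiable g u)
  (dh : differentiable h u) := partialM k dg dh.
have dM := @differentiable_mul R 2 _ _ u.
have dY : differentiable height_det u by apply: smooth_diff; exact: smooth_height_det.
have PN k (N : 'rV[R]_2 -> R) : differentiable N u ->
    partial k (fun q => N q / Num.sqrt (height_det q)) u =
    (partial k N u - N u * partial k height_det u / (2 * height_det u))
      / Num.sqrt (height_det u).
  move=> dN.
  have s0 : Num.sqrt (height_det u) != 0 by rewrite gt_eqF// sqrtr_gt0.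
  have ds := differentiable_sqrt dY (Y0 u).
  rewrite (PM _ _ _ dN (differentiable_inv ds s0)) (partialV _ ds s0).
  rewrite (partial_sqrt _ dY (Y0 u)).
  have := sqr_sqrtr (ltW (Y0 u)).
  move: s0; set s := Num.sqrt _ => s0 <-.
  move: (partial _ _ _) (partial _ _ _) (N u) s0 => a b c s0.
  by field.
rewrite /flux0 /flux1.
have bf i j k := dM _ _ (db i j) (df k).
have dN i j k i' j' k' : differentiable
    (fun q => support_form i j q * partial k f q - support_form i' j' q * partial k' f q) u.
  exact: (differentiableB (bf i j k) (bf i' j' k')).
have P2 m i j k i' j' k' : partial m
    (fun q => support_form i j q * partial k f q - support_form i' j' q * partial k' f q) u
    = partial m (support_form i j) u * partial k f u
      + support_form i j u * partial m (partial k f) u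
      - (partial m (support_form i' j') u * partial k' f u
      + support_form i' j' u * partial m (partial k' f) u).
  rewrite (partialB m (bf i j k) (bf i' j' k')) (PM m _ _ (db i j) (df k)).
  by rewrite (PM m _ _ (db i' j') (df k')).
rewrite (PN ord0 _ (dN _ _ _ _ _ _)) (PN ord_max _ (dN _ _ _ _ _ _)) !P2.
have := codazzi ord0 u; have := codazzi ord_max u.
rewrite !partial_height_det (partialC ord_max ord0 u sf).
have -> : support_form ord_max ord0 = support_form ord0 ord_max.
  by apply/funext => q; exact: support_formC.
rewrite !hessE /adj_trace /support_det.
rewrite !(christoffelC u (gram_sym mG) _ ord_max ord0) (gram_sym mG u ord_max ord0).
have Ys := sqr_sqrtr (ltW (Y0 u)).
have Yn0 : height_det u != 0 by rewrite gt_eqF.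
have : height_det u = 2 * f u * (G u ord0 ord0 * G u ord_max ord_max
  - G u ord0 ord_max ^+ 2) - adj_norm u.
  by rewrite {1}/height_det det2 (gram_sym mG u ord_max ord0) expr2.
rewrite det2 (gram_sym mG u ord_max ord0) /adj_norm.
have s0 : Num.sqrt (height_det u) != 0 by rewrite gt_eqF// sqrtr_gt0.
move: s0 Ys Yn0; set s := Num.sqrt _.
move: (height_det u) s => Y s s0 Ys Yn0 YE.
(* From here on s = sqrt Y occurs only as a common denominator, so s and Y can be treated as
   independent. *)
have Ks K : K * s = K * Y / s by rewrite -Ys; field.
rewrite Ks; move: (gauss_curvature G u) => K {Ks}.
set C := fun k i j => christoffel G k i j u; rewrite -!/(C _ _ _).
set b := fun i j => support_form i j u; rewrite -!/(b _ _).
move: C b (G u) (f u) (partial ord0 f u) (partial ord_max f u) YE => C b g f0 p q.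
move: (partial _ _ u) (partial _ _ u) (partial _ _ u) (partial _ _ u).
move=> b1 b2 b3 b4 YE E1 E2.
(* Eliminates f itself, through 2 f det G = Y + det G |grad f|^2. *)
have -> : 2 * f0 * (g ord0 ord0 * g ord_max ord_max - g ord0 ord_max * g ord0 ord_max) =
    Y + (g ord_max ord_max * p ^+ 2 - 2 * g ord0 ord_max * p * q +
     g ord0 ord0 * q ^+ 2) by rewrite YE; ring.
(* The two Codazzi equations remove the derivatives of b in direction 0 that occur; those in
   direction 1 then cancel. *)
move/(canRL (subrK _)): E1 => ->; move/eqP: E2; rewrite subr_eq => /eqP ->.
clear -s0 Yn0; field.
by rewrite Yn0 s0.
Qed.

End SupportForm.

(** * Connection and curvature of the base metric A of the cone *)

Section ConeBase.
Context {R : realType}.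
Variables (G : 'rV[R]_2 -> 'M[R]_2) (f : 'rV[R]_2 -> R).
Hypotheses (mG : smooth_metric G) (sf : smooth f) (f_gt0 : forall u, 0 < f u).
Hypothesis Y_gt0 : forall u, 0 < height_det G f u.
Implicit Types (i j k l m : 'I_2) (u : 'rV[R]_2).

Local Notation b := (support_form G f).
Local Notation Y := (height_det G f).

(* With [f = r^2/2], the entries of [(G - dr dr)/r^2]. *)
Definition cone_base u : 'M[R]_2 := \matrix_(i, j)
  (G u i j * (2 * f u)^-1 - partial i f u * partial j f u * ((2 * f u)^-1 * (2 * f u)^-1)).

Local Notation A := cone_base.
Local Notation phi u := (2 * f u)^-1.

(** The vector n = grad f / h^2. Multiplied by -h, it is the spherical part of the unit normal of
    M_r. *)
Definition normal_dir l u : R := if l == ord0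
  then (G u ord_max ord_max * partial ord0 f u
        - G u ord0 ord_max * partial ord_max f u) / Y u
  else (G u ord0 ord0 * partial ord_max f u
        - G u ord0 ord_max * partial ord0 f u) / Y u.

(** The spherical components of the Gauss formula of M_r, solved for the symbols of A. The mixed
    Christoffel symbols of the cone produce the terms in dr/r = df/(2f), and the normal component,
    II times the spherical part -h n of the normal, produces n b. *)
Definition cone_christoffel l j k u : R := christoffel G l j k u
  - (partial j f u * (l == k)%:R + partial k f u * (l == j)%:R) * phi u
  + normal_dir l u * b j k u.

Lemma double_neq0 u : 2 * f u != 0.
Proof. by rewrite mulf_neq0// gt_eqF. Qed.

Lemma height_det_neq0 u : Y u != 0. Proof. by rewrite gt_eqF. Qed.

Lemma height_detE u : Y u = 2 * f u * (G u ord0 ord0 * G u ord_max ord_max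
  - G u ord0 ord_max ^+ 2)
  - (G u ord_max ord_max * partial ord0 f u ^+ 2
  - 2 * G u ord0 ord_max * partial ord0 f u * partial ord_max f u
  + G u ord0 ord0 * partial ord_max f u ^+ 2).
Proof. by rewrite /height_det det2 (gram_sym mG u ord_max ord0) expr2. Qed.

(** A rank-one change of a determinant: A is G / (2f) minus the square of df / (2f). Hence det A > 0
    is the positivity of h^2. *)
Lemma det_cone_base u : \det (A u) = Y u * phi u ^+ 3.
Proof.
rewrite det2 !mxE height_detE (gram_sym mG u ord_max ord0).
have := double_neq0 u; move: (f u) (G u) (partial _ _ _) (partial _ _ _) => c g p q c0.
field.
by move: c0; apply: contraNN => /eqP ->; rewrite mulr0.
Qed.

Lemma smooth_phi : smooth (fun u => phi u).
Proof. by apply: smoothV; [exact: double_neq0|smooth_tac]. Qed.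

Lemma smooth_metric_cone_base : smooth_metric A.
Proof.
split=> [u i j|i j|u].
- by rewrite !mxE (gram_sym mG) (mulrC (partial i f u)).
- have sG := gram_smooth mG; have sp := smooth_phi.
  rewrite (_ : (fun u => _) = fun u => G u i j * phi u
     - partial i f u * partial j f u * (phi u * phi u)).
    apply: smoothB; first exact: smoothM.
    by apply: smoothM; apply: smoothM => //; exact: smooth_partial.
  by apply/funext => u; rewrite mxE.
- by rewrite det_cone_base mulr_gt0// exprn_gt0// invr_gt0 mulr_gt0.
Qed.

Lemma normal_dir_cone_base j u :
  normal_dir ord0 u * A u ord0 j + normal_dir ord_max u * A u ord_max j
  = partial j f u * phi u ^+ 2.
Proof.
rewrite /normal_dir !mxE /=.
have := height_det_neq0 u; have := double_neq0 u; rewrite height_detE.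
have [->|->] := ord2 j; rewrite ?(gram_sym mG u ord_max ord0);
  move: (f u) (G u) (partial _ _ u) (partial _ _ u) => c g p q c0 Y0; field;
  by rewrite Y0 andbT; move: c0; apply: contraNN => /eqP ->; rewrite mulr0.
Qed.

Lemma partial_phi k u : partial k (fun q => phi q) u = - 2 * partial k f u * phi u ^+ 2.
Proof.
have d2 : differentiable (fun=> 2 : R) u by exact: differentiable_cst.
have d := differentiable_mul d2 (smooth_diff u sf).
rewrite (partialV k d (double_neq0 u)) (partialM k d2 (smooth_diff u sf)) partial_cst.
by rewrite mul0r add0r exprVn mulNr mulNr.
Qed.

Lemma partial_cone_base k i j u : partial k (fun q => A q i j) u =
  partial k (fun q => G q i j) u * phi u
  + G u i j * (- 2 * partial k f u * phi u ^+ 2)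
  - ((partial k (partial i f) u * partial j f u
      + partial i f u * partial k (partial j f) u) * phi u ^+ 2
     - partial i f u * partial j f u * (4 * partial k f u * phi u ^+ 3)).
Proof.
have -> : (fun q => A q i j) = (fun u => G u i j * phi u
     - partial i f u * partial j f u * (phi u * phi u)).
  by apply/funext => q; rewrite mxE.
have dp : differentiable (fun q => phi q) u by apply: smooth_diff; exact: smooth_phi.
have dg : differentiable (fun q => G q i j) u by apply: smooth_diff; exact: gram_smooth.
have df l : differentiable (partial l f) u by diff_tac.
rewrite (partialB k (differentiable_mul dg dp)
  (differentiable_mul (differentiable_mul (df i) (df j)) (differentiable_mul dp dp))).
rewrite (partialM k dg dp) (partialM k (differentiable_mul (df i) (df j))
  (differentiable_mul dp dp)) (partialM k (df i) (df j)) (partialM k dp dp).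
rewrite !partial_phi.
move: (partial _ _ _) (partial _ _ _) (partial _ _ _) (partial _ _ _).
move: (partial _ _ _) (partial _ _ _) (phi u) (G u) => *; ring.
Qed.

(** Verified by [christoffel_unique]. After lowering with A the summand n b becomes df b / (2f)^2 by
    [normal_dir_cone_base], and the entries of A can be expanded. *)
Lemma christoffel_cone_base l j k u :
  christoffel A l j k u = cone_christoffel l j k u.
Proof.
have mA := smooth_metric_cone_base.
pose C l i j := cone_christoffel l i j u.
rewrite (@christoffel_unique _ _ A u (gram_unit mA u) C)//.
- exact: gram_sym.
- move=> {}l i {}j; rewrite /C /cone_christoffel (support_formC mG sf i j).
  by rewrite (christoffelC u (gram_sym mG)) [in X in _ - X * _]addrC.
- move=> {}l i {}j; rewrite sum2.
  have low a c d : C ord0 a c * A u ord0 d + C ord_max a c * A u ord_max d =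
     christoffel G ord0 a c u * A u ord0 d + christoffel G ord_max a c u * A u ord_max d
     - phi u * (partial a f u * A u c d + partial c f u * A u a d)
     + partial d f u * phi u ^+ 2 * b a c u.
    rewrite -normal_dir_cone_base /C /cone_christoffel.
    have [->|->] := ord2 a; have [->|->] := ord2 c; rewrite ?eqxx /=;
    move: (christoffel _ _ _ _ _) (christoffel _ _ _ _ _) (A u) (phi u);
    move=> c0 c1 a' p; move: (normal_dir _ _) (normal_dir _ _) (partial _ _ _) (b _ _ _);
    try move: (partial _ _ _); move=> *; ring.
  rewrite addrACA low [X in _ = _ + X](_ : _ =
     C ord0 l j * A u ord0 i + C ord_max l j * A u ord_max i); last first.
    by rewrite (gram_sym mA u i ord0) (gram_sym mA u i ord_max).
  rewrite low partial_cone_base (gram_partial mG) !(hessE G) !mxE.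
  rewrite (gram_sym mG u i ord0) (gram_sym mG u i ord_max) (gram_sym mG u j i).
  set X := fun l j => b l j u; rewrite -!/(X _ _).
  move: (christoffel _ _ _ _ _) (christoffel _ _ _ _ _).
  move: (christoffel _ _ _ _ _) (christoffel _ _ _ _ _) X.
  move: (partial _ _ _) (partial _ _ _) (partial _ _ _) (G u) (phi u).
  move: (partial _ _ _) (partial _ _ _).
  by move=> *; ring.
Qed.

(** This is det G times b with its second index raised. *)
Definition support_adj i l u : R := if l == ord0
  then b i ord0 u * G u ord_max ord_max - b i ord_max u * G u ord0 ord_max
  else b i ord_max u * G u ord0 ord0 - b i ord0 u * G u ord0 ord_max.

Lemma smooth_normal_dir l : smooth (normal_dir l).
Proof.
have sG := gram_smooth mG.
have sYV : smooth (fun u => (Y u)^-1).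
  by apply: smoothV => [q|]; [exact: height_det_neq0|exact: smooth_height_det].
by have [->|->] := ord2 l; apply: (smoothM _ sYV); smooth_tac.
Qed.

(** The covariant derivative of grad f / h^2: Hess f = G - b gives the first fraction, and d(h^2) =
    2 h^2 b(n, .) gives the last term. *)
Lemma partial_normal_dir i l u : partial i (normal_dir l) u =
  (\det (G u) * (i == l)%:R - support_adj i l u) / Y u
  - (christoffel G l i ord0 u * normal_dir ord0 u
     + christoffel G l i ord_max u * normal_dir ord_max u)
  - 2 * normal_dir l u * (b i ord0 u * normal_dir ord0 u
                          + b i ord_max u * normal_dir ord_max u).
Proof.
have sG := gram_smooth mG; have sY := smooth_height_det mG sf.
have df k : differentiable (partial k f) u by diff_tac.
have dG j k : differentiable (fun q => G q j k) u by exact: smooth_diff.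
have dY : differentiable Y u by exact: smooth_diff.
have Pn0 : partial i (normal_dir ord0) u =
    ((partial i (fun q => G q ord_max ord_max) u * partial ord0 f u
      + G u ord_max ord_max * partial i (partial ord0 f) u
      - (partial i (fun q => G q ord0 ord_max) u * partial ord_max f u
      + G u ord0 ord_max * partial i (partial ord_max f) u))
     - normal_dir ord0 u * partial i Y u) / Y u.
  have dN := differentiable_sub (differentiable_mul (dG ord_max ord_max) (df ord0))
    (differentiable_mul (dG ord0 ord_max) (df ord_max)).
  rewrite (partial_div i dN dY (height_det_neq0 u)).
  rewrite (partialB i (differentiable_mul (dG ord_max ord_max) (df ord0))
    (differentiable_mul (dG ord0 ord_max) (df ord_max))).
  by rewrite (partialM i (dG ord_max ord_max) (df ord0)) (partialM i (dG ord0 ord_max) (df ord_max)).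
have Pn1 : partial i (normal_dir ord_max) u =
    ((partial i (fun q => G q ord0 ord0) u * partial ord_max f u
      + G u ord0 ord0 * partial i (partial ord_max f) u
      - (partial i (fun q => G q ord0 ord_max) u * partial ord0 f u
      + G u ord0 ord_max * partial i (partial ord0 f) u))
     - normal_dir ord_max u * partial i Y u) / Y u.
  have dN := differentiable_sub (differentiable_mul (dG ord0 ord0) (df ord_max))
    (differentiable_mul (dG ord0 ord_max) (df ord0)).
  rewrite (partial_div i dN dY (height_det_neq0 u)).
  rewrite (partialB i (differentiable_mul (dG ord0 ord0) (df ord_max))
    (differentiable_mul (dG ord0 ord_max) (df ord0))).
  by rewrite (partialM i (dG ord0 ord0) (df ord_max)) (partialM i (dG ord0 ord_max) (df ord0)).
have := height_det_neq0 u.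
have [->|->] := ord2 l; rewrite ?Pn0 ?Pn1 /normal_dir /= /support_adj /=;
  rewrite (partial_height_det mG sf) !(hessE G f) !(gram_partial mG) det2;
  rewrite !(gram_sym mG u ord_max ord0);
  [have [->|->] := ord2 i|have [->|->] := ord2 i];
  rewrite ?eqxx /= ?(support_formC mG sf ord_max ord0) ?(gram_sym mG u ord_max ord0);
  rewrite ?(christoffelC u (gram_sym mG) _ ord_max ord0);
  set B := (fun i j => b i j u); rewrite -!/(B _ _);
  set C := (fun k i j => christoffel G k i j u); rewrite -!/(C _ _ _);
  move: B C (G u) (Y u) (partial ord0 f u) (partial ord_max f u);
  by move=> B C g y p q y0; field.
Qed.

(** In geometric terms K_A - 1 = r^4 (K - det B) / h^2. This is the Gauss equation: the spherical
    planes at rho = r have curvature (K_A - 1) / r^2, and a tangent plane of M_r sees the fraction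
    cos^2 alpha = h^2 / r^2 of it. The proof is intrinsic, from the symbols of A. *)
Lemma gauss_curvature_cone_base u : gauss_curvature A u =
  1 + (2 * f u) ^+ 2 * \det (G u)
      * (gauss_curvature G u - support_det G f u / Y u) / Y u.
Proof.
have mA := smooth_metric_cone_base.
have sG := gram_smooth mG; have sC := smooth_christoffel mG.
have sp := smooth_phi; have sb := smooth_support_form mG sf.
have sY := smooth_height_det mG sf.
have snl := smooth_normal_dir.
have PnB i l j k : partial i (fun q => normal_dir l q * b j k q) u =
    partial i (normal_dir l) u * b j k u + normal_dir l u * partial i (b j k) u.
  by rewrite (partialM i (smooth_diff u (snl l)) (smooth_diff u (sb j k))).
have df l : differentiable (partial l f) u by diff_tac.
have dG i j : differentiable (fun q => G q i j) u by exact: smooth_diff.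
have dp : differentiable (fun q => phi q) u by exact: smooth_diff.
have dY : differentiable Y u by exact: smooth_diff.
have dC l j k : differentiable (christoffel G l j k) u by exact: smooth_diff.
have dnb l j k : differentiable (fun q => normal_dir l q * b j k q) u.
  exact: (differentiable_mul (smooth_diff u (snl l)) (smooth_diff u (sb j k))).
have dcst (c : R) : differentiable (fun=> c : R) u by exact: differentiable_cst.
have PC i l j k : partial i (christoffel A l j k) u =
    partial i (christoffel G l j k) u
    - ((partial i (partial j f) u * (l == k)%:R
       + partial i (partial k f) u * (l == j)%:R) * phi u
      + (partial j f u * (l == k)%:R + partial k f u * (l == j)%:R)
        * (- 2 * partial i f u * phi u ^+ 2))
    + (partial i (normal_dir l) u * b j k u + normal_dir l u * partial i (b j k) u).
  rewrite (_ : christoffel A l j k = cone_christoffel l j k); last first.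
    by apply/funext => q; exact: (christoffel_cone_base).
  have dM1 := differentiable_mul (df j) (dcst (l == k)%:R).
  have dM2 := differentiable_mul (df k) (dcst (l == j)%:R).
  have dS := differentiable_add dM1 dM2.
  rewrite (partialD i (differentiableB (dC l j k) (differentiable_mul dS dp)) (dnb l j k)).
  rewrite (partialB i (dC l j k) (differentiable_mul dS dp)) (partialM i dS dp).
  rewrite (partialD i dM1 dM2) (partialM i (df j) (dcst _)) (partialM i (df k) (dcst _)).
  by rewrite !partial_cst PnB (partial_phi) !mulr0 !addr0.
have E0 := curvatureE mG ord0 ord_max u; have E1 := curvatureE mG ord_max ord_max u.
have Co := codazzi mG sf ord_max u.
rewrite {1}/gauss_curvature (det_cone_base) sum2 {1 2}/curvature !sum2.
rewrite !PC !partial_normal_dir !christoffel_cone_base /cone_christoffel /support_adj.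
rewrite !(hessE G f) !eqxx /= !mxE.
move: E0 E1 Co; rewrite /curvature !sum2 !eqxx /=.
rewrite /support_det.
rewrite ?(support_formC mG sf ord_max ord0) ?(gram_sym mG u ord_max ord0).
rewrite ?(christoffelC u (gram_sym mG) _ ord_max ord0).
have := height_det_neq0 u; have := double_neq0 u; have := height_detE u.
rewrite /normal_dir /= !det2 (gram_sym mG u ord_max ord0).
set B := fun i j => b i j u; rewrite -!/(B _ _).
set C := fun k i j => christoffel G k i j u; rewrite -!/(C _ _ _).
move: (gauss_curvature G u) B C (G u) (Y u) (f u) (partial ord0 f u) (partial ord_max f u).
move: (partial _ (support_form _ _ _ _) u) (partial _ (support_form _ _ _ _) u).
move: (partial _ _ u) (partial _ _ u) (partial _ _ u) (partial _ _ u).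
move=> c1 c2 c3 c4 b1 b2 K B C g Y f0 p q YE f0n Yn E0 E1 Co.
have f0n0 : f0 != 0 by move: f0n; apply: contraNN => /eqP ->; rewrite mulr0.
have solve_for (a b X r : R) : a - b + X = r -> a = r + b - X.
  by move=> <-; ring.
(* The curvature equations of G remove one derivative of its Christoffel symbols for each upper
   index, and Codazzi removes one derivative of b. The other such derivatives cancel. *)
rewrite (solve_for _ _ _ _ E0) (solve_for _ _ _ _ E1) {E0 E1}.
move/(canRL (subrK _)): Co => ->.
rewrite YE in Yn *.
clear -f0n0 Yn.
move: (g ord0 ord0) (g ord0 ord_max) (g ord_max ord_max) Yn => g00 g01 g11 Yn.
move: (B ord0 ord0) (B ord0 ord_max) (B ord_max ord_max) => b00 b01 b11.
move: (C ord0 ord0 ord0) (C ord0 ord0 ord_max) (C ord0 ord_max ord_max) => u00 u01 u11.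
move: (C ord_max ord0 ord0) (C ord_max ord0 ord_max) (C ord_max ord_max ord_max).
move=> v00 v01 v11.
field.
by rewrite f0n0 Yn.
Qed.

End ConeBase.

(** * The cone and its hypersurface *)

Section Cone.
Context {R : realType}.
Implicit Types (p : 'rV[R]_(1 + 2)) (a b c d : 'I_2) (i j k l : 'I_(1 + 2)).

Local Notation z := (lshift 2 (ord0 : 'I_1)).
Local Notation s a := (rshift 1 a).

Lemma ord3_ind (P : 'I_(1 + 2) -> Prop) : P z -> (forall a, P (s a)) -> forall i, P i.
Proof.
by move=> Pz Ps i; case: (split_ordP i) => [j ->|a ->//]; rewrite (ord1 j).
Qed.

Lemma sum3 (V : nmodType) (F : 'I_(1 + 2) -> V) :
  \sum_i F i = F z + (F (s ord0) + F (s ord_max)).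
Proof. by rewrite big_split_ord/= big_ord1 sum2. Qed.

Lemma rhoE p : rho p = p 0 z. Proof. by rewrite /rho mxE. Qed.

Lemma differentiable_rho p : differentiable (@rho R) p.
Proof.
rewrite (_ : @rho R = fun q => q 0 z); first exact: differentiable_coord.
by apply/funext => q; exact: rhoE.
Qed.

Lemma partial_rho i p : partial i (@rho R) p = (i == z)%:R.
Proof.
rewrite (_ : @rho R = fun q => q 0 z); first exact: partial_coord.
by apply/funext => q; exact: rhoE.
Qed.

Lemma differentiable_base (h : 'rV[R]_2 -> R) p : differentiable h (rsubmx p) ->
  differentiable (fun q : 'rV[R]_(1 + 2) => h (rsubmx q)) p.
Proof. by move=> dh; apply: differentiable_comp => //; exact: differentiable_rsubmx. Qed.

Lemma partial_base i (h : 'rV[R]_2 -> R) p : differentiable h (rsubmx p) ->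
  partial i (fun q : 'rV[R]_(1 + 2) => h (rsubmx q)) p =
  \sum_a (i == s a)%:R * partial a h (rsubmx p).
Proof.
move=> dh; rewrite (@partial_comp _ _ _ rsubmx)//; last exact: differentiable_rsubmx.
apply: eq_bigr => a _; congr (_ * _).
under eq_fun do rewrite mxE.
exact: partial_coord.
Qed.

Lemma partial_base_rho (h : 'rV[R]_2 -> R) p : differentiable h (rsubmx p) ->
  partial z (fun q : 'rV[R]_(1 + 2) => h (rsubmx q)) p = 0.
Proof.
move=> dh; rewrite partial_base// big1// => a _.
by rewrite eq_lrshift mul0r.
Qed.

Lemma partial_base_sphere a (h : 'rV[R]_2 -> R) p : differentiable h (rsubmx p) ->
  partial (s a) (fun q : 'rV[R]_(1 + 2) => h (rsubmx q)) p = partial a h (rsubmx p).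
Proof.
move=> dh; rewrite partial_base// (bigD1 a)//= eqxx mul1r big1 ?addr0// => b ba.
by rewrite (inj_eq (@rshift_inj _ _)) eq_sym (negbTE ba) mul0r.
Qed.

Variable A : 'rV[R]_2 -> 'M[R]_2.
Hypothesis mA : smooth_metric A.

Definition cone p : 'M[R]_(1 + 2) :=
  block_mx 1%:M 0 0 (rho p ^+ 2 *: A (rsubmx p)).

Lemma cone_zz p : cone p z z = 1.
Proof. by rewrite /cone block_mxEul mxE eqxx. Qed.
Lemma cone_zs p a : cone p z (s a) = 0.
Proof. by rewrite /cone block_mxEur mxE. Qed.
Lemma cone_sz p a : cone p (s a) z = 0.
Proof. by rewrite /cone block_mxEdl mxE. Qed.
Lemma cone_ss p a b : cone p (s a) (s b) = rho p ^+ 2 * A (rsubmx p) a b.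
Proof. by rewrite /cone block_mxEdr mxE. Qed.
Definition coneE := (cone_zz, cone_zs, cone_sz, cone_ss).

Lemma cone_sym p i j : cone p i j = cone p j i.
Proof.
elim/ord3_ind: i => [|a]; elim/ord3_ind: j => [|b]; rewrite ?coneE//.
by rewrite (gram_sym mA).
Qed.

Lemma det_cone p : \det (cone p) = rho p ^+ 4 * \det (A (rsubmx p)).
Proof. by rewrite /cone det_ublock det1 mul1r detZ -exprM. Qed.

Lemma cone_unit p : rho p != 0 -> cone p \in unitmx.
Proof.
by move=> p0; rewrite unitmxE unitfE det_cone mulf_neq0 ?expf_neq0// gram_det.
Qed.

Lemma invmx_cone p : rho p != 0 ->
  invmx (cone p) = block_mx 1%:M 0 0 ((rho p ^+ 2)^-1 *: invmx (A (rsubmx p))).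
Proof.
move=> p0; set B := block_mx _ _ _ _.
have AB : B *m cone p = 1%:M.
  rewrite /B /cone mulmx_block !mul0mx !mulmx0 !addr0 !add0r mulmx1.
  rewrite -scalemxAl -scalemxAr scalerA mulVf ?expf_neq0// scale1r.
  by rewrite mulVmx ?gram_unit// -scalar_mx_block.
by rewrite -[LHS]mul1mx -AB mulmxK// cone_unit.
Qed.

(** The Levi-Civita symbols of drho^2 + rho^2 A, by the kind of each index: [inl] is the radial one,
    [inr] the spherical ones. *)
Definition cone_gamma l j k p : R :=
  match fintype.split l, fintype.split j, fintype.split k with
  | inl _, inr a, inr b => - (rho p * A (rsubmx p) a b)
  | inr c, inl _, inr b => (c == b)%:R / rho p
  | inr c, inr a, inl _ => (c == a)%:R / rho p
  | inr c, inr a, inr b => christoffel A c a b (rsubmx p)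
  | _, _, _ => 0
  end.

Lemma split_z : fintype.split z = inl ord0 :> 'I_1 + 'I_2.
Proof. exact: (unsplitK (inl ord0)). Qed.
Lemma split_s a : fintype.split (s a) = inr a :> 'I_1 + 'I_2.
Proof. exact: (unsplitK (inr a)). Qed.

Lemma christoffel_cone l j k p : rho p != 0 ->
  christoffel cone l j k p = cone_gamma l j k p.
Proof.
move=> p0; pose C l j k := cone_gamma l j k p.
have sA := gram_smooth mA.
rewrite (@christoffel_unique _ _ cone p (cone_unit p0) C)//.
- exact: cone_sym.
- move=> {}l i {}j; rewrite /C /cone_gamma.
  elim/ord3_ind: l => [|c]; elim/ord3_ind: i => [|a]; elim/ord3_ind: j => [|b];
  rewrite ?split_z ?split_s//.
    by rewrite (gram_sym mA).
  by rewrite (christoffelC _ (gram_sym mA)).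
- move=> {l j k}; have Pss l a b : partial l (fun q => cone q (s a) (s b)) p =
     2 * (l == z)%:R * rho p * A (rsubmx p) a b +
     rho p ^+ 2 * partial l (fun q => A (rsubmx q) a b) p.
    have dA : differentiable (fun q : 'rV[R]_(1 + 2) => A (rsubmx q) a b) p.
      by apply: (@differentiable_base (fun u => A u a b)); exact: smooth_diff.
    have dr := differentiable_rho p.
    rewrite (_ : (fun q => _) = fun q => rho q * rho q * A (rsubmx q) a b); last first.
      by apply/funext => q; rewrite cone_ss expr2.
    rewrite (partialM l (differentiable_mul dr dr) dA) (partialM l dr dr) !partial_rho.
    by move: (l == z)%:R (rho p) (A _ _ _) (partial _ _ _) => *; ring.
  have dA a b : differentiable (fun u => A u a b) (rsubmx p) by exact: smooth_diff.
  have P1 l : partial l (fun q => cone q z z) p = 0.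
    by under eq_fun do rewrite cone_zz; exact: partial_cst.
  have P2 l a : partial l (fun q => cone q z (s a)) p = 0.
    by under eq_fun do rewrite cone_zs; exact: partial_cst.
  have P3 l a : partial l (fun q => cone q (s a) z) p = 0.
    by under eq_fun do rewrite cone_sz; exact: partial_cst.
  move=> l i j; rewrite sum3 /C /cone_gamma.
  elim/ord3_ind: l => [|c]; elim/ord3_ind: i => [|a]; elim/ord3_ind: j => [|b];
  rewrite ?P1 ?P2 ?P3 ?Pss ?coneE ?split_z ?split_s ?eqxx ?eq_rlshift
    ?mulr0 ?mul0r ?addr0//.
  + rewrite (partial_base_rho (dA a b)).
    have [->|->] := ord2 a; have [->|->] := ord2 b; rewrite ?eqxx /=;
    move: (rho p) p0 (A _) => x x0 g; by field.
  + have [->|->] := ord2 c; rewrite ?eqxx /=;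
    move: (rho p) p0 (A _) => x x0 g; by field.
  + have [->|->] := ord2 c; rewrite ?eqxx /= ?(gram_sym mA _ a);
    move: (rho p) p0 (A _) => x x0 g; by field.
  + rewrite (partial_base_sphere c (dA a b)) (gram_partial mA).
    move: (rho p) (A _) (christoffel _ _ _ _ _) (christoffel _ _ _ _ _).
    move: (christoffel _ _ _ _ _) (christoffel _ _ _ _ _) => *; ring.
Qed.

Lemma near_rho p : rho p != 0 -> \forall q \near p, rho q != 0.
Proof.
move=> p0; have /differentiable_continuous c := differentiable_rho p.
exact: (cvgr_neq0 _ c p0).
Qed.

(** The table agrees with the symbols where rho is nonzero; this set is open, so derivatives agree
    there too. *)
Lemma partial_christoffel_cone i l j k p : rho p != 0 ->
  partial i (christoffel cone l j k) p = partial i (cone_gamma l j k) p.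
Proof.
move=> p0; apply: partial_near; have := near_rho p0.
by apply: filterS => q; exact: christoffel_cone.
Qed.

Lemma curvature_diag i k l p : curvature cone l i i k p = 0.
Proof. by rewrite /curvature subrr add0r big1// => m _; rewrite subrr. Qed.

Lemma ricci_cone_rho p : rho p != 0 -> ricci cone z z p = 0.
Proof.
move=> p0; rewrite /ricci sum3 curvature_diag.
have Pi : partial z (fun q => (rho q)^-1) p = - (rho p ^+ 2)^-1.
  by rewrite (partialV _ (differentiable_rho p) p0) partial_rho eqxx mul1r.
have E a : curvature cone (s a) (s a) z z p = 0.
  rewrite /curvature !partial_christoffel_cone// sum3 !christoffel_cone//.
  rewrite (_ : cone_gamma (s a) z z = fun=> 0); last first.
    by apply/funext => q; rewrite /cone_gamma ?split_z ?split_s.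
  rewrite (_ : cone_gamma (s a) (s a) z = fun q => (rho q)^-1); last first.
    by apply/funext => q; rewrite /cone_gamma ?split_z ?split_s eqxx mul1r.
  rewrite Pi partial_cst /cone_gamma ?split_z ?split_s.
  by have [->|->] := ord2 a; rewrite ?eqxx /=; move: (rho p) p0 => x x0; field.
by rewrite !E !addr0.
Qed.

Lemma ricci_surface a b u : ricci A a b u = gauss_curvature A u * A u a b.
Proof.
have S c d e : curvature A c d e b u = - curvature A c e d b u.
  rewrite /curvature opprD opprB -sumrN; congr (_ + _).
  by apply: eq_bigr => m _; rewrite opprB.
rewrite /ricci sum2.
have Z c d : curvature A c d d b u = 0.
  by rewrite /curvature subrr add0r big1// => m _; rewrite subrr.
have [->|->] := ord2 a; rewrite Z ?add0r ?addr0.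
  by rewrite S (curvatureE mA) eqxx /= mulr0 mulr1 sub0r mulrN opprK.
by rewrite (curvatureE mA) eqxx /= mulr1 mulr0 subr0.
Qed.

(** Planes containing the radial direction contribute 0. In the spherical planes the products of the
    symbols -rho A and 1/rho subtract the curvature of a unit sphere from that of A. *)
Lemma ricci_cone_sphere b c p : rho p != 0 -> ricci cone (s b) (s c) p =
  (gauss_curvature A (rsubmx p) - 1) * A (rsubmx p) b c.
Proof.
move=> p0; have sA := gram_smooth mA.
have dA e d : differentiable (fun u => A u e d) (rsubmx p) by exact: smooth_diff.
have dG e f d : differentiable (christoffel A e f d) (rsubmx p).
  by apply: smooth_diff; exact: smooth_christoffel.
have Ez : curvature cone z z (s b) (s c) p = 0.
  rewrite /curvature !partial_christoffel_cone// sum3 !christoffel_cone//.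
  rewrite (_ : cone_gamma z z (s c) = fun=> 0); last first.
    by apply/funext => q; rewrite /cone_gamma ?split_z ?split_s.
  rewrite (_ : cone_gamma z (s b) (s c) = fun q => - (rho q * A (rsubmx q) b c)); last first.
    by apply/funext => q; rewrite /cone_gamma ?split_z ?split_s.
  have dA' := differentiable_base (dA b c).
  rewrite (partialN _ (differentiable_mul (differentiable_rho p) dA')).
  rewrite (partialM _ (differentiable_rho p) dA') (partial_base_rho (dA b c)).
  rewrite partial_rho partial_cst /cone_gamma ?split_z ?split_s eqxx /=.
  have [->|->] := ord2 b; have [->|->] := ord2 c; rewrite ?eqxx /=;
  move: (rho p) p0 (A _) (christoffel _ _ _ _ _) => x x0 g ?;
  by try (move: (christoffel _ _ _ _ _) => ?); field.
have Es a : curvature cone (s a) (s a) (s b) (s c) p =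
    curvature A a a b c (rsubmx p) - A (rsubmx p) b c + (a == b)%:R * A (rsubmx p) a c.
  rewrite /curvature !partial_christoffel_cone// sum3 sum2 !christoffel_cone//.
  have F e f d : cone_gamma (s e) (s f) (s d) = fun q => christoffel A e f d (rsubmx q).
    by apply/funext => q; rewrite /cone_gamma ?split_z ?split_s.
  rewrite !F !(partial_base_sphere _ (dG _ _ _)) /cone_gamma ?split_z ?split_s eqxx /=.
  move: (a == b)%:R (partial _ _ _) (partial _ _ _) (rho p) p0 (A _) => e c0 c1 x x0 g.
  set C := fun k i j : 'I_2 => christoffel A k i j (rsubmx p); rewrite -!/(C _ _ _).
  by move: C => C; field.
rewrite /ricci sum3 Ez !Es.
have := ricci_surface b c (rsubmx p); rewrite /ricci sum2 mulrBl => <-.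
by have [->|->] := ord2 b; rewrite ?eqxx /=; move: (curvature _ _ _ _ _ _) (curvature _ _ _ _ _ _) (A _ _ _) (A _ _ _) => *; ring.
Qed.

(** Only the spherical block contributes: rho^-2 times the A-trace of (K_A - 1) A. *)
Lemma scal_cone p : rho p != 0 ->
  scal cone p = 2 * (gauss_curvature A (rsubmx p) - 1) / rho p ^+ 2.
Proof.
move=> p0; rewrite /scal invmx_cone//.
have Iz : block_mx 1%:M 0 0 ((rho p ^+ 2)^-1 *: invmx (A (rsubmx p))) z z = 1 :> R.
  by rewrite block_mxEul mxE.
have Izs a : block_mx 1%:M 0 0 ((rho p ^+ 2)^-1 *: invmx (A (rsubmx p))) z (s a) = 0 :> R.
  by rewrite block_mxEur mxE.
have Isz a : block_mx 1%:M 0 0 ((rho p ^+ 2)^-1 *: invmx (A (rsubmx p))) (s a) z = 0 :> R.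
  by rewrite block_mxEdl mxE.
have Is a b : block_mx 1%:M 0 0 ((rho p ^+ 2)^-1 *: invmx (A (rsubmx p))) (s a) (s b) =
    (rho p ^+ 2)^-1 * invmx (A (rsubmx p)) a b :> R.
  by rewrite block_mxEdr mxE.
rewrite !sum3 Iz !Izs !Isz !Is !ricci_cone_sphere// ricci_cone_rho//.
have d0 := gram_det mA (rsubmx p).
have [-> -> -> ->] := invmx2 d0.
move: d0; rewrite det2 (gram_sym mA _ ord_max ord0).
move: (gauss_curvature _ _) (rho p) p0 (A _) (ricci _ _ _ _) (ricci _ _ _ _).
move: (ricci _ _ _ _) (ricci _ _ _ _) => r1 r2 K x x0 g r3 r4 d0.
by field; rewrite x0 d0.
Qed.

End Cone.

(** * Unit normal, height function and shape operator of M_r *)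

Section Hypersurface.
Context {R : realType}.
Variables (g : 'rV[R]_3 -> 'M[R]_3) (r : 'rV[R]_3 -> R).
(* A variable instead of [sphere_metric g], lest [mxE] unfold the pullback. *)
Variable G : 'rV[R]_2 -> 'M[R]_2.
Hypothesis GE : sphere_metric g = G.
Local Notation rr := (Defs.radius r).
Implicit Types (a b c d : 'I_2) (u : 'rV[R]_2) (p : 'rV[R]_(1 + 2)).

Definition half_sqr u : R := rr u * rr u / 2.

Local Notation f := half_sqr.
Local Notation A := (cone_base G f).
Local Notation Y := (height_det G f).
Local Notation n_ := (normal_dir G f).
Local Notation z := (lshift 2 (ord0 : 'I_1)).
Local Notation s a := (rshift 1 a).

Hypotheses (mG : smooth_metric G) (sr : smooth rr) (r_gt0 : forall u, 0 < rr u).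
Hypothesis G00_gt0 : forall u, 0 < G u ord0 ord0.
Hypothesis grad_lt : forall u, adj_norm G rr u < \det (G u).

Lemma radius_neq0 u : rr u != 0. Proof. by rewrite gt_eqF. Qed.

Lemma half_sqrE u : 2 * f u = rr u ^+ 2.
Proof. by rewrite /half_sqr mulrCA divff ?pnatr_eq0// mulr1. Qed.

Lemma half_sqr_gt0 u : 0 < f u.
Proof. by rewrite /half_sqr divr_gt0// mulr_gt0. Qed.

Lemma smooth_half_sqr : smooth f.
Proof. by apply: smoothM; [exact: smoothM|exact: smooth_cst]. Qed.

Lemma partial_half_sqr a u : partial a f u = rr u * partial a rr u.
Proof.
have dr : differentiable rr u by exact: smooth_diff.
have d2 : differentiable (fun=> 2^-1 : R) u by exact: differentiable_cst.
rewrite (partialM a (differentiable_mul dr dr) d2) (partialM a dr dr) partial_cst.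
by move: (rr u) (partial _ _ _) => x y; field.
Qed.

(** This turns the hypothesis |grad r| < 1 into h^2 > 0. *)
Lemma height_det_radius u : Y u = rr u ^+ 2 * (\det (G u) - adj_norm G rr u).
Proof.
rewrite /height_det /adj_norm !partial_half_sqr half_sqrE.
by move: (\det (G u)) (rr u) (partial _ _ _) (partial _ _ _) (G u) => *; ring.
Qed.

Lemma height_det_gt0 u : 0 < Y u.
Proof. by rewrite height_det_radius mulr_gt0 ?exprn_gt0// subr_gt0. Qed.

Let mA : smooth_metric A :=
  smooth_metric_cone_base mG smooth_half_sqr half_sqr_gt0 height_det_gt0.

Lemma gtildeE p : gtilde g r p = cone A p.
Proof.
rewrite /gtilde /cone GE; congr block_mx; apply/matrixP => a b.
rewrite [LHS]mxE [RHS]mxE expr_div_n -!mulrA; congr (_ * _).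
rewrite !mxE big_ord1 !mxE half_sqrE !partial_half_sqr.
have := radius_neq0 (rsubmx p).
move: (rr _) (partial _ _ _) (partial _ _ _) (G _ _ _) => x y w h x0; by field.
Qed.

Lemma gtilde_fun : gtilde g r = cone A. Proof. by apply/funext => p; exact: gtildeE. Qed.

Lemma rho_phi u : rho (phi r u) = rr u.
Proof. by rewrite /rho /phi row_mxKl mxE eqxx. Qed.

Lemma rsub_phi u : rsubmx (phi r u) = u. Proof. exact: row_mxKr. Qed.

Lemma phi_entry_z u : phi r u 0 z = rr u.
Proof. by rewrite -rhoE rho_phi. Qed.

Lemma phi_entry_s u a : phi r u 0 (s a) = u 0 a.
Proof. by rewrite /phi row_mxEr. Qed.

Lemma differentiable_phi u : differentiable (phi r) u.
Proof.
apply: differentiable_rV => j; elim/ord3_ind: j => [|a].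
  by under eq_fun do rewrite phi_entry_z; exact: smooth_diff.
by under eq_fun do rewrite phi_entry_s; exact: differentiable_coord.
Qed.

Lemma jacobian_phi_z u a : 'J (phi r) u a z = partial a rr u.
Proof.
rewrite (jacobianE _ _ (differentiable_phi u)).
by under [in LHS]eq_fun do rewrite phi_entry_z.
Qed.

Lemma jacobian_phi_s u a b : 'J (phi r) u a (s b) = (a == b)%:R.
Proof.
rewrite (jacobianE _ _ (differentiable_phi u)).
under [in LHS]eq_fun do rewrite phi_entry_s; exact: partial_coord.
Qed.

Lemma cone_base_phi u a b : rr u ^+ 2 * A u a b =
  G u a b - partial a rr u * partial b rr u.
Proof.
rewrite mxE half_sqrE !partial_half_sqr; have := radius_neq0 u.
by move: (rr _) (partial _ _ _) (partial _ _ _) (G _ _ _) => x y w h x0; field.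
Qed.

(** At rho = r the conical part is G - dr dr, and drho pulls back to dr, which restores G. *)
Lemma induced_metricE : induced_metric g r = G.
Proof.
apply/funext => u; apply/matrixP => a b.
rewrite /induced_metric /pullback gtilde_fun !mxE sum3.
rewrite ![('J (phi r) u)^T _ _]mxE ![(_ *m _) _ _]mxE !sum3 !coneE rho_phi rsub_phi.
rewrite !jacobian_phi_z !jacobian_phi_s !cone_base_phi.
by have [->|->] := ord2 a; have [->|->] := ord2 b; rewrite ?eqxx /=;
  move: (partial _ _ _) (partial _ _ _) (G u) => x y h; ring.
Qed.

(** The square root of 2 f - |grad f|^2; that it equals r cos alpha is [heightE], after the normal
    is known. *)
Definition support u : R := Num.sqrt (Y u / \det (G u)).

Local Notation h := support.

Lemma det_gram_gt0 u : 0 < \det (G u). Proof. by case: mG. Qed.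

Lemma support_gt0 u : 0 < h u.
Proof. by rewrite sqrtr_gt0 divr_gt0 ?height_det_gt0 ?det_gram_gt0. Qed.

Lemma support_sqr u : h u ^+ 2 = Y u / \det (G u).
Proof. by rewrite sqr_sqrtr// divr_ge0// ltW ?height_det_gt0 ?det_gram_gt0. Qed.

Lemma height_det_support u : Y u = h u ^+ 2 * \det (G u).
Proof. by rewrite support_sqr divfK// gram_det. Qed.

Lemma smooth_support : smooth h.
Proof.
apply: smooth_sqrt => [q|]; first by rewrite divr_gt0 ?height_det_gt0 ?det_gram_gt0.
apply: smoothM; first exact: smooth_height_det mG smooth_half_sqr.
by apply: smoothV; [exact: gram_det|exact: smooth_det].
Qed.

Lemma support_dvol u : h u * dvol (G u) = Num.sqrt (Y u).
Proof.
by rewrite -sqrtrM ?divfK ?gram_det// divr_ge0// ltW ?height_det_gt0 ?det_gram_gt0.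
Qed.

(** The normalised gradient of rho - r(u). At rho = r the gradient is d/drho - r n, because A n = dr
    / r^3, and its length is r / h. *)
Definition unit_normal u : 'rV[R]_(1 + 2) :=
  row_mx (h u / rr u)%:M (\row_a (- (h u * n_ a u))).

Lemma unit_normal_z u : unit_normal u 0 z = h u / rr u.
Proof. by rewrite row_mxEl mxE eqxx. Qed.
Lemma unit_normal_s u a : unit_normal u 0 (s a) = - (h u * n_ a u).
Proof. by rewrite row_mxEr mxE. Qed.

Lemma ip_cone u (v w : 'rV[R]_(1 + 2)) : ip (gtilde g r (phi r u)) v w =
  v 0 z * w 0 z + rr u ^+ 2 *
   ((v 0 (s ord0) * A u ord0 ord0 + v 0 (s ord_max) * A u ord_max ord0) * w 0 (s ord0)
   + (v 0 (s ord0) * A u ord0 ord_max + v 0 (s ord_max) * A u ord_max ord_max) * w 0 (s ord_max)).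
Proof.
rewrite gtilde_fun /ip mxE sum3 ![(_ *m _) _ _]mxE !sum3 !coneE rho_phi rsub_phi.
rewrite ![(w^T) _ _]mxE.
by move: (rr u) (A u) (v 0 _) (v 0 _) (v 0 _) (w 0 _) (w 0 _) (w 0 _) => *; ring.
Qed.

Lemma row_jacobian_phi u (w : 'rV[R]_2) :
  ((w *m 'J (phi r) u) 0 z = w 0 ord0 * partial ord0 rr u + w 0 ord_max * partial ord_max rr u)
  * (forall a, (w *m 'J (phi r) u) 0 (s a) = w 0 a).
Proof.
split=> [|a]; rewrite mxE sum2 ?jacobian_phi_z// !jacobian_phi_s.
by have [->|->] := ord2 a; rewrite eqxx /= ?mulr1 ?mulr0 ?addr0 ?add0r.
Qed.

(* [normal_dir] is dual to [df / r^4] with respect to the base metric. *)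
Lemma normal_dir_low u a : rr u ^+ 4 *
  (n_ ord0 u * A u ord0 a + n_ ord_max u * A u ord_max a) = rr u * partial a rr u.
Proof.
rewrite (normal_dir_cone_base mG half_sqr_gt0 height_det_gt0) half_sqrE partial_half_sqr.
have := radius_neq0 u.
by move: (rr u) (partial _ _ _) => x y x0; field.
Qed.

(** In geometric terms |grad f|^2 / h^2 = r^2 / h^2 - 1. *)
Lemma normal_dir_diff u : n_ ord0 u * partial ord0 f u
   + n_ ord_max u * partial ord_max f u = rr u ^+ 2 * \det (G u) / Y u - 1.
Proof.
rewrite /normal_dir /= -half_sqrE.
have := height_det_neq0 height_det_gt0 u.
have E : 2 * f u * \det (G u) = Y u + adj_norm G f u by rewrite /height_det subrK.
rewrite E /adj_norm.
by move: (Y u) (partial _ _ _) (partial _ _ _) (G u) => y p q m y0; field.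
Qed.

Lemma unit_normal_orth u (w : 'rV[R]_2) :
  ip (gtilde g r (phi r u)) (unit_normal u) (w *m 'J (phi r) u) = 0.
Proof.
rewrite ip_cone !row_jacobian_phi !unit_normal_s unit_normal_z.
have := normal_dir_low u ord0; have := normal_dir_low u ord_max.
have := radius_neq0 u.
move: (rr u) (h u) (A u) (n_ ord0 u) (n_ ord_max u) (partial ord0 _ _) (partial ord_max _ _)
  (w 0 ord0) (w 0 ord_max).
move=> x k m n0 n1 p q w0 w1 x0 E1 E0.
have -> : p = x ^+ 3 * (n0 * m ord0 ord0 + n1 * m ord_max ord0).
  by apply: (mulfI x0); rewrite -E0; ring.
have -> : q = x ^+ 3 * (n0 * m ord0 ord_max + n1 * m ord_max ord_max).
  by apply: (mulfI x0); rewrite -E1; ring.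
by field.
Qed.

(** Orthogonality to the two coordinate tangents determines the spherical part of v from its radial
    part: the difference from the multiple of [unit_normal] is spherical and annihilated by A, which
    is invertible. *)
Lemma ip_normal_multiple u (v : 'rV[R]_(1 + 2)) :
  (forall w, ip (gtilde g r (phi r u)) v (w *m 'J (phi r) u) = 0) ->
  v = (v 0 z * rr u / h u) *: unit_normal u.
Proof.
move=> vo.
have vA a : v 0 z * partial a rr u
   + rr u ^+ 2 * (v 0 (s ord0) * A u ord0 a + v 0 (s ord_max) * A u ord_max a) = 0.
  have dE b : (delta_mx 0 a : 'rV[R]_2) 0 b = (b == a)%:R by rewrite mxE eqxx.
  have := vo (delta_mx 0 a); rewrite ip_cone !row_jacobian_phi !dE => E.
  rewrite -[RHS]E {E}; have [->|->] := ord2 a; rewrite ?eqxx /=;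
  move: (v 0 z) (v 0 (s ord0)) (v 0 (s ord_max)) (rr u) (A u) (partial ord0 _ _)
    (partial ord_max _ _) => *; ring.
have h0 : h u != 0 by rewrite gt_eqF// support_gt0.
apply/rowP => j; rewrite mxE; elim/ord3_ind: j => [|b].
  rewrite unit_normal_z; have := radius_neq0 u.
  by move: (v 0 z) (rr u) (h u) h0 => x y k k0 y0; field; rewrite y0 k0.
rewrite unit_normal_s.
have := vA ord0; have := vA ord_max; have := normal_dir_low u ord0.
have := normal_dir_low u ord_max; have := radius_neq0 u.
have := gram_det mA u; rewrite det2.
have W (m : 'M[R]_2) (w1 w2 : R) : m ord0 ord0 * m ord_max ord_max
    - m ord0 ord_max * m ord_max ord0 != 0 :> R ->
    w1 * m ord0 ord0 + w2 * m ord_max ord0 = 0 ->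
    w1 * m ord0 ord_max + w2 * m ord_max ord_max = 0 -> w1 = 0 /\ w2 = 0.
  move=> D0 e0 e1; split; apply: (mulfI D0); rewrite mulr0.
    transitivity (m ord_max ord_max * (w1 * m ord0 ord0 + w2 * m ord_max ord0)
      - m ord_max ord0 * (w1 * m ord0 ord_max + w2 * m ord_max ord_max)); first by ring.
    by rewrite e0 e1 !mulr0 subr0.
  transitivity (m ord0 ord0 * (w1 * m ord0 ord_max + w2 * m ord_max ord_max)
      - m ord0 ord_max * (w1 * m ord0 ord0 + w2 * m ord_max ord0)); first by ring.
  by rewrite e0 e1 !mulr0 subr0.
move=> D0 x0 E1 E0 F1 F0.
suff : v 0 (s ord0) + v 0 z * rr u * n_ ord0 u = 0 /\
       v 0 (s ord_max) + v 0 z * rr u * n_ ord_max u = 0.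
  move=> [W0 W1]; have [->|->] := ord2 b.
    move: W0 => /eqP; rewrite addr_eq0 => /eqP ->.
    by move: (rr u) (n_ _ _) (v 0 _) (h u) h0 => x n y k k0; field.
  move: W1 => /eqP; rewrite addr_eq0 => /eqP ->.
  by move: (rr u) (n_ _ _) (v 0 _) (h u) h0 => x n y k k0; field.
have x3 := expf_neq0 3 x0.
apply: (W (A u)) => //; apply: (mulfI x0); apply: (mulfI x0); rewrite !mulr0;
  [rewrite -[RHS]F0|rewrite -[RHS]F1];
  [move: E0 => /eqP|move: E1 => /eqP]; rewrite exprS -mulrA (inj_eq (mulfI x0)) => /eqP <-;
  move: (rr u) (A u) (n_ ord0 u) (n_ ord_max u) (v 0 _) (v 0 _) (v 0 _) => *; ring.
Qed.

Lemma unit_normal_norm u : ip (gtilde g r (phi r u)) (unit_normal u) (unit_normal u) = 1.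
Proof.
(* Testing with the tangent vector that shares the spherical part of the normal expresses the
   spherical part of the squared norm through the radial component. *)
have := unit_normal_orth u (\row_a (unit_normal u 0 (s a))).
have rowE a : (\row_a (unit_normal u 0 (s a)) : 'rV[R]_2) 0 a = unit_normal u 0 (s a).
  by rewrite mxE.
rewrite !ip_cone !row_jacobian_phi !rowE => /eqP.
rewrite [X in X == 0]addrC addr_eq0 => /eqP ->.
have := normal_dir_diff u; rewrite !partial_half_sqr !unit_normal_s !unit_normal_z.
rewrite height_det_support.
have := radius_neq0 u; have := gram_det mG u; have := support_gt0 u.
move=> /lt0r_neq0.
move: (h u) (\det (G u)) (rr u) (n_ ord0 u) (n_ ord_max u) (partial ord0 _ _) (partial ord_max _ _).
move=> k D x n0 n1 p q k0 D0 x0 E.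
transitivity (k ^+ 2 / x ^+ 2 * (1 + (n0 * (x * p) + n1 * (x * q)))); first by field.
by rewrite E; field; rewrite k0 x0 D0.
Qed.

Lemma near_right_of_derive (F : R -> R) (d : R) : is_derive (0 : R) (1 : R) F d ->
  F 0 = 0 -> 0 < d ->
  (\forall t \near 0^'+, 0 < F t) /\ (\forall t \near 0^'+, F (- t) < 0).
Proof.
move=> [dF <-] F0 d0.
have : \forall t \near (0 : R)^', 0 < t^-1 *: (F (t *: 1 + 0) - F 0).
  exact: (cvgr_gt _ dF 0 d0).
move=> /nbhs_ballP[e /= e0 He].
have H t : t != 0 -> `|t| < e -> 0 < t^-1 * F t.
  move=> t0 te; have := He t; rewrite F0 subr0 addr0 /GRing.scale /= mulr1; apply => //.
  by rewrite -ball_normE/= sub0r normrN.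
split; near=> t.
  have t0 : 0 < t by near: t; exact: nbhs_right_gt.
  have := H t (lt0r_neq0 t0); rewrite gtr0_norm// pmulr_rgt0 ?invr_gt0//; apply.
  by near: t; exact: nbhs_right_lt.
have t0 : 0 < t by near: t; exact: nbhs_right_gt.
have := H (- t); rewrite oppr_eq0 normrN gtr0_norm// invrN mulNr oppr_gt0 => /(_ (lt0r_neq0 t0)).
rewrite pmulr_rlt0 ?invr_gt0//; apply.
by near: t; exact: nbhs_right_lt.
Unshelve. all: by end_near. Qed.

Lemma deriv_row (F : 'rV[R]_2 -> R) u v : differentiable F u ->
  'D_v F u = v 0 ord0 * partial ord0 F u + v 0 ord_max * partial ord_max F u.
Proof.
move=> dF; rewrite (deriveE _ dF) [in LHS](row_sum_delta v) linear_sum sum2.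
by rewrite !linearZ /= -!(deriveE _ dF).
Qed.

Lemma rho_line u t (v : 'rV[R]_(1 + 2)) : rho (phi r u + t *: v) = rr u + t * v 0 z.
Proof. by rewrite rhoE [LHS]mxE [X in _ + X]mxE phi_entry_z. Qed.

Lemma rsub_line u t (v : 'rV[R]_(1 + 2)) :
  rsubmx (phi r u + t *: v) = u + t *: rsubmx v.
Proof. by rewrite linearD linearZ /= rsub_phi. Qed.

(** The function rho - r, taken along the coordinate line through the point in the direction of
    [unit_normal], vanishes at t = 0 with positive derivative. So the line leaves P_r forwards and
    enters it backwards. *)
Lemma radial_gap u :
  (\forall t \near 0^'+, rr (u + t *: rsubmx (unit_normal u)) <
      rr u + t * unit_normal u 0 z) /\
  (\forall t \near 0^'+, rr u - t * unit_normal u 0 z <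
      rr (u - t *: rsubmx (unit_normal u))).
Proof.
pose F t := t * unit_normal u 0 z - (rr (u + t *: rsubmx (unit_normal u)) - rr u).
(* This derivative equals r / h, the length of the gradient of rho - r. *)
pose d := h u / rr u * (rr u ^+ 2 * \det (G u) / Y u).
have d0 : 0 < d.
  by rewrite !(mulr_gt0, divr_gt0, invr_gt0, exprn_gt0) ?support_gt0 ?height_det_gt0 ?det_gram_gt0.
have dF : is_derive (0 : R) (1 : R) F d.
  have dl := is_derive_line u (rsubmx (unit_normal u)) 0 (fun q => smooth_diff q sr).
  have d1 : is_derive (0 : R) (1 : R) (fun t : R => t * unit_normal u 0 z) (unit_normal u 0 z).
    rewrite (_ : (fun t : R => _) = unit_normal u 0 z *: (id : R -> R)); last first.
      by apply/funext => t; rewrite mulrC.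
    by apply: is_derive_eq; rewrite /GRing.scale /= mulr1.
  apply: (is_derive_eq (is_deriveB d1 (is_deriveB dl (is_derive_cst (rr u) _ _)))).
  rewrite subr0 scale0r addr0 (deriv_row _ (smooth_diff u sr)) ![rsubmx _ _ _]mxE.
  rewrite !unit_normal_s unit_normal_z /d.
  have := normal_dir_diff u; rewrite !partial_half_sqr => /eqP.
  rewrite eq_sym subr_eq => /eqP ->.
  have := radius_neq0 u.
  rewrite /GRing.scale /=.
  move: (h u) (rr u) (n_ ord0 u) (n_ ord_max u) (partial ord0 _ _) (partial ord_max _ _).
  by move=> k x n0 n1 p q x0; field.
have F0 : F 0 = 0 by rewrite /F mul0r scale0r addr0 subrr subr0.
have [P N] := near_right_of_derive dF F0 d0; split.
  by apply: filterS P => t; rewrite /F subr_gt0 ltrBlDl.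
by apply: filterS N => t; rewrite /F mulNr scaleNr -opprD oppr_lt0 addrA subr_gt0 ltrBlDl.
Qed.

(** A unit vector orthogonal to M_r is plus or minus [unit_normal], and the minus sign is excluded
    because that line runs into P_r. So [get] has a unique choice. *)
Lemma nuE u : nu g r u = unit_normal u.
Proof.
have [out inn] := radial_gap u.
have mem : outer_unit_normal g r u (unit_normal u).
  split; first exact: unit_normal_orth.
    by rewrite /ipnorm unit_normal_norm sqrtr1.
  apply: filterS out => t; rewrite /P_ /= rho_line rsub_line => lt.
  by move=> /andP[_ /(lt_le_trans lt)]; rewrite ltxx.
rewrite /nu; apply: get_unique => // v [vo vn vP].
pose k := v 0 z * rr u / h u.
have vk : v = k *: unit_normal u by exact: ip_normal_multiple.
have : k ^+ 2 = 1.
  move: vn; rewrite /ipnorm vk.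
  have -> : ip (gtilde g r (phi r u)) (k *: unit_normal u) (k *: unit_normal u) = k ^+ 2.
    rewrite /ip linearZ /= -!scalemxAl -scalemxAr !mxE.
    have := unit_normal_norm u; rewrite /ip mxE => ->.
    by rewrite mulr1 expr2.
  by rewrite sqrtr_sqr => k1; rewrite -real_normK ?num_real// k1 expr1n.
move/eqP; rewrite sqrf_eq1 => /orP[/eqP k1|/eqP k1].
  by rewrite vk k1 scale1r.
exfalso.
(* Membership in P_r also demands rho > 0, which persists for small t. *)
have pos : \forall t \near 0^'+, 0 < rr u - t * unit_normal u 0 z.
  have c0 : 0 < unit_normal u 0 z by rewrite unit_normal_z divr_gt0 ?support_gt0.
  have e0 : 0 < rr u / unit_normal u 0 z by rewrite divr_gt0.
  by apply: filterS (nbhs_right_lt e0) => t; rewrite subr_gt0 -ltr_pdivlMr.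
have F : \forall t \near (0 : R)^'+, False.
  apply: filterS3 vP inn pos => t; rewrite vk k1 scaleN1r => nP lt t0; apply: nP.
  rewrite /P_ /= rho_line rsub_line mxE mulrN t0 /= linearN /= scalerN.
  exact: ltW.
by have [] := filter_ex F.
Qed.

(** The quotient h / r is the radial component of the unit normal. [acosK] requires it to lie in
    [-1, 1], and h <= r amounts to |grad r|^2 >= 0. *)
Lemma cos_alpha u : cos (alpha g r u) = h u / rr u.
Proof.
rewrite /alpha /angle nuE /ipnorm unit_normal_norm sqrtr1 mulr1.
rewrite !ip_cone unit_normal_z.
have dz a : (delta_mx 0 0 : 'rV[R]_(1 + 2)) 0 (s a) = 0 by rewrite mxE eqxx.
have dzz : (delta_mx 0 0 : 'rV[R]_(1 + 2)) 0 z = 1 by rewrite mxE eqxx.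
rewrite !dz dzz !(mul0r, mulr0, addr0, mul1r) sqrtr1 divr1 acosK//.
rewrite in_itv /=; apply/andP; split.
  by rewrite (le_trans (lerN10 _))// divr_ge0// ltW// support_gt0.
rewrite ler_pdivrMr// mul1r -(@ler_pXn2r _ 2)// ?nnegrE ?(ltW (support_gt0 _)) ?(ltW (r_gt0 _))//.
rewrite support_sqr ler_pdivrMr ?det_gram_gt0// height_det_radius.
rewrite ler_pM2l ?exprn_gt0// gerBl.
(* Multiplying by the positive entry of G allows the quadratic form to be completed to a sum of
   squares. *)
rewrite -(pmulr_rge0 _ (G00_gt0 u)).
have -> : G u ord0 ord0 * adj_norm G rr u = \det (G u) * partial ord0 rr u ^+ 2
  + (G u ord0 ord0 * partial ord_max rr u - G u ord0 ord_max * partial ord0 rr u) ^+ 2.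
  rewrite /adj_norm det2 (gram_sym mG u ord_max ord0).
  by move: (G u) (partial _ _ _) (partial _ _ _) => *; ring.
by rewrite addr_ge0 ?sqr_ge0// mulr_ge0 ?sqr_ge0// ltW// det_gram_gt0.
Qed.

Lemma heightE u : height g r u = h u.
Proof. by rewrite /height cos_alpha mulrC divfK// radius_neq0. Qed.

(** The matrix b G^-1 / h, whose rows are the images of the coordinate fields. *)
Definition shape u : 'M[R]_2 := \matrix_(a, b)
  (support_adj G f a b u / (\det (G u) * h u)).

Lemma partial_support a u : partial a h u =
  (support_form G f a ord0 u * n_ ord0 u + support_form G f a ord_max u * n_ ord_max u) * h u.
Proof.
have dY : differentiable Y u by apply: smooth_diff; exact: smooth_height_det mG smooth_half_sqr.
have dD : differentiable (fun q => \det (G q)) u by apply: smooth_diff; exact: smooth_det.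
have D0 := gram_det mG u.
have dq := differentiable_mul dY (differentiable_inv dD D0).
have q0 : 0 < Y u / \det (G u) by rewrite divr_gt0 ?height_det_gt0 ?det_gram_gt0.
rewrite (partial_sqrt a dq q0) (partial_div a dY dD D0) partial_det//.
rewrite (partial_height_det mG smooth_half_sqr) -/(h u) -support_sqr.
have h0 := lt0r_neq0 (support_gt0 u).
rewrite height_det_support /normal_dir /=.
rewrite height_det_support.
move: (christoffel _ _ _ _ _) (christoffel _ _ _ _ _) (support_form _ _ _ _ _)
  (support_form _ _ _ _ _) (partial ord0 _ _) (partial ord_max _ _) (h u) h0.
move: (G u) D0 => m D0 c0 c1 b0 b1 p q k k0.
by field; rewrite D0 k0.
Qed.

(** Weingarten's equation. Conceptually, h nu = X - grad f, and the position field X has the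
    identity as covariant derivative, so the tangential part of h times the derivative of nu is the
    identity minus Hess f, which is b. The proof compares radial and spherical components. *)
Lemma covder_nu u : covder (gtilde g r) (phi r) (nu g r) u =
  shape u *m 'J (phi r) u.
Proof.
have -> : nu g r = unit_normal by apply/funext => q; exact: nuE.
have sn := smooth_normal_dir mG smooth_half_sqr height_det_gt0.
have dh : differentiable h u by apply: smooth_diff; exact: smooth_support.
have dn a : differentiable (n_ a) u by exact: smooth_diff.
have dr : differentiable rr u by exact: smooth_diff.
have dnu : differentiable unit_normal u.
  apply: differentiable_rV => j; elim/ord3_ind: j => [|a].
    under eq_fun do rewrite unit_normal_z.
    exact: (differentiable_mul dh (differentiable_inv dr (radius_neq0 u))).
  under eq_fun do rewrite unit_normal_s.
  by apply: differentiableN; exact: differentiable_mul.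
have p0 : rho (phi r u) != 0 by rewrite rho_phi radius_neq0.
have h0 := lt0r_neq0 (support_gt0 u).
have cov a j : covder (gtilde g r) (phi r) unit_normal u a j =
    partial a (fun q => unit_normal q 0 j) u + \sum_k \sum_l
      christoffel (cone A) j k l (phi r u) * 'J (phi r) u a k * unit_normal u 0 l.
  have addE (M N : 'M[R]_(2, 1 + 2)) : (M + N) a j = M a j + N a j by rewrite mxE.
  rewrite /covder gtilde_fun addE; congr (_ + _).
    exact: jacobianE.
  by rewrite mxE.
have shE a b : shape u a b = support_adj G f a b u / (\det (G u) * h u).
  by rewrite [LHS]mxE.
have Y0 := height_det_neq0 height_det_gt0 u.
apply/matrixP => a j; rewrite cov [RHS]mxE sum2 !shE !sum3.
have Jz b := jacobian_phi_z u b; have Js b c := jacobian_phi_s u b c.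
have nz := unit_normal_z u; have ns b := unit_normal_s u b.
move: ('J (phi r) u) (unit_normal u) Jz Js nz ns => J N Jz Js nz ns.
rewrite !Jz !Js !ns nz.
have Cc k l m : christoffel (cone A) k l m (phi r u) = cone_gamma A k l m (phi r u).
  exact: christoffel_cone.
rewrite !Cc {Cc}.
have [rp sp] := (rho_phi u, rsub_phi u).
elim/ord3_ind: j => [|b]; rewrite ?Jz ?Js.
  under [X in partial _ X _]eq_fun do rewrite unit_normal_z.
  rewrite (partial_div a dh dr (radius_neq0 u)) partial_support.
  rewrite /cone_gamma ?split_z ?split_s rp sp.
  (* The radial symbols of the cone are -rho A, so the radial component involves A n, which is dr /
     r^3. *)
  have low : A u a ord0 * n_ ord0 u + A u a ord_max * n_ ord_max u
      = partial a rr u / rr u ^+ 3.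
    have := normal_dir_low u a.
    rewrite (gram_sym mA u ord0 a) (gram_sym mA u ord_max a).
    have := radius_neq0 u.
    move: (rr u) (A u a ord0) (A u a ord_max) (n_ ord0 u) (n_ ord_max u) (partial a _ _).
    move=> x a0 a1 n0 n1 p x0 E.
    transitivity (x ^+ 4 * (n0 * a0 + n1 * a1) / x ^+ 4); first by field.
    by rewrite E; field.
  transitivity ((support_form G f a ord0 u * n_ ord0 u
      + support_form G f a ord_max u * n_ ord_max u) * h u / rr u
     - h u / rr u ^+ 2 * partial a rr u
     + rr u * h u * (A u a ord0 * n_ ord0 u + A u a ord_max * n_ ord_max u)).
    have := radius_neq0 u; move: (rr u) (A u) (h u) (n_ ord0 u) (n_ ord_max u).
    move: (support_form _ _ _ _ _) (support_form _ _ _ _ _) (partial _ _ _).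
    by have [->|->] := ord2 a; rewrite ?eqxx /= => *; field.
  rewrite low /normal_dir /= height_det_support !partial_half_sqr /support_adj /=.
  have := radius_neq0 u; have := gram_det mG u; move: h0.
  move: (rr u) (G u) (h u) (partial ord0 _ _) (partial ord_max _ _).
  move: (support_form _ _ _ _ _) (support_form _ _ _ _ _) (partial _ _ _).
  move=> b0 b1 pa x m k p q k0 D0 x0.
  by field; rewrite x0 D0 k0.
under [X in partial _ X _]eq_fun do rewrite unit_normal_s.
rewrite (partialN a (differentiable_mul dh (dn b))) (partialM a dh (dn b)) partial_support.
rewrite (partial_normal_dir mG smooth_half_sqr height_det_gt0).
rewrite /cone_gamma ?split_z ?split_s rp sp.
rewrite !(christoffel_cone_base mG smooth_half_sqr half_sqr_gt0 height_det_gt0) /cone_christoffel.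
(* Writes 1/h^2 as (1 + n . df) / r^2; the identity part of the derivative of n then cancels against
   the radial terms of the connection. *)
have EY (d S : R) : (\det (G u) * d - S) / Y u =
    (1 + (n_ ord0 u * partial ord0 f u + n_ ord_max u * partial ord_max f u))
      / rr u ^+ 2 * d - S / (h u ^+ 2 * \det (G u)).
  rewrite normal_dir_diff height_det_support.
  have := radius_neq0 u; have := gram_det mG u.
  move: (rr u) (\det (G u)) (h u) h0 => x D k k0 D0 x0.
  by field; rewrite x0 D0 k0.
rewrite EY !half_sqrE !partial_half_sqr.
have := radius_neq0 u; have := gram_det mG u; move: h0.
clear -mG sr; move: (rr u) (\det (G u)) (h u) (n_ ord0 u) (n_ ord_max u) => x D k.
have [->|->] := ord2 a; have [->|->] := ord2 b; rewrite ?eqxx /=;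
  rewrite ?(support_formC mG smooth_half_sqr ord_max ord0)
    ?(christoffelC u (gram_sym mG) _ ord_max ord0);
  move: (partial ord0 _ _) (partial ord_max _ _) (support_form _ _ ord0 ord0 _)
  (support_form _ _ ord_max ord_max _) (support_form _ _ ord0 ord_max _)
  (christoffel _ _ _ _ _) (christoffel _ _ _ _ _) (christoffel _ _ _ _ _);
  move: (support_adj _ _ _ _ _) (support_adj _ _ _ _ _);
  move=> s0 s1 p q b0 b1 b2 c0 c1 c2 n0 n1 k0 D0 x0; field;
  by rewrite x0 D0 k0.
Qed.

Lemma shape_operatorE u : shape_operator g r u = shape u.
Proof.
rewrite /shape_operator covder_nu -mulmxA mulmxVp ?mulmx1//.
have Jz b := jacobian_phi_z u b; have Js b c := jacobian_phi_s u b c.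
move: ('J (phi r) u) Jz Js => J Jz Js.
(* The projection (rho, u) -> u is a right inverse of the Jacobian, so its rows are independent and
   [pinvmx] inverts it on the right. *)
apply/row_freeP; exists (\matrix_(i, b) (i == s b)%:R).
apply/matrixP => a b; rewrite [LHS]mxE sum3 Jz !Js !mxE.
rewrite eq_lrshift mulr0 add0r !(inj_eq (@rshift_inj _ _)).
by have [->|->] := ord2 a; have [->|->] := ord2 b;
  rewrite ?eqxx /= ?(mulr0, mulr1, addr0, add0r).
Qed.

Lemma sqrt_height_det_neq0 u : Num.sqrt (Y u) != 0.
Proof. by rewrite gt_eqF// sqrtr_gt0 height_det_gt0. Qed.

Lemma mean_curvature_dvol u : mean_curvature g r u * dvol (induced_metric g r u) =
  2^-1 * (adj_trace G f u / Num.sqrt (Y u)).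
Proof.
rewrite /mean_curvature shape_operatorE induced_metricE -mulrA; congr (_ * _).
rewrite /mxtrace sum2 ![shape u _ _]mxE -support_dvol /support_adj /adj_trace /=.
rewrite (support_formC mG smooth_half_sqr ord_max ord0).
have D0 : dvol (G u) != 0 by rewrite gt_eqF// sqrtr_gt0 det_gram_gt0.
have DE : \det (G u) = dvol (G u) ^+ 2 by rewrite sqr_sqrtr// ltW// det_gram_gt0.
have h0 := lt0r_neq0 (support_gt0 u).
rewrite DE; move: (h u) h0 (dvol (G u)) D0 => k k0 D D0.
move: (support_form _ _ ord0 ord0 _) (support_form _ _ ord0 ord_max _)
  (support_form _ _ ord_max ord_max _) (G u) => b0 b1 b2 m.
by field; rewrite k0 D0.
Qed.

Lemma det_shape u : \det (shape u) = support_det G f u / Y u.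
Proof.
rewrite det2 ![shape u _ _]mxE /support_adj /support_det height_det_support /=.
rewrite (support_formC mG smooth_half_sqr ord_max ord0).
have := gram_det mG u; have h0 := lt0r_neq0 (support_gt0 u).
rewrite det2 (gram_sym mG u ord_max ord0).
move: (h u) h0 (G u) (support_form _ _ _ _ _) (support_form _ _ _ _ _) => k k0 m b0 b1.
move: (support_form _ _ _ _ _) => b2 D0.
by field; rewrite k0 D0.
Qed.

Lemma height_curvature_dvol u :
  height g r u * (gauss_curvature (induced_metric g r) u + \det (shape_operator g r u))
    * dvol (induced_metric g r u) =
  gauss_curvature G u * Num.sqrt (Y u) + support_det G f u / Num.sqrt (Y u).
Proof.
rewrite induced_metricE shape_operatorE det_shape heightE mulrAC support_dvol.
have := sqr_sqrtr (ltW (height_det_gt0 u)); have := sqrt_height_det_neq0 u.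
move: (Num.sqrt (Y u)) => x x0 <-.
by move: (gauss_curvature _ _) (support_det _ _ _) => K d; field.
Qed.

(** The scalar curvature scales as rho^-2 and the volume density as rho^2, so the product does not
    depend on rho. This is why the integral converges at the apex. *)
Lemma scal_dvol p : 0 < rho p -> scal (gtilde g r) p * dvol (gtilde g r p) =
  2 * (2 * f (rsubmx p) * \det (G (rsubmx p))
       * (gauss_curvature G (rsubmx p) - support_det G f (rsubmx p) / Y (rsubmx p))
       / Num.sqrt (Y (rsubmx p))) / rr (rsubmx p).
Proof.
move=> p0; set u := rsubmx p; rewrite gtilde_fun (scal_cone mA (lt0r_neq0 p0)).
rewrite (gauss_curvature_cone_base mG smooth_half_sqr half_sqr_gt0 height_det_gt0).
rewrite /dvol det_cone (det_cone_base mG half_sqr_gt0) -/u half_sqrE.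
have -> : Num.sqrt (rho p ^+ 4 * (Y u * (rr u ^+ 2)^-1 ^+ 3)) =
    rho p ^+ 2 / rr u ^+ 3 * Num.sqrt (Y u).
  have -> : rho p ^+ 4 * (Y u * (rr u ^+ 2)^-1 ^+ 3) =
      (rho p ^+ 2 / rr u ^+ 3) ^+ 2 * Y u.
    by have := radius_neq0 u; move: (rr u) (Y u) (rho p) => x y w x0; field.
  by rewrite sqrtrM ?sqr_ge0// sqrtr_sqr ger0_norm// divr_ge0// exprn_ge0// ltW.
have := sqr_sqrtr (ltW (height_det_gt0 u)); have := sqrt_height_det_neq0 u.
move: (Num.sqrt (Y u)) => y y0 <-.
have := radius_neq0 u; have := lt0r_neq0 p0.
move: (rr u) (rho p) (\det (G u)) (gauss_curvature _ _) (support_det _ _ _).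
by move=> x w D K d w0 x0; field; rewrite ?w0 ?x0 ?y0.
Qed.

End Hypersurface.

(** * The densities in the plane to which the three integrals reduce *)

Section Densities.
Context {R : realType}.
Variables (G : 'rV[R]_2 -> 'M[R]_2) (f : 'rV[R]_2 -> R).

(* For [f = r^2/2] the three densities are half of [scal dvol] integrated over
   [rho], [2 H darea] and [h (K + \det B) darea], in the chart. *)
Definition scal_density u : R := 2 * f u * \det (G u)
  * (gauss_curvature G u - support_det G f u / height_det G f u)
  / Num.sqrt (height_det G f u).

Definition mean_density u : R := adj_trace G f u / Num.sqrt (height_det G f u).

Definition height_density u : R := gauss_curvature G u * Num.sqrt (height_det G f u)
  + support_det G f u / Num.sqrt (height_det G f u).

Hypotheses (mG : smooth_metric G) (sf : smooth f) (Y_gt0 : forall u, 0 < height_det G f u).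

Lemma smooth_gauss_curvature : smooth (gauss_curvature G).
Proof.
have sG := gram_smooth mG; have sC := smooth_christoffel mG.
have sDV : smooth (fun u => (\det (G u))^-1).
  by apply: smoothV; [exact: gram_det|exact: smooth_det].
apply: (smoothM _ sDV); apply: smooth_sum => l; apply: (smoothM _ (sG _ _)).
apply: smoothD; first by apply: smoothB; apply: smooth_partial.
by apply: smooth_sum => m; apply: smoothB; exact: smoothM.
Qed.

Let sY := smooth_height_det mG sf.

Lemma smooth_sqrtV : smooth (fun u => (Num.sqrt (height_det G f u))^-1).
Proof.
apply: smoothV => [q|]; first by rewrite gt_eqF// sqrtr_gt0.
exact: smooth_sqrt.
Qed.

Lemma smooth_scal_density : smooth scal_density.
Proof.
apply: (smoothM _ smooth_sqrtV); apply: smoothM.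
  by apply: smoothM; [smooth_tac|exact: smooth_det].
apply: smoothB; first exact: smooth_gauss_curvature.
apply: smoothM; first exact: smooth_support_det.
by apply: smoothV => // q; rewrite gt_eqF.
Qed.

Lemma smooth_mean_density : smooth mean_density.
Proof. by apply: (smoothM _ smooth_sqrtV); exact: smooth_adj_trace. Qed.

Lemma smooth_height_density : smooth height_density.
Proof.
apply: smoothD; first by apply: smoothM; [exact: smooth_gauss_curvature|exact: smooth_sqrt].
by apply: (smoothM _ smooth_sqrtV); exact: smooth_support_det.
Qed.

Lemma smooth_flux0 : smooth (flux0 G f).
Proof. by apply: (smoothM _ smooth_sqrtV); have sb := smooth_support_form mG sf; smooth_tac. Qed.

Lemma smooth_flux1 : smooth (flux1 G f).
Proof. by apply: (smoothM _ smooth_sqrtV); have sb := smooth_support_form mG sf; smooth_tac. Qed.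

Lemma div_flux_density u : partial ord0 (flux0 G f) u + partial ord_max (flux1 G f) u =
  scal_density u + mean_density u - height_density u.
Proof. exact: div_flux. Qed.

End Densities.

(** * Change of chart *)

Section CoordinateChange.
Context {R : realType}.
Variables (G G' : 'rV[R]_2 -> 'M[R]_2) (psi : 'rV[R]_2 -> 'rV[R]_2) (U : set 'rV[R]_2).
Implicit Types (i j k l a b c : 'I_2) (u q : 'rV[R]_2).

Definition jac i a : 'rV[R]_2 -> R := partial i (fun q => psi q 0 a).

Hypotheses (mG : smooth_metric G) (mG' : smooth_metric G') (oU : open U).
Hypothesis dpsi : forall q, U q -> differentiable psi q.
Hypothesis dP : forall q i a, U q ->
  differentiable (jac i a) q.
Hypothesis PC : forall q i j a, U q ->
  partial i (jac j a) q = partial j (jac i a) q.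

Definition jac_det q : R := jac ord0 ord0 q * jac ord_max ord_max q
  - jac ord0 ord_max q * jac ord_max ord0 q.

Hypothesis P_neq0 : forall q, U q -> jac_det q != 0.

Hypothesis G'E : forall q i j, U q -> G' q i j =
  jac i ord0 q * jac j ord0 q * G (psi q) ord0 ord0
  + (jac i ord0 q * jac j ord_max q + jac i ord_max q * jac j ord0 q) * G (psi q) ord0 ord_max
  + jac i ord_max q * jac j ord_max q * G (psi q) ord_max ord_max.

Local Opaque partial jac.

Lemma near_dom (F H : 'rV[R]_2 -> R) u : U u -> (forall q, U q -> F q = H q) ->
  \forall q \near u, F q = H q.
Proof. by move=> Uu FH; apply: filterS (open_nbhs_nbhs (conj oU Uu)) => q; exact: FH. Qed.

Lemma partial_pullback i (F : 'rV[R]_2 -> R) u : U u -> differentiable F (psi u) ->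
  partial i (fun q => F (psi q)) u =
  jac i ord0 u * partial ord0 F (psi u) + jac i ord_max u * partial ord_max F (psi u).
Proof. by move=> Uu dF; rewrite (partial_comp _ (dpsi Uu) dF) sum2. Qed.

Lemma differentiable_pullback (F : 'rV[R]_2 -> R) u : U u -> differentiable F (psi u) ->
  differentiable (fun q => F (psi q)) u.
Proof. by move=> Uu dF; exact: (differentiable_comp (dpsi Uu) dF). Qed.

(** One side of the transformation law of the Christoffel symbols; the other is contracted with the
    Jacobian of psi, which avoids its inverse. *)
Definition pull_gamma i j a u : R := partial i (jac j a) u
  + (christoffel G a ord0 ord0 (psi u) * jac i ord0 u * jac j ord0 u
     + christoffel G a ord0 ord_max (psi u) * (jac i ord0 u * jac j ord_max u + jac i ord_max u * jac j ord0 u)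
     + christoffel G a ord_max ord_max (psi u) * jac i ord_max u * jac j ord_max u).

Lemma partial_G' k i j u : U u -> partial k (fun q => G' q i j) u =
  pull_gamma k i ord0 u * (jac j ord0 u * G (psi u) ord0 ord0 + jac j ord_max u * G (psi u) ord0 ord_max)
  + pull_gamma k i ord_max u * (jac j ord0 u * G (psi u) ord0 ord_max + jac j ord_max u * G (psi u) ord_max ord_max)
  + (pull_gamma k j ord0 u * (jac i ord0 u * G (psi u) ord0 ord0 + jac i ord_max u * G (psi u) ord0 ord_max)
  + pull_gamma k j ord_max u * (jac i ord0 u * G (psi u) ord0 ord_max + jac i ord_max u * G (psi u) ord_max ord_max)).
Proof.
move=> Uu.
rewrite (partial_near k (near_dom Uu (fun q Uq => G'E i j Uq))).
have dp x y : differentiable (jac x y) u by exact: dP.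
have dg x y : differentiable (fun q => G (psi q) x y) u.
  by apply: (@differentiable_pullback (fun q => G q x y)) => //; apply: smooth_diff; exact: gram_smooth.
have Pg x y : partial k (fun q => G (psi q) x y) u =
    jac k ord0 u * partial ord0 (fun q => G q x y) (psi u)
    + jac k ord_max u * partial ord_max (fun q => G q x y) (psi u).
  by apply: (partial_pullback k (F := fun q => G q x y)) => //; apply: smooth_diff; exact: gram_smooth.
have dpp x y x' y' := differentiable_mul (dp x y) (dp x' y').
have ds := differentiable_add (dpp i ord0 j ord_max) (dpp i ord_max j ord0).
have d0 := differentiable_mul (dpp i ord0 j ord0) (dg ord0 ord0).
have d1 := differentiable_mul ds (dg ord0 ord_max).
have d2 := differentiable_mul (dpp i ord_max j ord_max) (dg ord_max ord_max).
rewrite (partialD k (differentiable_add d0 d1) d2) (partialD k d0 d1).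
rewrite (partialM k (dpp i ord0 j ord0) (dg ord0 ord0)) (partialM k ds (dg ord0 ord_max)).
rewrite (partialM k (dpp i ord_max j ord_max) (dg ord_max ord_max)).
rewrite (partialD k (dpp i ord0 j ord_max) (dpp i ord_max j ord0)).
rewrite (partialM k (dp i ord0) (dp j ord0)) (partialM k (dp i ord_max) (dp j ord_max)).
rewrite (partialM k (dp i ord0) (dp j ord_max)) (partialM k (dp i ord_max) (dp j ord0)).
rewrite !Pg !(gram_partial mG) (gram_sym mG (psi u) ord_max ord0).
rewrite !(christoffelC (psi u) (gram_sym mG) _ ord_max ord0) /pull_gamma.
set C := fun k i j => christoffel G k i j (psi u); rewrite -!/(C _ _ _).
move: (partial k (jac i ord0) u) (partial k (jac j ord0) u)
  (partial k (jac i ord_max) u) (partial k (jac j ord_max) u) => h0 h1 h2 h3.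
pose p x y := jac x y u; rewrite -!/(p _ _).
move: p C (G (psi u)) => p C g; ring.
Qed.

(** Cramer's rule solves the transformation law for candidate symbols, which [christoffel_unique]
    then identifies. *)
Lemma christoffel_change i j a u : U u ->
  christoffel G' ord0 i j u * jac ord0 a u + christoffel G' ord_max i j u * jac ord_max a u
  = pull_gamma i j a u.
Proof.
move=> Uu; pose d := jac_det u; have d0 : d != 0 by exact: P_neq0.
pose C l i j := if l == ord0
  then (pull_gamma i j ord0 u * jac ord_max ord_max u - pull_gamma i j ord_max u * jac ord_max ord0 u) / d
  else (pull_gamma i j ord_max u * jac ord0 ord0 u - pull_gamma i j ord0 u * jac ord0 ord_max u) / d.
have CP i' j' a' : C ord0 i' j' * jac ord0 a' u + C ord_max i' j' * jac ord_max a' u = pull_gamma i' j' a' u.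
  move: d0; rewrite /C /= /d /jac_det.
  by have [->|->] := ord2 a';
    move: (pull_gamma _ _ _ _) (pull_gamma _ _ _ _) (jac ord0 ord0 u) (jac ord0 ord_max u)
      (jac ord_max ord0 u) (jac ord_max ord_max u) => g0 g1 p0 p1 p2 p3 d0; field.
have pC i' j' a' : pull_gamma i' j' a' u = pull_gamma j' i' a' u.
  rewrite /pull_gamma (PC i' j' a' Uu).
  by move: (partial _ _ _) (christoffel _ _ _ _ _) (christoffel _ _ _ _ _) (christoffel _ _ _ _ _)
    (jac i' _ u) (jac i' _ u) (jac j' _ u) (jac j' _ u) => *; ring.
have CE l : christoffel G' l i j u = C l i j; last by rewrite !CE.
apply: (@christoffel_unique _ _ G' u (gram_unit mG' u) C).
- exact: gram_sym.
- by move=> l' i' j'; rewrite /C (pC i' j' ord0) (pC i' j' ord_max).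
- move=> l' i' j'; rewrite (partial_G' _ _ _ Uu) sum2 -!CP.
  rewrite !(G'E _ _ Uu).
  pose p x y := jac x y u; rewrite -!/(p _ _).
  by move: p (C) (G (psi u)) => p C' g; ring.
Qed.

Section Scalar.
Variables f f' : 'rV[R]_2 -> R.
Hypotheses (sf : smooth f) (sf' : smooth f').
Hypothesis f'E : forall q, U q -> f' q = f (psi q).

Lemma partial_change i u : U u -> partial i f' u =
  jac i ord0 u * partial ord0 f (psi u) + jac i ord_max u * partial ord_max f (psi u).
Proof.
move=> Uu; rewrite (partial_near i (near_dom Uu f'E)).
by apply: partial_pullback => //; exact: smooth_diff.
Qed.

(** The second derivatives of psi in the Hessian cancel against those in the Christoffel symbols, so
    b transforms as a tensor. *)
Lemma support_form_change i j u : U u -> support_form G' f' i j u =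
  jac i ord0 u * jac j ord0 u * support_form G f ord0 ord0 (psi u)
  + (jac i ord0 u * jac j ord_max u + jac i ord_max u * jac j ord0 u) * support_form G f ord0 ord_max (psi u)
  + jac i ord_max u * jac j ord_max u * support_form G f ord_max ord_max (psi u).
Proof.
move=> Uu.
have df a : differentiable (partial a f) (psi u) by diff_tac.
have dfp a := differentiable_pullback Uu (df a).
have dp x y : differentiable (jac x y) u by exact: dP.
have H : partial i (partial j f') u =
   partial i (jac j ord0) u * partial ord0 f (psi u)
   + jac j ord0 u * (jac i ord0 u * partial ord0 (partial ord0 f) (psi u)
                   + jac i ord_max u * partial ord_max (partial ord0 f) (psi u))
   + (partial i (jac j ord_max) u * partial ord_max f (psi u)
   + jac j ord_max u * (jac i ord0 u * partial ord0 (partial ord_max f) (psi u)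
                   + jac i ord_max u * partial ord_max (partial ord_max f) (psi u))).
  rewrite (partial_near i (near_dom Uu (partial_change j))).
  rewrite (partialD i (differentiable_mul (dp j ord0) (dfp ord0))
    (differentiable_mul (dp j ord_max) (dfp ord_max))).
  rewrite (partialM i (dp j ord0) (dfp ord0)) (partialM i (dp j ord_max) (dfp ord_max)).
  by rewrite !(partial_pullback i Uu (df _)).
have E : christoffel G' ord0 i j u * partial ord0 f' u
       + christoffel G' ord_max i j u * partial ord_max f' u =
    pull_gamma i j ord0 u * partial ord0 f (psi u)
    + pull_gamma i j ord_max u * partial ord_max f (psi u).
  rewrite !(partial_change _ Uu) -!(christoffel_change _ _ _ Uu).
  move: (christoffel _ _ _ _ _) (christoffel _ _ _ _ _) (jac ord0 _ u) (jac ord_max _ u) (jac ord0 _ u) (jac ord_max _ u).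
  by move: (partial _ _ _) (partial _ _ _) => *; ring.
rewrite /support_form E H (G'E _ _ Uu) (partialC ord_max ord0 _ sf) /pull_gamma.
set C := fun k i j => christoffel G k i j (psi u); rewrite -!/(C _ _ _).
pose p x y := jac x y u; rewrite -!/(p _ _).
move: p C (G (psi u)) => p C g.
move: (partial _ _ _) (partial _ _ _) (partial _ _ _) (partial _ _ _).
move: (partial _ _ _) (partial _ _ _) (partial _ _ _) => *; ring.
Qed.

(** All terms of the Codazzi equation other than the one with K transform by tensor rules already
    established, so comparing both charts isolates the two curvatures. Only first and second
    derivatives of psi enter, whereas transforming the curvature tensor directly would bring in
    third ones. *)
Lemma gauss_curvature_change_mul k u : U u ->
  (gauss_curvature G' u - gauss_curvature G (psi u))
  * (G' u ord_max k * partial ord0 f' u - G' u ord0 k * partial ord_max f' u) = 0.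
Proof.
move=> Uu.
have sb a c : smooth (support_form G f a c) by exact: smooth_support_form.
have db a c : differentiable (support_form G f a c) (psi u) by exact: smooth_diff.
have dbp a c := differentiable_pullback Uu (db a c).
have dp x y : differentiable (jac x y) u by exact: dP.
have Pb i a c : partial i (fun q => support_form G f a c (psi q)) u =
    jac i ord0 u * partial ord0 (support_form G f a c) (psi u)
    + jac i ord_max u * partial ord_max (support_form G f a c) (psi u).
  by rewrite (partial_pullback i Uu (db a c)).
have Db i j : partial i (support_form G' f' j k) u =
    (partial i (jac j ord0) u * jac k ord0 u + jac j ord0 u * partial i (jac k ord0) u)
      * support_form G f ord0 ord0 (psi u)
    + jac j ord0 u * jac k ord0 u * (jac i ord0 u * partial ord0 (support_form G f ord0 ord0) (psi u)
        + jac i ord_max u * partial ord_max (support_form G f ord0 ord0) (psi u))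
    + ((partial i (jac j ord0) u * jac k ord_max u + jac j ord0 u * partial i (jac k ord_max) u
      + (partial i (jac j ord_max) u * jac k ord0 u + jac j ord_max u * partial i (jac k ord0) u))
      * support_form G f ord0 ord_max (psi u)
    + (jac j ord0 u * jac k ord_max u + jac j ord_max u * jac k ord0 u)
      * (jac i ord0 u * partial ord0 (support_form G f ord0 ord_max) (psi u)
        + jac i ord_max u * partial ord_max (support_form G f ord0 ord_max) (psi u)))
    + ((partial i (jac j ord_max) u * jac k ord_max u + jac j ord_max u * partial i (jac k ord_max) u)
      * support_form G f ord_max ord_max (psi u)
    + jac j ord_max u * jac k ord_max u * (jac i ord0 u * partial ord0 (support_form G f ord_max ord_max) (psi u)
        + jac i ord_max u * partial ord_max (support_form G f ord_max ord_max) (psi u))).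
  rewrite (partial_near i (near_dom Uu (fun q Uq =>
    support_form_change j k Uq))).
  have dpp x y x' y' := differentiable_mul (dp x y) (dp x' y').
  have ds := differentiable_add (dpp j ord0 k ord_max) (dpp j ord_max k ord0).
  have d0 := differentiable_mul (dpp j ord0 k ord0) (dbp ord0 ord0).
  have d1 := differentiable_mul ds (dbp ord0 ord_max).
  have d2 := differentiable_mul (dpp j ord_max k ord_max) (dbp ord_max ord_max).
  rewrite (partialD i (differentiable_add d0 d1) d2) (partialD i d0 d1).
  rewrite (partialM i (dpp j ord0 k ord0) (dbp ord0 ord0)) (partialM i ds (dbp ord0 ord_max)).
  rewrite (partialM i (dpp j ord_max k ord_max) (dbp ord_max ord_max)).
  rewrite (partialD i (dpp j ord0 k ord_max) (dpp j ord_max k ord0)).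
  rewrite (partialM i (dp j ord0) (dp k ord0)) (partialM i (dp j ord_max) (dp k ord_max)).
  by rewrite (partialM i (dp j ord0) (dp k ord_max)) (partialM i (dp j ord_max) (dp k ord0)) !Pb.
(* The second derivatives of psi are expressed by the Christoffel symbols of both charts. *)
have hess i j a : partial i (jac j a) u =
    christoffel G' ord0 i j u * jac ord0 a u + christoffel G' ord_max i j u * jac ord_max a u
    - (christoffel G a ord0 ord0 (psi u) * jac i ord0 u * jac j ord0 u
     + christoffel G a ord0 ord_max (psi u) * (jac i ord0 u * jac j ord_max u + jac i ord_max u * jac j ord0 u)
     + christoffel G a ord_max ord_max (psi u) * jac i ord_max u * jac j ord_max u).
  by rewrite (christoffel_change i j a Uu) /pull_gamma addrK.
have := codazzi mG' sf' k u; rewrite !Db {Db} => Co'.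
have solve_K (x y z : R) : x = y + z -> z = x - y by move=> ->; rewrite addrC addKr.
rewrite mulrBl (solve_K _ _ _ Co') {Co'}.
have bC : support_form G f ord_max ord0 = support_form G f ord0 ord_max.
  by apply/funext => q; exact: support_formC.
have Co0 := codazzi mG sf ord0 (psi u); have Co1 := codazzi mG sf ord_max (psi u).
rewrite bC in Co0 Co1.
have -> : gauss_curvature G (psi u) *
    (G' u ord_max k * partial ord0 f' u - G' u ord0 k * partial ord_max f' u) =
  jac_det u * (jac k ord0 u * (gauss_curvature G (psi u) *
     (G (psi u) ord_max ord0 * partial ord0 f (psi u)
      - G (psi u) ord0 ord0 * partial ord_max f (psi u)))
   + jac k ord_max u * (gauss_curvature G (psi u) *
     (G (psi u) ord_max ord_max * partial ord0 f (psi u)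
      - G (psi u) ord0 ord_max * partial ord_max f (psi u)))).
  rewrite !(G'E _ _ Uu) !(partial_change _ Uu) /jac_det.
  rewrite (gram_sym mG (psi u) ord_max ord0).
  pose p x y := jac x y u; rewrite -!/(p _ _).
  by move: (gauss_curvature _ _) p (G (psi u)) (partial ord0 _ _) (partial ord_max _ _) => *; ring.
rewrite (solve_K _ _ _ Co0) (solve_K _ _ _ Co1) {Co0 Co1 solve_K}.
have bE a c := support_form_change a c Uu.
rewrite !bE !hess {bE hess Pb sb db dbp}.
rewrite !(christoffelC u (gram_sym mG') _ ord_max ord0) /jac_det.
rewrite !(christoffelC (psi u) (gram_sym mG) _ ord_max ord0).
set C := fun k i j => christoffel G k i j (psi u); rewrite -!/(C _ _ _).
set C' := fun k i j => christoffel G' k i j u; rewrite -!/(C' _ _ _).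
pose p x y := jac x y u; rewrite -!/(p _ _).
set b := fun i j => support_form G f i j (psi u); rewrite -!/(b _ _).
move: C C' p b (partial ord0 (support_form G f ord0 ord0) (psi u))
  (partial ord0 (support_form G f ord0 ord_max) (psi u))
  (partial ord0 (support_form G f ord_max ord_max) (psi u))
  (partial ord_max (support_form G f ord0 ord0) (psi u))
  (partial ord_max (support_form G f ord0 ord_max) (psi u))
  (partial ord_max (support_form G f ord_max ord_max) (psi u)).
by move=> C C' p b b0 b1 b2 b3 b4 b5; ring.
Qed.

(** If the curvatures differed, the equations for k = 0 and k = 1 together with the invertibility of
    G' would force df' = 0. *)
Lemma gauss_curvature_change u : U u ->
  (partial ord0 f' u != 0) || (partial ord_max f' u != 0) ->
  gauss_curvature G' u = gauss_curvature G (psi u).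
Proof.
move=> Uu f0.
have E0 := gauss_curvature_change_mul ord0 Uu.
have E1 := gauss_curvature_change_mul ord_max Uu.
apply/eqP; rewrite -subr_eq0; apply: contraT => K0.
have D0 := gram_det mG' u; move: D0 E0 E1; rewrite det2 (gram_sym mG' u ord_max ord0).
move/mulfI: K0; move: (_ - gauss_curvature _ _) => K K0.
move: f0 (G' u); move: (partial ord0 _ _) (partial ord_max _ _) => p q pq g D0.
rewrite -[X in _ = X -> _](mulr0 K) => /K0 E0.
rewrite -[X in _ = X -> _](mulr0 K) => /K0 E1.
have p0 : p = 0.
  apply: (mulfI D0); rewrite mulr0.
  transitivity (g ord0 ord0 * (g ord_max ord_max * p - g ord0 ord_max * q)
    - g ord0 ord_max * (g ord0 ord_max * p - g ord0 ord0 * q)); first by ring.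
  by rewrite E0 E1 !mulr0 subr0.
have q0 : q = 0.
  apply: (mulfI D0); rewrite mulr0.
  transitivity (g ord0 ord_max * (g ord_max ord_max * p - g ord0 ord_max * q)
    - g ord_max ord_max * (g ord0 ord_max * p - g ord0 ord0 * q)); first by ring.
  by rewrite E0 E1 !mulr0 subr0.
by move: pq; rewrite p0 q0 eqxx.
Qed.

Hypothesis Y_gt0 : forall q, 0 < height_det G f q.
Variable u : 'rV[R]_2.
Hypothesis Uu : U u.
Hypothesis K_E : gauss_curvature G' u = gauss_curvature G (psi u).

Let bE a c := support_form_change a c Uu.
Let dfE i := partial_change i Uu.

Lemma det_change : \det (G' u) = jac_det u ^+ 2 * \det (G (psi u)).
Proof.
rewrite !det2 !(G'E _ _ Uu) (gram_sym mG _ ord_max ord0) /jac_det.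
pose p x y := jac x y u; rewrite -!/(p _ _).
by move: p (G (psi u)) => *; ring.
Qed.

Lemma support_det_change :
  support_det G' f' u = jac_det u ^+ 2 * support_det G f (psi u).
Proof.
rewrite /support_det !bE /jac_det.
pose p x y := jac x y u; rewrite -!/(p _ _).
set b := fun i j => support_form G f i j (psi u); rewrite -!/(b _ _).
by move: p b => *; ring.
Qed.

Lemma adj_trace_change :
  adj_trace G' f' u = jac_det u ^+ 2 * adj_trace G f (psi u).
Proof.
rewrite /adj_trace !bE !(G'E _ _ Uu) /jac_det.
pose p x y := jac x y u; rewrite -!/(p _ _).
set b := fun i j => support_form G f i j (psi u); rewrite -!/(b _ _).
by move: p b (G (psi u)) => *; ring.
Qed.

Lemma height_det_change :
  height_det G' f' u = jac_det u ^+ 2 * height_det G f (psi u).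
Proof.
rewrite /height_det det_change (f'E Uu) /adj_norm !dfE !(G'E _ _ Uu) /jac_det.
move: (partial _ _ _) (partial _ _ _) (f _) (\det (G (psi u))) => a b c d.
pose p x y := jac x y u; rewrite -!/(p _ _).
by move: p (G (psi u)) => *; ring.
Qed.

Lemma sqrt_height_det_change :
  Num.sqrt (height_det G' f' u) = `|jac_det u| * Num.sqrt (height_det G f (psi u)).
Proof. by rewrite height_det_change sqrtrM ?sqr_ge0// sqrtr_sqr. Qed.

Let d0 : `|jac_det u| != 0. Proof. by rewrite normr_eq0 P_neq0. Qed.
Let dE : jac_det u ^+ 2 = `|jac_det u| ^+ 2.
Proof. by rewrite real_normK// num_real. Qed.
Let y0 : Num.sqrt (height_det G f (psi u)) != 0.
Proof. by rewrite gt_eqF// sqrtr_gt0. Qed.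

Lemma scal_density_change :
  scal_density G' f' u = `|jac_det u| * scal_density G f (psi u).
Proof.
rewrite /scal_density sqrt_height_det_change K_E support_det_change det_change
  height_det_change (f'E Uu).
have Y0 : height_det G f (psi u) != 0 by rewrite gt_eqF.
rewrite dE; move: (Num.sqrt _) y0 => y y0'; move: (`|_|) d0 (height_det _ _ _) Y0 => d d0' Y Y0.
move: (support_det _ _ _) (\det (G (psi u))) (gauss_curvature _ _) (f _) => *.
by field; rewrite ?d0' ?y0' ?Y0.
Qed.

Lemma mean_density_change :
  mean_density G' f' u = `|jac_det u| * mean_density G f (psi u).
Proof.
rewrite /mean_density sqrt_height_det_change adj_trace_change.
rewrite dE; move: (`|_|) d0 (Num.sqrt _) y0 (adj_trace _ _ _) => d d0' y y0' *.
by field; rewrite ?d0' ?y0'.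
Qed.

Lemma height_density_change :
  height_density G' f' u = `|jac_det u| * height_density G f (psi u).
Proof.
rewrite /height_density sqrt_height_det_change support_det_change K_E.
rewrite dE; move: (`|_|) d0 (Num.sqrt _) y0 (support_det _ _ _) (gauss_curvature _ _) => d d0' y y0' *.
by field; rewrite ?d0' ?y0'.
Qed.

(** The flux transforms as a vector density, by |det J| J^-1; multiplying by [jac_det] replaces the
    inverse by the adjugate and records the sign of the orientation. *)
Lemma flux_change :
  jac_det u * flux0 G' f' u = `|jac_det u| *
    (jac ord_max ord_max u * flux0 G f (psi u) - jac ord_max ord0 u * flux1 G f (psi u)) /\
  jac_det u * flux1 G' f' u = `|jac_det u| *
    (jac ord0 ord0 u * flux1 G f (psi u) - jac ord0 ord_max u * flux0 G f (psi u)).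
Proof.
have := d0; have := y0; rewrite /flux0 /flux1 sqrt_height_det_change !bE !dfE.
move: (Num.sqrt _) => y y0'.
have : `|jac_det u| * `|jac_det u| = jac_det u * jac_det u by rewrite -!expr2 dE.
move: (`|jac_det u|) => d dd dn0.
set b := fun i j => support_form G f i j (psi u); rewrite -!/(b _ _).
move: (partial ord0 _ _) (partial ord_max _ _) => f0 f1.
have key (X : R) : jac_det u * (jac_det u * X / (d * y)) = d * (X / y).
  by rewrite mulrA mulrA -dd; field; rewrite y0' dn0.
have split2 (p q a c : R) : p * (a / y) - q * (c / y) = (p * a - q * c) / y.
  by field.
rewrite !split2 -!key /jac_det; pose p x y := jac x y u; rewrite -!/(p _ _).
by move: b p => b p; split; congr (_ * (_ / _)); ring.
Qed.

End Scalar.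
End CoordinateChange.

(** Needed because the explicit formula for the Jacobian of the inversion is established only off
    the origin. *)
Lemma differentiable_near (R : realType) (V W : normedModType R) (F G : V -> W) p :
  (\forall q \near p, F q = G q) -> differentiable F p -> differentiable G p.
Proof.
move=> FG /diff_locallyP [dc dF].
have FGp : F p = G p by exact: nbhs_singleton FG.
have FG0 : \forall h \near (0 : V), F (h + p) = G (h + p).
  have := FG; rewrite (near_shift 0 p) /= => H.
  by apply: filterS H => h; rewrite /= subr0.
have dG : G \o shift p = cst (G p) + 'd F p +o_ 0 id.
  apply/eqaddoE/eqaddoP => e e0; move/eqaddoP : dF => /(_ e e0) dF.
  apply: filterS2 dF FG0 => h /=.
  by rewrite !fctE /= FGp => + <-.
have dd := diff_unique dc dG.
by apply/diff_locallyP; rewrite dd.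
Qed.

(** * The two stereographic charts and the inversion between them *)

Section Stereo.
Context {R : realType}.
Implicit Types (a b c i j : 'I_2) (u v w : 'rV[R]_2) (s : bool).

Definition sqn u : R := u 0 ord0 ^+ 2 + u 0 ord_max ^+ 2.

Local Notation xa a := (lshift 1 (a : 'I_2) : 'I_(2 + 1)).
Local Notation xz := (rshift 2 (ord0 : 'I_1) : 'I_(2 + 1)).

Lemma sqn_ge0 u : 0 <= sqn u. Proof. by rewrite addr_ge0// sqr_ge0. Qed.

Lemma sqn1_gt0 u : 0 < 1 + sqn u. Proof. by rewrite ltr_pwDl// sqn_ge0. Qed.

Lemma sqn1_neq0 u : 1 + sqn u != 0. Proof. by rewrite gt_eqF// sqn1_gt0. Qed.

Lemma smooth_sqn : smooth sqn.
Proof. by rewrite /sqn; smooth_tac. Qed.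

Lemma partial_sqn i u : partial i sqn u = 2 * u 0 i.
Proof.
have du a : differentiable (fun q : 'rV[R]_2 => q 0 a) u by exact: differentiable_coord.
rewrite (partialD i (differentiable_mul (du ord0) (du ord0))
  (differentiable_mul (du ord_max) (du ord_max))).
rewrite (partialM i (du ord0) (du ord0)) (partialM i (du ord_max) (du ord_max)).
rewrite !partial_coord.
by have [->|->] := ord2 i; rewrite !eqxx /=; move: (u 0 ord0) (u 0 ord_max) => *; ring.
Qed.

Lemma sqnE u : (u *m u^T) 0 0 = sqn u.
Proof. by rewrite mxE sum2 !mxE -!expr2. Qed.

Lemma stereo_a s u a : stereo s u 0 (xa a) = 2 * u 0 a / (1 + sqn u).
Proof. by rewrite /stereo sqnE mxE row_mxEl mxE mulrC. Qed.

Lemma stereo_z s u : stereo s u 0 xz = (-1) ^+ s * (sqn u - 1) / (1 + sqn u).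
Proof. by rewrite /stereo sqnE mxE row_mxEr mxE eqxx mulr1n mulrC. Qed.

Lemma ord3'_ind (P : 'I_(2 + 1) -> Prop) : (forall a, P (xa a)) -> P xz ->
  forall k, P k.
Proof.
by move=> Pa Pz k; case: (split_ordP k) => [j ->//|l ->]; rewrite (ord1 l).
Qed.

Lemma sum3' (V : nmodType) (F : 'I_(2 + 1) -> V) :
  \sum_i F i = F (xa ord0) + F (xa ord_max) + F xz.
Proof. by rewrite big_split_ord/= big_ord1 sum2. Qed.

Lemma smooth_sqn1V : smooth (fun u => (1 + sqn u)^-1).
Proof.
apply: smoothV; first exact: sqn1_neq0.
by apply: smoothD; [exact: smooth_cst|exact: smooth_sqn].
Qed.

Lemma smooth_stereo s (i : 'I_3) : smooth (fun u => stereo s u 0 i).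
Proof.
have s1 := smooth_sqn1V; have s2 := smooth_sqn.
elim/ord3'_ind: i => [a|].
  rewrite (_ : (fun u => _) = fun u => 2 * u 0 a * (1 + sqn u)^-1).
    by smooth_tac.
  by apply/funext => u; exact: stereo_a.
rewrite (_ : (fun u => _) = fun u => (-1) ^+ s * (sqn u - 1) * (1 + sqn u)^-1).
  by smooth_tac.
by apply/funext => u; exact: stereo_z.
Qed.

Lemma differentiable_stereo s u : differentiable (stereo s : 'rV[R]_2 -> _) u.
Proof. by apply: differentiable_rV => j; apply: smooth_diff; exact: smooth_stereo. Qed.

Lemma stereo_sphere s u : sphere2 (stereo s u).
Proof.
rewrite /sphere2 /=; apply/matrixP => i j; rewrite (ord1 i) (ord1 j) mxE sum3'.
have T (M : 'rV[R]_3) k : M^T k 0 = M 0 k by rewrite mxE.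
rewrite !T !stereo_a stereo_z mxE /= mulr1n.
have := sqn1_neq0 u; rewrite /sqn.
move: (u 0 ord0) (u 0 ord_max) => x y d0.
case: s; rewrite /= ?expr1 ?expr0; by field.
Qed.

Lemma stereo_jacobian_a s u i a : 'J (stereo s) u i (xa a) =
  2 * (i == a)%:R / (1 + sqn u) - 4 * u 0 a * u 0 i / (1 + sqn u) ^+ 2.
Proof.
rewrite (jacobianE i (xa a) (differentiable_stereo s u)).
rewrite (_ : (fun u => _) = fun u => 2 * u 0 a * (1 + sqn u)^-1); last first.
  by apply/funext => q; exact: stereo_a.
have du : differentiable (fun q : 'rV[R]_2 => q 0 a) u by exact: differentiable_coord.
have d2 : differentiable (fun=> 2 : R) (u : 'rV[R]_2) by exact: differentiable_cst.
have d1 : differentiable (fun=> 1 : R) (u : 'rV[R]_2) by exact: differentiable_cst.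
have dq : differentiable sqn u by apply: smooth_diff; exact: smooth_sqn.
rewrite (partial_div i (differentiable_mul d2 du) (differentiable_add d1 dq) (sqn1_neq0 u)).
rewrite (partialM i d2 du) (partialD i d1 dq) !partial_cst partial_coord partial_sqn.
have := sqn1_neq0 u; move: (1 + sqn u) (u 0 a) (u 0 i) (i == a)%:R => d x y e d0.
by field.
Qed.

Lemma stereo_jacobian_z s u i : 'J (stereo s) u i xz =
  (-1) ^+ s * (4 * u 0 i) / (1 + sqn u) ^+ 2.
Proof.
rewrite (jacobianE i xz (differentiable_stereo s u)).
rewrite (_ : (fun u => _) = fun u => (-1) ^+ s * (sqn u - 1) * (1 + sqn u)^-1); last first.
  by apply/funext => q; exact: stereo_z.
have d2 : differentiable (fun=> (-1) ^+ s : R) (u : 'rV[R]_2) by exact: differentiable_cst.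
have d1 : differentiable (fun=> 1 : R) (u : 'rV[R]_2) by exact: differentiable_cst.
have dq : differentiable sqn u by apply: smooth_diff; exact: smooth_sqn.
rewrite (partial_div i (differentiable_mul d2 (differentiable_sub dq d1)) (differentiable_add d1 dq) (sqn1_neq0 u)).
rewrite (partialM i d2 (differentiable_sub dq d1)) (partialB i dq d1) (partialD i d1 dq) !partial_cst partial_sqn.
have := sqn1_neq0 u; move: (sqn u) (u 0 i) ((-1) ^+ s) => d x y d0.
by field.
Qed.

Lemma row_jacobian_stereo s u v :
  (forall a, (v *m 'J (stereo s) u) 0 (xa a) = 2 * v 0 a / (1 + sqn u)
     - 4 * u 0 a * (v 0 ord0 * u 0 ord0 + v 0 ord_max * u 0 ord_max) / (1 + sqn u) ^+ 2) /\
  (v *m 'J (stereo s) u) 0 xz = (-1) ^+ s *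
    (4 * (v 0 ord0 * u 0 ord0 + v 0 ord_max * u 0 ord_max)) / (1 + sqn u) ^+ 2.
Proof.
have d0 := sqn1_neq0 u.
have Ja i a := stereo_jacobian_a s u i a; have Jz i := stereo_jacobian_z s u i.
move: ('J (stereo s) u) Ja Jz => J Ja Jz.
split=> [a|]; rewrite mxE sum2 ?Jz ?Ja.
  by have [->|->] := ord2 a; rewrite ?eqxx /=; move: (1 + sqn u) d0 (u 0 _) (u 0 _) (v 0 _) (v 0 _)
   => d d0 *; field.
by move: (1 + sqn u) d0 (u 0 _) (u 0 _) (v 0 _) (v 0 _) ((-1) ^+ s) => d d0 *; field.
Qed.

Lemma stereo_tangent s u v : (v *m 'J (stereo s) u) *m (stereo s u)^T = 0.
Proof.
have [Ja Jz] := row_jacobian_stereo s u v.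
have d0 := sqn1_neq0 u.
move: (v *m _) Ja Jz => w Ja Jz.
apply/matrixP => i j; rewrite (ord1 i) (ord1 j) [LHS]mxE sum3' !Ja !Jz.
have T (M : 'rV[R]_3) k : M^T k 0 = M 0 k by rewrite mxE.
rewrite !T !stereo_a stereo_z mxE.
move: d0; rewrite /sqn; move: (u 0 ord0) (u 0 ord_max) (v 0 ord0) (v 0 ord_max) => x y z t d0.
by clear Ja Jz; case: s; rewrite /= ?expr1 ?expr0; field.
Qed.

(** The last coordinate forces v to be orthogonal to u; the others then reduce to 2 v / (1 +
    |u|^2). *)
Lemma stereo_immersion s u v : v *m 'J (stereo s) u = 0 -> v = 0.
Proof.
have [Ja Jz] := row_jacobian_stereo s u v.
have d0 := sqn1_neq0 u; move=> vJ; rewrite vJ in Ja Jz.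
have vu : v 0 ord0 * u 0 ord0 + v 0 ord_max * u 0 ord_max = 0.
  move/eqP: Jz; rewrite mxE eq_sym mulf_eq0 invr_eq0 expf_eq0 (negbTE d0) andbF orbF.
  by rewrite mulf_eq0 signr_eq0 mulf_eq0 pnatr_eq0 => /eqP.
apply/rowP => a; rewrite mxE; move/eqP: (Ja a).
rewrite vu mxE mulr0 mul0r subr0 eq_sym mulf_eq0 invr_eq0 (negbTE d0) orbF.
by rewrite mulf_eq0 pnatr_eq0 => /eqP.
Qed.

Lemma ip_pullback (n m : nat) (F : 'rV[R]_m -> 'rV[R]_n) (H : 'rV[R]_n -> 'M[R]_n)
    x (v w : 'rV[R]_m) :
  ip (pullback F H x) v w = ip (H (F x)) (v *m 'J F x) (w *m 'J F x).
Proof. by rewrite /ip /pullback trmx_mul !mulmxA. Qed.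

Lemma entry_ip (n : nat) (M : 'M[R]_n) (i j : 'I_n) : M i j = ip M (delta_mx 0 i) (delta_mx 0 j).
Proof. by rewrite /ip -rowE trmx_delta -colE !mxE. Qed.

Variable g : 'rV[R]_3 -> 'M[R]_3.
Hypothesis g_metric : riemannian_metric g.

Lemma pullback_sym s u i j : pullback (stereo s) g u i j = pullback (stereo s) g u j i.
Proof.
have [sym _ _] := g_metric.
rewrite !(entry_ip (pullback _ _ _)) !ip_pullback.
by apply: sym; [exact: stereo_sphere|exact: stereo_tangent|exact: stereo_tangent].
Qed.

Lemma pullback_pos s u v : v != 0 -> 0 < ip (pullback (stereo s) g u) v v.
Proof.
have [_ pos _] := g_metric.
move=> v0; rewrite ip_pullback; apply: pos; [exact: stereo_sphere|exact: stereo_tangent|].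
by apply: contra_neq v0; exact: stereo_immersion.
Qed.

Lemma pullback00_gt0 s u : 0 < pullback (stereo s) g u ord0 ord0.
Proof.
rewrite entry_ip pullback_pos//; apply/eqP => /rowP/(_ ord0).
by rewrite !mxE !eqxx => /eqP; rewrite oner_eq0.
Qed.

Lemma smooth_metric_pullback s : smooth_metric (pullback (stereo s) g).
Proof.
have [_ _ sm] := g_metric; split=> [u i j|i j|u]; [exact: pullback_sym|exact: sm|].
have := pullback00_gt0 s u; have S := pullback_sym s u ord_max ord0.
have P := @pullback_pos s u; move: (pullback _ _ _) S P => M S P M0.
(* On this vector the quadratic form takes the value [M ord0 ord0 * \det M], so positivity transfers
   to the determinant. *)
pose v : 'rV[R]_2 := \row_a (if a == ord0 then - M ord0 ord_max else M ord0 ord0).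
have v0 : v != 0.
  by apply/eqP => /rowP/(_ ord_max); rewrite !mxE /= => m0; move: M0; rewrite m0 ltxx.
rewrite -(pmulr_rgt0 _ M0); suff <- : ip M v v = M ord0 ord0 * \det M by exact: P.
have vM a : (v *m M) 0 a = v 0 ord0 * M ord0 a + v 0 ord_max * M ord_max a.
  by rewrite mxE sum2.
have vT a : v^T a 0 = v 0 a by rewrite mxE.
have vE a : v 0 a = if a == ord0 then - M ord0 ord_max else M ord0 ord0 by rewrite mxE.
rewrite /ip mxE sum2 !vM !vT !vE /= det2 S.
by move: (M _ _) (M _ _) (M _ _) => *; ring.
Qed.

(** The transition map between the charts. At the origin its value is the default 0, which
    [punctured] excludes. *)
Definition inversion u : 'rV[R]_2 := (sqn u)^-1 *: u.

Definition punctured : set 'rV[R]_2 := [set u | sqn u != 0].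

Lemma open_punctured : open punctured.
Proof.
rewrite openE => u u0; have c : {for u, continuous sqn} by exact: (smooth_continuous smooth_sqn).
exact: (cvgr_neq0 _ c u0).
Qed.

Lemma inversion_entry u a : inversion u 0 a = u 0 a / sqn u.
Proof. by rewrite mxE mulrC. Qed.

Lemma sqn_inversion u : sqn u != 0 -> sqn (inversion u) = (sqn u)^-1.
Proof.
rewrite {2}/sqn !inversion_entry /sqn.
by move: (u 0 ord0) (u 0 ord_max) => x y d0; field.
Qed.

Lemma stereo_inversion u : punctured u -> stereo false u = stereo true (inversion u).
Proof.
rewrite /punctured /= => u0; have d0 := sqn1_neq0 u; have d1 := sqn1_neq0 (inversion u).
move: d1; rewrite sqn_inversion// => d1.
apply/rowP => i; elim/ord3'_ind: i => [a|].
  rewrite !stereo_a sqn_inversion// inversion_entry.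
  by move: (sqn u) (u 0 a) u0 d0 d1 => q x q0 d0 d1; field; rewrite ?[q + 1]addrC ?q0 ?d0 ?d1.
rewrite !stereo_z sqn_inversion// expr0 expr1.
by move: (sqn u) u0 d0 d1 => q q0 d0 d1; field; rewrite ?[q + 1]addrC ?q0 ?d0 ?d1.
Qed.

Definition inversion_jac i a u : R :=
  ((i == a)%:R - 2 * u 0 a * u 0 i / sqn u) / sqn u.

Lemma differentiable_inversion_entry u a : punctured u ->
  differentiable (fun q => inversion q 0 a) u.
Proof.
move=> u0; under eq_fun do rewrite inversion_entry.
apply: differentiable_mul; first exact: differentiable_coord.
by apply: differentiable_inv => //; apply: smooth_diff; exact: smooth_sqn.
Qed.

Lemma differentiable_inversion u : punctured u -> differentiable inversion u.
Proof. by move=> u0; apply: differentiable_rV => j; exact: differentiable_inversion_entry. Qed.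

Lemma jac_inversion i a u : punctured u -> jac inversion i a u = inversion_jac i a u.
Proof.
rewrite /punctured /= => u0; rewrite /jac; under eq_fun do rewrite inversion_entry.
have dq : differentiable sqn u by apply: smooth_diff; exact: smooth_sqn.
have du : differentiable (fun q : 'rV[R]_2 => q 0 a) u by exact: differentiable_coord.
rewrite (partial_div i du dq u0) partial_coord partial_sqn /inversion_jac.
by move: (i == a)%:R (u 0 a) (u 0 i) (sqn u) u0 => e x y q q0; field.
Qed.

Lemma near_jac_inversion i a u : punctured u ->
  \forall q \near u, inversion_jac i a q = jac inversion i a q.
Proof.
move=> u0; apply: filterS (open_nbhs_nbhs (conj open_punctured u0)) => q q0.
by rewrite jac_inversion.
Qed.

Lemma differentiable_inversion_jac i a u : punctured u ->
  differentiable (inversion_jac i a) u.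
Proof.
move=> u0; have dq : differentiable sqn u by apply: smooth_diff; exact: smooth_sqn.
have dqV := differentiable_inv dq u0.
have dc b : differentiable (fun q : 'rV[R]_2 => q 0 b) u by exact: differentiable_coord.
apply: differentiable_mul => //; apply: differentiable_sub; first exact: differentiable_cst.
apply: differentiable_mul => //; apply: differentiable_mul => //.
by apply: differentiable_mul => //; exact: differentiable_cst.
Qed.

Lemma differentiable_jac_inversion i a u : punctured u ->
  differentiable (jac inversion i a) u.
Proof.
move=> u0; apply: differentiable_near (near_jac_inversion i a u0) _.
exact: differentiable_inversion_jac.
Qed.

Lemma jac_inversionC i j a u : punctured u ->
  partial i (jac inversion j a) u = partial j (jac inversion i a) u.
Proof.
rewrite /punctured /= => u0; rewrite -(partial_near i (near_jac_inversion j a u0)).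
rewrite -(partial_near j (near_jac_inversion i a u0)).
have dq : differentiable sqn u by apply: smooth_diff; exact: smooth_sqn.
have dc b : differentiable (fun q : 'rV[R]_2 => q 0 b) u by exact: differentiable_coord.
have d2 : differentiable (fun=> 2 : R) (u : 'rV[R]_2) by exact: differentiable_cst.
have H k l : partial k (inversion_jac l a) u =
   (0 - (2 * (k == a)%:R * u 0 l + 2 * u 0 a * (k == l)%:R
      - 2 * u 0 a * u 0 l / sqn u * (2 * u 0 k)) / sqn u
    - ((l == a)%:R - 2 * u 0 a * u 0 l / sqn u) / sqn u * (2 * u 0 k)) / sqn u.
  have dM := differentiable_mul (differentiable_mul d2 (dc a)) (dc l).
  have dl : differentiable (fun=> (l == a)%:R : R) (u : 'rV[R]_2) by exact: differentiable_cst.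
  have dD : differentiable (fun q : 'rV[R]_2 => 2 * q 0 a * q 0 l / sqn q) u.
    exact: (differentiable_mul dM (differentiable_inv dq u0)).
  rewrite (partial_div k (differentiable_sub dl dD) dq u0) (partialB k dl dD).
  rewrite (partial_div k dM dq u0) (partialM k (differentiable_mul d2 (dc a)) (dc l)).
  rewrite (partialM k d2 (dc a)) !partial_cst !partial_coord partial_sqn.
  move: (k == a)%:R (k == l)%:R (l == a)%:R (u 0 a) (u 0 l) (u 0 k) (sqn u) u0.
  by move=> e1 e2 e3 x y w q q0; field.
rewrite !H (eq_sym j i).
move: (i == a)%:R (j == a)%:R (i == j)%:R (u 0 a) (u 0 i) (u 0 j) (sqn u) u0.
by move=> e1 e2 e3 x y z q q0; field.
Qed.

(** The inversion reverses orientation, hence the sign. The modulus |u|^-4 is the decay rate of the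
    densities. *)
Lemma jac_det_inversion u : punctured u -> jac_det inversion u = - (sqn u)^-1 ^+ 2.
Proof.
move=> u0; rewrite /jac_det !jac_inversion// /inversion_jac !eqxx /=.
move: u0; rewrite /punctured /= /sqn; move: (u 0 ord0) (u 0 ord_max) => x y q0.
by field.
Qed.

Lemma pullback_inversion u i j : punctured u -> pullback (stereo false) g u i j =
  jac inversion i ord0 u * jac inversion j ord0 u
    * pullback (stereo true) g (inversion u) ord0 ord0
  + (jac inversion i ord0 u * jac inversion j ord_max u
    + jac inversion i ord_max u * jac inversion j ord0 u)
    * pullback (stereo true) g (inversion u) ord0 ord_max
  + jac inversion i ord_max u * jac inversion j ord_max u
    * pullback (stereo true) g (inversion u) ord_max ord_max.
Proof.
move=> u0.
have JE : 'J (stereo false) u = 'J inversion u *m 'J (stereo true) (inversion u).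
  rewrite -jacobian_comp; [|exact: differentiable_inversion|exact: differentiable_stereo].
  have dc : differentiable (stereo true \o inversion : 'rV[R]_2 -> _) u.
    apply: differentiable_comp; first exact: differentiable_inversion.
    exact: differentiable_stereo.
  apply/matrixP => a b.
  apply: (etrans (jacobianE a b (differentiable_stereo _ u))).
  apply: (etrans _ (esym (jacobianE a b dc))).
  apply: partial_near; apply: filterS (open_nbhs_nbhs (conj open_punctured u0)) => q q0.
  by rewrite stereo_inversion.
have PE : pullback (stereo false) g u = 'J inversion u *m
    pullback (stereo true) g (inversion u) *m ('J inversion u)^T.
  by rewrite /pullback JE stereo_inversion// trmx_mul !mulmxA.
have S := pullback_sym true (inversion u) ord_max ord0.
have Ji a b : 'J inversion u a b = jac inversion a b u.
  exact: (jacobianE a b (differentiable_inversion u0)).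
rewrite PE; move: (pullback (stereo true) g (inversion u)) S => M S.
move: ('J inversion u) Ji => J Ji.
have mul3 (N : 'M[R]_2) : (J *m N *m J^T) i j =
    (J i ord0 * N ord0 ord0 + J i ord_max * N ord_max ord0) * J j ord0
    + (J i ord0 * N ord0 ord_max + J i ord_max * N ord_max ord_max) * J j ord_max.
  by rewrite !mxE sum2 !mxE !sum2.
rewrite mul3 !Ji S.
by move: (M _ _) (M _ _) (M _ _) (jac _ _ _ _) (jac _ _ _ _) (jac _ _ _ _) (jac _ _ _ _) => *; ring.
Qed.

End Stereo.

(** * Bounds at infinity obtained from the opposite chart *)

Section Bounds.
Context {R : realType}.
Implicit Types (a b c i j : 'I_2) (u v w : 'rV[R]_2).

Lemma adj_normE (G : 'rV[R]_2 -> 'M[R]_2) (h : 'rV[R]_2 -> R) u :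
  smooth_metric G -> ip (G u) (grad G h u) (grad G h u) = adj_norm G h u / \det (G u).
Proof.
move=> mG; have d0 := gram_det mG u.
have [i00 i01 i10 i11] := invmx2 d0.
have gE a : grad G h u 0 a = partial ord0 h u * invmx (G u) ord0 a
    + partial ord_max h u * invmx (G u) ord_max a.
  by rewrite /grad mxE sum2; congr (_ * _ + _ * _); rewrite mxE.
move: (grad G h u) gE => w gE.
rewrite /ip mxE sum2 /adj_norm.
have T a : w^T a 0 = w 0 a by rewrite mxE.
have M a : (w *m G u) 0 a = w 0 ord0 * G u ord0 a + w 0 ord_max * G u ord_max a.
  by rewrite mxE sum2.
rewrite !T !M !gE i00 i01 i10 i11 (gram_sym mG u ord_max ord0).
move: d0; rewrite det2 (gram_sym mG u ord_max ord0).
by move: (G u) (partial ord0 _ _) (partial ord_max _ _) => m p q d0; field.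
Qed.

Lemma adj_norm_lt (G : 'rV[R]_2 -> 'M[R]_2) (h : 'rV[R]_2 -> R) u : smooth_metric G ->
  ipnorm (G u) (grad G h u) < 1 -> adj_norm G h u < \det (G u).
Proof.
move=> mG; rewrite /ipnorm adj_normE//; have [_ _ /(_ u) D0] := mG.
rewrite -{1}(@sqrtr1 R) => lt1.
have : adj_norm G h u / \det (G u) < 1.
  by rewrite ltNge; apply/negP => /ler_wsqrtr; rewrite leNgt lt1.
by rewrite ltr_pdivrMr// mul1r.
Qed.

(** The copies of this compact square in the two charts cover the sphere: points outside it satisfy
    |u| >= 1 and are inverted into it. *)
Definition unit_box : set 'rV[R]_2 := [set u | forall a, `|u 0 a| <= 1].

Lemma compact_unit_box : compact unit_box.
Proof.
have -> : unit_box = [set u : 'rV[R]_2 | forall a, `[(-1 : R), 1]%classic (u ord0 a)].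
  by apply/seteqP; split => u /= H a; have := H a; rewrite in_itv /= ler_norml.
apply: (@rV_compact _ _ (fun _ : 'I_2 => `[(-1 : R), 1]%classic)) => a.
exact: segment_compact.
Qed.

Lemma unit_box_bound (h : 'rV[R]_2 -> R) : continuous h ->
  exists2 M, 0 <= M & forall u, unit_box u -> `|h u| <= M.
Proof.
move=> ch.
have cn : {within unit_box, continuous (fun u => `|h u|)}.
  apply: continuous_subspaceT => u; exact: (continuous_comp (ch u) (@norm_continuous _ _ _)).
have [|c _ Hc] := compact_EVT_max _ compact_unit_box cn.
  by exists 0 => a /=; rewrite mxE normr0.
by exists `|h c| => // u Bu; apply: Hc; exact: mem_set.
Qed.

Lemma entry_sqr_le u a : u 0 a ^+ 2 <= sqn u.
Proof.
by have [->|->] := ord2 a; rewrite /sqn ?lerDl ?lerDr sqr_ge0.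
Qed.

Lemma unit_box_sqn u : unit_box u -> forall a, u 0 a ^+ 2 <= 1.
Proof. by move=> Bu a; rewrite -(real_normK (num_real _)) exprn_ile1. Qed.

Lemma outside_unit_box u : ~ unit_box u -> 1 <= sqn u.
Proof.
move=> nB; have [a] : exists a, 1 < `|u 0 a|.
  by apply: contrapT => H; apply: nB => a; rewrite leNgt; apply/negP => lt; apply: H; exists a.
move=> lt; apply: le_trans (entry_sqr_le u a).
by rewrite -(real_normK (num_real _)) exprn_ege1// ltW.
Qed.

Lemma inversion_unit_box u : 1 <= sqn u -> unit_box (inversion u).
Proof.
move=> q1 a; have q0 : 0 < sqn u by rewrite (lt_le_trans ltr01).
have := entry_sqr_le (inversion u) a; rewrite sqn_inversion ?gt_eqF// => le.
have : `|inversion u 0 a| ^+ 2 <= 1.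
  by rewrite real_normK ?num_real// (le_trans le)// invf_le1.
by rewrite expr_le1.
Qed.

(** Inside the box h' is bounded by compactness, outside it by the bound for h times |u|^-4. The
    majorant is a product in the two coordinates, so that its integrability reduces to one
    variable. *)
Lemma density_decay (h h' : 'rV[R]_2 -> R) : continuous h -> continuous h' ->
  (forall u, punctured u -> h' u = `|jac_det inversion u| * h (inversion u)) ->
  exists2 C, 0 <= C & forall u, `|h' u| <= C / ((1 + u 0 ord0 ^+ 2) * (1 + u 0 ord_max ^+ 2)).
Proof.
move=> ch ch' hh'.
have [M M0 HM] := unit_box_bound ch; have [M' M'0 HM'] := unit_box_bound ch'.
(* The product of the factors 1 + u_a^2 is at most 2 * 2 in the box and at most (2 |u|^2)^2
   outside. *)
exists (4 * (M + M')); first by rewrite mulr_ge0// addr_ge0.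
move=> u; have p0 a : 0 < 1 + u 0 a ^+ 2 by rewrite ltr_pwDl// sqr_ge0.
rewrite ler_pdivlMr ?mulr_gt0//.
have [Bu|/outside_unit_box q1] := pselect (unit_box u).
  have le2 a : 1 + u 0 a ^+ 2 <= 2 by rewrite -[2](natrD _ 1 1) lerD2l unit_box_sqn.
  rewrite mulrC ler_pM ?mulr_ge0 ?(ltW (p0 _))//.
    have -> : 4 = 2 * 2 :> R by ring.
    by rewrite ler_pM ?(ltW (p0 _)).
  by rewrite (le_trans (HM' u Bu))// lerDr.
have q0 : 0 < sqn u by rewrite (lt_le_trans ltr01).
have pu : punctured u by rewrite /punctured/= gt_eqF.
rewrite hh'// normrM normr_id jac_det_inversion// normrN normrX normfV (gtr0_norm q0).
have HMi := HM _ (inversion_unit_box q1).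
rewrite expr2; set k := (sqn u)^-1.
have k0 : 0 < k by rewrite invr_gt0.
have le1 : (1 + u 0 ord0 ^+ 2) * (1 + u 0 ord_max ^+ 2) <= 4 * (sqn u * sqn u).
  rewrite (_ : 4 * (sqn u * sqn u) = (2 * sqn u) * (2 * sqn u)); last by ring.
  have le2 a : 1 + u 0 a ^+ 2 <= 2 * sqn u.
    by rewrite mulrDl !mul1r lerD// entry_sqr_le.
  by rewrite ler_pM ?(ltW (p0 _)).
apply: (@le_trans _ _ (k * k * M * (4 * (sqn u * sqn u)))).
  apply: ler_pM => //; rewrite ?mulr_ge0 ?(ltW k0) ?(ltW (p0 _))//.
  by rewrite ler_pM2l ?mulr_gt0.
rewrite (_ : k * k * M * _ = 4 * M * (k * sqn u) ^+ 2); last by ring.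
by rewrite /k mulVf ?gt_eqF// expr1n mulr1 ler_wpM2l// lerDl.
Qed.

(** The constant is 1 + 2, from the Kronecker symbol and from 2 |u_a u_i| <= 2 |u|^2. *)
Lemma inversion_jac_bound i a u : 1 <= sqn u -> `|jac inversion i a u| <= 3 / sqn u.
Proof.
move=> q1; have q0 : 0 < sqn u by rewrite (lt_le_trans ltr01).
have pu : punctured u by rewrite /punctured/= gt_eqF.
rewrite jac_inversion// /inversion_jac normrM normfV (gtr0_norm q0).
rewrite ler_wpM2r ?invr_ge0 ?(ltW q0)//.
apply: le_trans (ler_normB _ _) _; rewrite (_ : 3 = 1 + 2); last by ring.
rewrite lerD//; first by case: (i == a); rewrite ?normr1 ?normr0.
rewrite normrM normfV (gtr0_norm q0) ler_pdivrMr// -mulrA normrM ger0_norm//.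
rewrite ler_pM2l// normrM -(@ler_pXn2r _ 2)// ?nnegrE ?mulr_ge0 ?(ltW q0)//.
by rewrite exprMn !real_normK ?num_real// expr2 ler_pM ?sqr_ge0// entry_sqr_le.
Qed.

(** A vector density gains one Jacobian entry, of order |u|^-2. The indices are left free so that
    both components of the flux are covered. *)
Lemma flux_decay (h0 h1 h' : 'rV[R]_2 -> R) i a j b : continuous h0 -> continuous h1 ->
  continuous h' -> (forall u, punctured u -> jac_det inversion u * h' u =
    `|jac_det inversion u| * (jac inversion i a u * h0 (inversion u)
                              - jac inversion j b u * h1 (inversion u))) ->
  exists2 C, 0 <= C & forall u, `|h' u| <= C / (1 + sqn u).
Proof.
move=> c0 c1 c' E.
have [M0 M00 HM0] := unit_box_bound c0; have [M1 M10 HM1] := unit_box_bound c1.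
have [M M_0 HM] := unit_box_bound c'.
(* In the box 1 + |u|^2 <= 3; outside, 1 + |u|^2 <= 2 |u|^2 meets the Jacobian bound 3 / |u|^2. *)
exists (3 * M + 6 * (M0 + M1)); first by rewrite addr_ge0// mulr_ge0// addr_ge0.
move=> u; rewrite ler_pdivlMr ?sqn1_gt0//.
have [Bu|/outside_unit_box q1] := pselect (unit_box u).
  apply: (@le_trans _ _ (M * 3)).
    rewrite ler_pM ?(ltW (sqn1_gt0 _))// ?HM// (_ : 3 = 1 + (1 + 1)); last by ring.
    by rewrite lerD2l lerD// unit_box_sqn.
  by rewrite mulrC lerDl mulr_ge0// addr_ge0.
have q0 : 0 < sqn u by rewrite (lt_le_trans ltr01).
have pu : punctured u by rewrite /punctured/= gt_eqF.
have d0 : `|jac_det inversion u| != 0.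
  by rewrite normr_eq0 jac_det_inversion// oppr_eq0 expf_neq0// invr_eq0.
have := congr1 Num.norm (E u pu); rewrite !normrM normr_id => /(mulfI d0) ->.
apply: (@le_trans _ _ ((3 / sqn u * M0 + 3 / sqn u * M1) * (2 * sqn u))).
  rewrite ler_pM ?(ltW (sqn1_gt0 _))//; last by rewrite mulrDl !mul1r lerD2r.
  apply: le_trans (ler_normB _ _) _; rewrite !normrM lerD// ler_pM// ?inversion_jac_bound//.
    by apply: HM0; exact: inversion_unit_box.
  by apply: HM1; exact: inversion_unit_box.
rewrite (_ : _ * (2 * sqn u) = 6 * (M0 + M1)); last by field; rewrite gt_eqF.
by rewrite lerDr mulr_ge0.
Qed.

End Bounds.

Section Decay.
Context {R : realType}.
Variables (g : 'rV[R]_3 -> 'M[R]_3) (r : 'rV[R]_3 -> R).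
Hypotheses (g_metric : riemannian_metric g) (r_gt0 : forall x, sphere2 x -> 0 < r x).
Hypotheses (r_smooth : smooth_on_sphere r).
Hypothesis (grad_r_lt1 : forall s u, grad_norm g r s u < 1).
Implicit Types (s : bool) (u : 'rV[R]_2).

Local Notation G s := (pullback (stereo s) g).

Definition chart_half_sqr s u : R := r (stereo s u) * r (stereo s u) / 2.
Local Notation f := chart_half_sqr.

Lemma smooth_chart_half_sqr s : smooth (f s).
Proof. by have sr := r_smooth s; apply: (smoothM _ (smooth_cst _)); exact: (smoothM sr sr). Qed.

Lemma adj_norm_chart s u : adj_norm (G s) (r \o stereo s) u < \det (G s u).
Proof. by apply: adj_norm_lt; [exact: smooth_metric_pullback|exact: grad_r_lt1]. Qed.

Lemma chart_height_det_gt0 s u : 0 < height_det (G s) (f s) u.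
Proof.
have := adj_norm_chart s u; have := r_gt0 (stereo_sphere s u).
have dr : differentiable (r \o stereo s) u by exact: smooth_diff.
have d2 : differentiable (fun=> 2^-1 : R) u by exact: differentiable_cst.
have pf a : partial a (f s) u = r (stereo s u) * partial a (r \o stereo s) u.
  have := partialM a (differentiable_mul dr dr) d2.
  rewrite (partialM a dr dr) partial_cst => E; apply: (etrans E).
  by rewrite /=; move: (r _) (partial _ _ _) => x y; field.
rewrite /height_det /adj_norm !pf /f.
move: (r _) (partial ord0 _ _) (partial ord_max _ _) (G s u) => x p q m x0 lt.
rewrite (_ : _ - _ = x ^+ 2 * (\det m - (m ord_max ord_max * p ^+ 2
  - 2 * m ord0 ord_max * p * q + m ord0 ord0 * q ^+ 2))); last by field.
by rewrite mulr_gt0 ?exprn_gt0// subr_gt0.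
Qed.

(** The chart is an immersion, so at each point some coordinate function of R^3 has nonzero
    differential. It is smooth in both charts and serves as the test function for
    [gauss_curvature_change]. *)
Lemma gauss_curvature_inversion u : punctured u ->
  gauss_curvature (G false) u = gauss_curvature (G true) (inversion u).
Proof.
move=> pu.
have [i Ji] : exists i : 'I_3, 'J (stereo false) u ord0 i != 0.
  have := @stereo_immersion _ false u (delta_mx 0 ord0).
  rewrite -rowE; move: ('J (stereo false) u) => J J0.
  apply: contrapT => H; have /J0 /rowP/(_ ord0) : row ord0 J = 0.
    apply/rowP => i; rewrite mxE [RHS]mxE; apply: contrapT => /eqP Ji.
    by apply: H; exists i.
  by rewrite !mxE !eqxx => /eqP; rewrite oner_eq0.
have pi : (partial ord0 (fun q => stereo false q 0 i) u != 0) ||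
    (partial ord_max (fun q => stereo false q 0 i) u != 0).
  apply/orP; left.
  exact: (eq_ind _ (fun x => x != 0) Ji _ (jacobianE ord0 i (differentiable_stereo false u))).
apply: (@gauss_curvature_change _ (G true) (G false) inversion punctured _ _ _ _ _ _ _ _ (fun q => stereo true q 0 i)
  (fun q => stereo false q 0 i) _ _ _ u pu pi).
- exact: smooth_metric_pullback.
- exact: smooth_metric_pullback.
- exact: open_punctured.
- by move=> q; exact: differentiable_inversion.
- by move=> q j a; exact: differentiable_jac_inversion.
- by move=> q j k a; exact: jac_inversionC.
- move=> q q0; rewrite jac_det_inversion// oppr_eq0 expf_neq0// invr_eq0; exact: q0.
- by move=> q j k q0; exact: pullback_inversion.
- exact: smooth_stereo.
- exact: smooth_stereo.
- by move=> q q0; rewrite stereo_inversion.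
Qed.

Let K_E := gauss_curvature_inversion.
Let mG s := smooth_metric_pullback g_metric s.
Let P_neq0 (q : 'rV[R]_2) : punctured q -> jac_det inversion q != 0.
Proof. by move=> q0; rewrite jac_det_inversion// oppr_eq0 expf_neq0// invr_eq0; exact: q0. Qed.
Let f'E q : punctured q -> f false q = f true (inversion q).
Proof. by move=> q0; rewrite /f stereo_inversion. Qed.
Let G'E q i j (q0 : punctured q) := pullback_inversion g_metric i j q0.
Let dP (q : 'rV[R]_2) i a (q0 : punctured q) := differentiable_jac_inversion i a q0.
Let PC (q : 'rV[R]_2) i j a (q0 : punctured q) := jac_inversionC i j a q0.
Let sf := smooth_chart_half_sqr.
Let Y_gt0 := chart_height_det_gt0.
Let oP := @open_punctured R.
Let dpsi := @differentiable_inversion R.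

Local Notation decay h := (exists2 C, 0 <= C &
  forall u, `|h u| <= C / ((1 + u 0 ord0 ^+ 2) * (1 + u 0 ord_max ^+ 2))).

Lemma scal_density_decay : decay (scal_density (G false) (f false)).
Proof.
apply: density_decay (smooth_continuous (smooth_scal_density (mG true) (sf true) (Y_gt0 true))) _ _.
  exact: smooth_continuous (smooth_scal_density (mG false) (sf false) (Y_gt0 false)).
move=> u pu.
exact: (scal_density_change (mG true) (mG false) oP dpsi dP PC P_neq0 G'E (sf true) f'E (Y_gt0 true) pu (K_E pu)).
Qed.

Lemma mean_density_decay : decay (mean_density (G false) (f false)).
Proof.
apply: density_decay (smooth_continuous (smooth_mean_density (mG true) (sf true) (Y_gt0 true))) _ _.
  exact: smooth_continuous (smooth_mean_density (mG false) (sf false) (Y_gt0 false)).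
move=> u pu.
exact: (mean_density_change (mG true) (mG false) oP dpsi dP PC P_neq0 G'E (sf true) f'E (Y_gt0 true) pu).
Qed.

Lemma height_density_decay : decay (height_density (G false) (f false)).
Proof.
apply: density_decay (smooth_continuous (smooth_height_density (mG true) (sf true) (Y_gt0 true))) _ _.
  exact: smooth_continuous (smooth_height_density (mG false) (sf false) (Y_gt0 false)).
move=> u pu.
exact: (height_density_change (mG true) (mG false) oP dpsi dP PC P_neq0 G'E (sf true) f'E (Y_gt0 true) pu (K_E pu)).
Qed.

Let flux_inversion u (pu : punctured u) :=
  flux_change (mG true) (mG false) oP dpsi dP PC P_neq0 G'E (sf true) f'E (Y_gt0 true) pu.

Let cflux0 s := smooth_continuous (smooth_flux0 (mG s) (sf s) (Y_gt0 s)).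
Let cflux1 s := smooth_continuous (smooth_flux1 (mG s) (sf s) (Y_gt0 s)).

Lemma flux0_decay : exists2 C, 0 <= C &
  forall u, `|flux0 (G false) (f false) u| <= C / (1 + sqn u).
Proof.
exact: (flux_decay (@cflux0 true) (@cflux1 true) (@cflux0 false)
  (fun u pu => (flux_inversion pu).1)).
Qed.

Lemma flux1_decay : exists2 C, 0 <= C &
  forall u, `|flux1 (G false) (f false) u| <= C / (1 + sqn u).
Proof.
exact: (flux_decay (@cflux1 true) (@cflux0 true) (@cflux1 false)
  (fun u pu => (flux_inversion pu).2)).
Qed.

End Decay.

(** * Integration over the plane *)

Section PlaneMeasure.
Context {R : realType}.

(** Links the topology of the plane to the product sigma-algebra: an open set is a countable union
    of open rectangles with rational corners. *)
Lemma measurable_open_plane (O : set (R * R)) : open O -> measurable O.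
Proof.
move=> oO.
pose box (a b c d : rat) : set (R * R) := `]ratr a, ratr b[ `*` `]ratr c, ratr d[.
(* Rectangles not contained in O are replaced by the empty set, so the union runs over all
   rationals. *)
pose F a b c d : set (R * R) := if `[< box a b c d `<=` O >] then box a b c d else set0.
have -> : O = \bigcup_a \bigcup_b \bigcup_c \bigcup_d F a b c d.
  apply/seteqP; split=> [[x y] Oxy|[x y] [a _ [b _ [c _ [d _]]]]]; last first.
    by rewrite /F; case: asboolP => // + ?; exact.
  have /nbhs_ballP[e /= e0 He] := open_nbhs_nbhs (conj oO Oxy).
  have lt1 (t : R) : t - e < t by rewrite ltrBlDr ltrDl.
  have lt2 (t : R) : t < t + e by rewrite ltrDl.
  have [a] := rat_in_itvoo (lt1 x); have [b] := rat_in_itvoo (lt2 x).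
  have [c] := rat_in_itvoo (lt1 y); have [d] := rat_in_itvoo (lt2 y).
  rewrite !in_itv /= => /andP[d1 d2] /andP[c1 c2] /andP[b1 b2] /andP[a1 a2].
  exists a => //; exists b => //; exists c => //; exists d => //.
  rewrite /F; case: asboolP => [_|[]].
    by split; rewrite /= in_itv /= ?a2 ?b1 ?c2 ?d1.
  move=> [z w] [/=]; rewrite !in_itv /= => /andP[z1 z2] /andP[w1 w2].
  apply: He; split => /=; rewrite -ball_normE /= ltr_distlC.
    by rewrite (lt_trans a1 z1) (lt_trans z2 b2).
  by rewrite (lt_trans c1 w1) (lt_trans w2 d2).
do 4 (apply: bigcupT_measurable_rat => ?).
by rewrite /F; case: asboolP => // _; exact: measurableX.
Qed.

Lemma measurable_continuous_plane (h : R * R -> R) : continuous h ->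
  measurable_fun setT h.
Proof.
move=> /continuousP ch; apply: (measurability _ (RGenOpens.measurableE R)).
by move=> _ [_ [a [b ->]] <-]; rewrite setTI; apply: measurable_open_plane; apply: ch; exact: interval_open.
Qed.

Lemma point2_0 (a : R * R) : point2 a 0 ord0 = a.1.
Proof.
transitivity (row_mx (a.1%:M : 'M[R]_1) (a.2%:M : 'M[R]_1) 0 (lshift 1 ord0)).
  by congr (row_mx _ _ _ _); exact: val_inj.
by rewrite row_mxEl mxE eqxx.
Qed.

Lemma point2_max (a : R * R) : point2 a 0 ord_max = a.2.
Proof.
transitivity (row_mx (a.1%:M : 'M[R]_1) (a.2%:M : 'M[R]_1) 0 (rshift 1 ord0)).
  by congr (row_mx _ _ _ _); exact: val_inj.
by rewrite row_mxEr mxE eqxx.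
Qed.

Lemma continuous_point2 (h : 'rV[R]_2 -> R) : continuous h -> continuous (h \o @point2 R).
Proof.
move=> ch a; apply: continuous_comp; last exact: ch.
apply/cvg_ballP => e e0; near=> b; split=> // i j.
have [b1 b2] : ball a e b by near: b; exact: (nbhsx_ballx a e e0).
have [->|->] := ord2 j; rewrite (ord1 i).
  by rewrite !point2_0.
by rewrite !point2_max.
Unshelve. all: by end_near. Qed.

Lemma measurable_point2 (h : 'rV[R]_2 -> R) : continuous h ->
  measurable_fun setT (h \o @point2 R).
Proof. by move=> ch; apply: measurable_continuous_plane; exact: continuous_point2. Qed.

End PlaneMeasure.

Section PlaneIntegral.
Context {R : realType}.

Local Notation mu := (@lebesgue_measure R).
Local Notation mu2 := (mu \x mu)%E.
Local Notation oneDsqrV := (fun x : R => (oneDsqr x)^-1).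

Lemma oneDsqrV_ge0 (x : R) : 0 <= (oneDsqr x)^-1.
Proof. by rewrite invr_ge0 addr_ge0// sqr_ge0. Qed.

Lemma measurable_oneDsqrV : measurable_fun setT oneDsqrV.
Proof. by apply: continuous_measurable_fun; exact: continuous_oneDsqrV. Qed.

Lemma integral_oneDsqrV : (\int[mu]_x ((oneDsqr x)^-1)%:E = pi%:E)%E.
Proof.
rewrite (ge0_symfun_integralT oneDsqrV_ge0 continuous_oneDsqrV); last first.
  by move=> x; rewrite /= /oneDsqr sqrrN.
rewrite (_ : [set x | 0 <= x] = `[0, +oo[%classic :> set R); last first.
  by apply/seteqP; split => x /=; rewrite in_itv/= andbT.
by rewrite integral0y_oneDsqr -EFinM mulrC divfK.
Qed.

Lemma measurable_decay C : measurable_fun setT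
  (fun a : R * R => (C * ((oneDsqr a.1)^-1 * (oneDsqr a.2)^-1))).
Proof.
apply: measurable_funM; first exact: measurable_cst.
by apply: measurable_funM; apply: (measurableT_comp measurable_oneDsqrV);
  [exact: measurable_fst|exact: measurable_snd].
Qed.

(** By Tonelli the integral is C pi^2, from two arctangent integrals. *)
Lemma integrable_decay C : 0 <= C -> mu2.-integrable setT
  (fun a : R * R => (C * ((oneDsqr a.1)^-1 * (oneDsqr a.2)^-1))%:E).
Proof.
move=> C0; apply/integrable12ltyP.
  by apply/measurable_EFinP; exact: measurable_decay.
rewrite [ltLHS](_ : _ = \int[mu]_x ((C * pi)%:E * ((oneDsqr x)^-1)%:E))%E.
  rewrite ge0_integralZl//.
  - by rewrite integral_oneDsqrV -EFinM ltry.
  - by apply/measurable_EFinP; exact: measurable_oneDsqrV.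
  - by rewrite lee_fin mulr_ge0// pi_ge0.
apply: eq_integral => x _.
rewrite (_ : (C * pi)%:E * _ = (C * (oneDsqr x)^-1)%:E * pi%:E)%E; last first.
  by rewrite -!EFinM; congr EFin; rewrite mulrAC.
rewrite -integral_oneDsqrV -ge0_integralZl//.
- apply: eq_integral => y _; rewrite -EFinM /= ger0_norm ?mulrA//.
  by rewrite !mulr_ge0// oneDsqrV_ge0.
- by apply/measurable_EFinP; exact: measurable_oneDsqrV.
- by rewrite lee_fin mulr_ge0// oneDsqrV_ge0.
Qed.

Lemma integrable_point2 (h : 'rV[R]_2 -> R) : continuous h ->
  (exists2 C, 0 <= C &
     forall u, `|h u| <= C / ((1 + u 0 ord0 ^+ 2) * (1 + u 0 ord_max ^+ 2))) ->
  mu2.-integrable setT (fun a => (h (point2 a))%:E).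
Proof.
move=> ch [C C0 hC]; apply: le_integrable (integrable_decay C0) => //.
  by apply/measurable_EFinP; exact: measurable_point2.
move=> a _; rewrite /= lee_fin (le_trans (hC _))// point2_0 point2_max invfM.
exact: ler_norm.
Qed.

Lemma integral_slab (c x : R) : 0 <= x ->
  (\int[mu]_t (if (0 < t) && (t <= x) then c else 0)%:E = (c * x)%:E)%E.
Proof.
move=> x0; transitivity (\int[mu]_(t in `]0%R, x]) (cst c%:E t))%E.
  rewrite [RHS]integral_mkcond; apply: eq_integral => t _.
  by rewrite patchE mem_setE in_itv /=; case: ifP.
rewrite integral_cst//= lebesgue_measure_itv/= lte_fin.
case: ltP => [_|xle]; first by rewrite oppr0 adde0 EFinM.
by rewrite mule0 (le_anti (introT andP (conj xle x0))) mulr0.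
Qed.

(** For fixed y the integrand is the constant k / w on an interval of length w, so integrating the
    first variable out leaves k. *)
Lemma integral_cone d (T : measurableType d) (m : {sigma_finite_measure set T -> \bar R})
    (k w : T -> R) (D : set (R * T)) (h : R * T -> R) : (forall a, 0 < w a) ->
  (forall a, D a = ((0 < a.1) && (a.1 <= w a.2))) ->
  (forall a, D a -> h a = k a.2 / w a.2) ->
  measurable_fun setT w -> measurable_fun setT (fun a => k a / w a) ->
  m.-integrable setT (EFin \o k) ->
  (\int[mu \x m]_(a in D) (h a)%:E = \int[m]_a (k a)%:E)%E.
Proof.
move=> w0 DE hE mw mk ik.
pose F (a : R * T) :=
  if (0 < a.1) && (a.1 <= w a.2) then k a.2 / w a.2 else 0.
transitivity (\int[mu \x m]_a (F a)%:E)%E.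
  rewrite integral_mkcond; apply: eq_integral => a _.
  rewrite patchE /F; case: ifPn => [/set_mem Da|aD].
    by have := Da; rewrite DE => ->; rewrite hE.
  by case: ifP => // H; rewrite mem_set ?DE in aD.
have mF : measurable_fun setT F.
  have m1 : measurable_fun setT (fst : R * T -> R) by exact: measurable_fst.
  have mw2 : measurable_fun setT (fun a : R * T => w a.2).
    exact: (measurableT_comp mw measurable_snd).
  apply: measurable_fun_ifT; last exact: measurable_cst.
    apply: measurable_and.
      by apply: measurable_fun_ltr.
    exact: measurable_fun_ler.
  exact: (measurableT_comp mk measurable_snd).
have inner y : (\int[mu]_x (F (x, y))%:E = (k y)%:E)%E.
  rewrite /F /= integral_slab ?(ltW (w0 y))// divfK//.
  by rewrite gt_eqF.
(* The same slab computation for the absolute value reduces integrability on the product to that of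
   k, which justifies Fubini. *)
have iF : (mu \x m)%E.-integrable setT (EFin \o F).
  apply/integrable21ltyP; first exact/measurable_EFinP.
  have /integrableP[_] := ik; congr (_ < _)%E; apply: eq_integral => y _.
  rewrite /= -[X in `|X|%:E](divfK (lt0r_neq0 (w0 y))) normrM (gtr0_norm (w0 y)).
  rewrite -(integral_slab _ (ltW (w0 y))); apply: eq_integral => x _.
  by rewrite /F /=; case: ifP; rewrite ?normr0.
rewrite -(integral21_prod_meas1 iF).
by apply: eq_integral => y _; rewrite /fubini_G /= inner.
Qed.

Lemma sigma_finite_plane : sigma_finite setT mu2.
Proof.
exists (fun n => `[(- n%:R)%R, n%:R] `*` `[(- n%:R)%R, n%:R]).
  apply/esym/seteqP; split=> // -[x y] _.
  have [n _ /(_ n (leqnn n)) xyn] := nbhs_infty_ger (`|x| + `|y|).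
  exists n => //; rewrite /= !in_itv /= -!ler_norml.
  by rewrite !(le_trans _ xyn)// ?lerDl ?lerDr.
move=> n; split; first exact: measurableX.
rewrite product_measure1E//= !lebesgue_measure_itv/=.
by case: ifP => _; rewrite ?mule0// -!EFinB -EFinM ltry.
Qed.

(* [mu \x mu] has no canonical sigma-finite structure. *)
Definition plane_measure :
    {sigma_finite_measure set (measurableTypeR R * measurableTypeR R)%type -> \bar R} :=
  HB.pack mu2 (Measure_isSigmaFinite.Build _ _ _ mu2 sigma_finite_plane).

Lemma integral_cone_plane (k w : R * R -> R) (D : set (R * (R * R)))
    (h : R * (R * R) -> R) : (forall a, 0 < w a) ->
  (forall a, D a = ((0 < a.1) && (a.1 <= w a.2))) ->
  (forall a, D a -> h a = k a.2 / w a.2) ->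
  measurable_fun setT w -> measurable_fun setT (fun a => k a / w a) ->
  mu2.-integrable setT (EFin \o k) ->
  (\int[mu \x mu2]_(a in D) (h a)%:E = \int[mu2]_a (k a)%:E)%E.
Proof.
move=> w0 DE hE mw mk ik.
exact: (@integral_cone _ _ plane_measure k w D h w0 DE hE mw mk ik).
Qed.

End PlaneIntegral.

(** * The divergence theorem on growing squares *)

Section Divergence.
Context {R : realType}.
Implicit Types (c t x y : R) (i : 'I_2) (u v : 'rV[R]_2).

Local Notation mu := (@lebesgue_measure R).
Local Notation mu2 := (mu \x mu)%E.

Definition seg c x : bool := (- c <= x) && (x <= c).

(** Cutting off the integrand keeps the whole plane as domain, as Fubini and dominated convergence
    are used there. *)
Definition trunc c (k : R * R -> R) (a : R * R) : R :=
  if seg c a.1 && seg c a.2 then k a else 0.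

Lemma measurable_seg c : measurable_fun setT (seg c).
Proof.
by apply: measurable_and; apply: measurable_fun_ler => //; exact: measurable_cst.
Qed.

Lemma measurable_trunc c k : measurable_fun setT k -> measurable_fun setT (trunc c k).
Proof.
move=> mk; apply: measurable_fun_ifT => //.
by apply: measurable_and; apply: (measurableT_comp (measurable_seg c));
  [exact: measurable_fst|exact: measurable_snd].
Qed.

Lemma integral_seg c (k : R -> R) :
  (\int[mu]_t (if seg c t then k t else 0)%:E = \int[mu]_(t in `[(- c)%R, c]) (k t)%:E)%E.
Proof.
rewrite [RHS]integral_mkcond; apply: eq_integral => t _.
by rewrite patchE mem_setE in_itv /= -/(seg c t); case: ifP.
Qed.

Lemma integral_seg_cst c x : 0 < c ->
  (\int[mu]_t (if seg c t then x else 0)%:E = (x * (2 * c))%:E)%E.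
Proof.
move=> c0; rewrite integral_seg (integral_cst mu (measurable_itv _) x%:E).
rewrite [X in (_ * X)%E = _]lebesgue_measure_itv /= lte_fin ifT ?gtrN//.
by rewrite -EFinB -EFinM; congr (_ * _)%:E; ring.
Qed.

Lemma seg_sqr c x : seg c x -> x ^+ 2 <= c ^+ 2.
Proof.
by rewrite /seg -ler_norml => xc; rewrite -real_normK ?num_real// lerXn2r// nnegrE (le_trans _ xc).
Qed.

Lemma box_bound (k : R * R -> R) c : continuous k ->
  exists2 M, 0 <= M & forall a, seg c a.1 -> seg c a.2 -> `|k a| <= M.
Proof.
move=> ck; pose B : set (R * R) := `[- c, c] `*` `[- c, c].
have BE a : B a <-> seg c a.1 /\ seg c a.2.
  by rewrite /B /seg /= !in_itv /=; split.
have cB : compact B by apply: compact_setX; exact: segment_compact.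
have cn : {within B, continuous (fun a => `|k a|)}.
  apply: continuous_subspaceT => a; exact: (continuous_comp (ck a) (@norm_continuous _ _ _)).
have [c0|c0] := leP 0 c.
  have [|a0 _ Ha] := compact_EVT_max _ cB cn.
    by exists (0, 0); apply/BE; rewrite /seg /= oppr_le0 c0.
  exists `|k a0| => // a s1 s2; apply: Ha; apply: mem_set.
  by apply/BE.
by exists 0 => // a /andP[s1 s2]; exfalso; lra.
Qed.

(** On the square 1 <= (1 + c^2) / (1 + x^2) in each variable, so a bounded function is dominated by
    a multiple of the standard decaying product. *)
Lemma integrable_trunc c k : continuous k -> mu2.-integrable setT (EFin \o trunc c k).
Proof.
move=> ck; have [M M0 HM] := box_bound c ck.
have mk := measurable_continuous_plane ck.
have C0 : 0 <= M * ((1 + c ^+ 2) * (1 + c ^+ 2)).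
  by rewrite mulr_ge0// mulr_ge0// addr_ge0// sqr_ge0.
apply: (le_integrable _ _ _ (integrable_decay C0)) => //.
  by apply/measurable_EFinP; exact: measurable_trunc.
move=> a _; rewrite /= lee_fin [leRHS]ger0_norm; last first.
  by rewrite mulr_ge0// mulr_ge0// oneDsqrV_ge0.
rewrite /trunc; case: ifP => [/andP[s1 s2]|_]; last first.
  by rewrite normr0 mulr_ge0// mulr_ge0// oneDsqrV_ge0.
apply: le_trans (HM a s1 s2) _; rewrite -mulrA ler_peMr//.
rewrite mulrACA.
have le1 x : seg c x -> 1 <= (1 + c ^+ 2) * (oneDsqr x)^-1.
  move=> sx; rewrite ler_pdivlMr ?mul1r; last by rewrite /oneDsqr ltr_pwDl// sqr_ge0.
  by rewrite lerD2l seg_sqr.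
by have := ler_pM ler01 ler01 (le1 _ s1) (le1 _ s2); rewrite mulr1.
Qed.

(** Puts the variable of differentiation first, so that one argument treats both partial
    derivatives. *)
Definition swap i x y : R * R := if i == ord0 then (x, y) else (y, x).

Lemma swap_line i x y :
  point2 (swap i x y) = point2 (swap i 0 y) + x *: delta_mx 0 i :> 'rV[R]_2.
Proof.
have E a : point2 (swap i x y) 0 a = (point2 (swap i 0 y) + x *: delta_mx 0 i) 0 a.
  rewrite [RHS]mxE [X in _ = _ + X]mxE [delta_mx _ _ _ _]mxE eqxx /= /swap.
  have [->|->] := ord2 i; have [->|->] := ord2 a; rewrite ?point2_0 ?point2_max ?eqxx /=;
    by rewrite ?mulr1 ?mulr0 ?addr0 ?add0r.
by apply/rowP => a; exact: E.
Qed.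

Lemma seg_swap c i x y : seg c (swap i x y).1 && seg c (swap i x y).2 = seg c x && seg c y.
Proof. by rewrite /swap; case: ifP => //= _; rewrite andbC. Qed.

Lemma is_derive_swap (h : 'rV[R]_2 -> R) i x y : smooth h ->
  is_derive x (1 : R) (fun t => h (point2 (swap i t y))) (partial i h (point2 (swap i x y))).
Proof.
move=> sh; rewrite (swap_line i x y) (_ : (fun t : R => _) =
    fun t => h (point2 (swap i 0 y) + t *: delta_mx 0 i)).
  by apply: is_derive_line => q; exact: smooth_diff.
by apply/funext => t; rewrite (swap_line i t y).
Qed.

Lemma continuous_swap (h : 'rV[R]_2 -> R) i y : smooth h ->
  continuous (fun t => h (point2 (swap i t y))).
Proof.
move=> sh x; apply: differentiable_continuous; apply/derivable1_diffP.
by have [] := is_derive_swap i x y sh.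
Qed.

Lemma integral_partial_line (h : 'rV[R]_2 -> R) i y c : smooth h -> 0 < c ->
  (\int[mu]_(t in `[(- c)%R, c]) (partial i h (point2 (swap i t y)))%:E =
   (h (point2 (swap i c y)) - h (point2 (swap i (- c) y)))%:E)%E.
Proof.
move=> sh c0; pose F t := h (point2 (swap i t y)).
rewrite (@continuous_FTC2 _ (fun t => partial i h (point2 (swap i t y))) F)//.
- by rewrite gtrN.
- by apply: continuous_subspaceT; apply: continuous_swap; exact: smooth_partial.
- split.
  + by move=> x _; have [] := is_derive_swap i x y sh.
  + by apply: cvg_at_right_filter; exact: continuous_swap.
  + by apply: cvg_at_left_filter; exact: continuous_swap.
- by move=> x _; rewrite derive1E; have [_ ->] := is_derive_swap i x y sh.
Qed.

Lemma integral_swap i (F : R * R -> R) : mu2.-integrable setT (EFin \o F) ->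
  (\int[mu2]_a (F a)%:E = \int[mu]_y \int[mu]_x (F (swap i x y))%:E)%E.
Proof.
move=> iF; have [->|->] := ord2 i; rewrite /swap /=.
  by rewrite -(integral21_prod_meas1 iF).
by rewrite -(integral12_prod_meas1 iF).
Qed.

Lemma sqn_swap i x y : x ^+ 2 <= sqn (point2 (swap i x y)).
Proof.
rewrite /sqn point2_0 point2_max /swap.
by case: ifP => _ /=; rewrite ?lerDl ?lerDr sqr_ge0.
Qed.

Lemma measurable_swap (k : R * R -> R) i x : measurable_fun setT k ->
  measurable_fun setT (fun y => k (swap i x y)).
Proof.
move=> mk; have [->|->] := ord2 i; rewrite /swap /=.
  exact: measurable_fun_pair2.
exact: measurable_fun_pair1.
Qed.

(** The fundamental theorem of calculus on each line leaves the values of h on two opposite edges,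
    of length 2 c each, where |u| >= c. *)
Lemma integral_trunc_partial (h : 'rV[R]_2 -> R) i c M : smooth h -> 0 < c ->
  (forall u, c ^+ 2 <= sqn u -> `|h u| <= M) ->
  (`| \int[mu2]_a (trunc c (partial i h \o @point2 R) a)%:E | <= (2 * M * (2 * c))%:E)%E.
Proof.
move=> sh c0 hM; pose B y := h (point2 (swap i c y)) - h (point2 (swap i (- c) y)).
have cp : continuous (partial i h) by apply: smooth_continuous; exact: smooth_partial.
rewrite (integral_swap i (integrable_trunc c (continuous_point2 cp))).
have -> : (\int[mu]_y \int[mu]_x (trunc c (partial i h \o @point2 R) (swap i x y))%:E =
    \int[mu]_y (if seg c y then B y else 0)%:E)%E.
  apply: eq_integral => y _; case: ifPn => sy.
    rewrite -(integral_partial_line i y sh c0) -integral_seg.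
    by apply: eq_integral => x _; rewrite /trunc seg_swap sy andbT.
  by apply: integral0_eq => x _; rewrite /trunc seg_swap (negbTE sy) andbF.
have mh : measurable_fun setT (h \o @point2 R).
  by apply: measurable_point2; exact: smooth_continuous.
have mB : measurable_fun setT (fun y => if seg c y then B y else 0).
  apply: measurable_fun_ifT => //; first exact: measurable_seg.
  by apply: measurable_funB; exact: measurable_swap mh.
apply: le_trans (le_abse_integral mu measurableT (_ : measurable_fun setT (EFin \o _))) _; first exact/measurable_EFinP.
rewrite -(integral_seg_cst (2 * M) c0); apply: ge0_le_integral => //.
- by apply/measurable_EFinP; apply: measurableT_comp => //.
- apply/measurable_EFinP; apply: measurable_fun_ifT => //.
  exact: measurable_seg.
- move=> y _; rewrite /= lee_fin; case: ifP => _; last by rewrite normr0.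
  apply: le_trans (ler_normB _ _) _; rewrite mulrDl mul1r lerD// hM//.
    exact: sqn_swap.
  by apply: le_trans (sqn_swap i (- c) y); rewrite sqrrN.
Qed.

Lemma integral_divergence (h0 h1 : 'rV[R]_2 -> R) : smooth h0 -> smooth h1 ->
  (exists2 C, 0 <= C & forall u, `|h0 u| <= C / (1 + sqn u)) ->
  (exists2 C, 0 <= C & forall u, `|h1 u| <= C / (1 + sqn u)) ->
  mu2.-integrable setT
    (fun a => (partial ord0 h0 (point2 a) + partial ord_max h1 (point2 a))%:E) ->
  (\int[mu2]_a (partial ord0 h0 (point2 a) + partial ord_max h1 (point2 a))%:E = 0)%E.
Proof.
move=> s0 s1 [C0 C00 H0] [C1 C10 H1] iD.
set D := fun a : R * R => partial ord0 h0 (point2 a) + partial ord_max h1 (point2 a).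
have cp0 : continuous (partial ord0 h0) by apply: smooth_continuous; exact: smooth_partial.
have cp1 : continuous (partial ord_max h1) by apply: smooth_continuous; exact: smooth_partial.
have mD : measurable_fun setT D.
  by apply: measurable_funD; exact: measurable_point2.
(* The successor keeps the half-side of the square positive. *)
pose f_ n := fun a => (trunc n.+1%:R D a)%:E.
have [| | | | | _ _ cv] := @dominated_convergence _ _ R mu2 setT measurableT f_ (EFin \o D)
  (fun a => `|(D a)%:E|%E).
- by move=> n; apply/measurable_EFinP; exact: measurable_trunc.
- exact/measurable_EFinP.
- apply: aeW => a _; apply: cvg_near_cst.
  have := nbhs_infty_ger (`|a.1| + `|a.2|); apply: filterS => n an.
  rewrite /f_ /trunc ifT// /seg -!ler_norml.
  have n1 : n%:R <= n.+1%:R :> R by rewrite ler_nat.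
  by rewrite !(le_trans _ n1)// (le_trans _ an)// ?lerDl ?lerDr.
- exact: integrable_abse iD.
- apply: aeW => a n _; rewrite /f_ /trunc; case: ifP => // _.
  by rewrite abse0.
(* Each component contributes at most 2 * C / (1 + c^2) * 2 c, and c / (1 + c^2) <= 1 / c. *)
pose K := 4 * (C0 + C1).
have K0 : 0 <= K by rewrite mulr_ge0// addr_ge0.
have bound n : (`|\int[mu2]_a (f_ n a)| <= (K * harmonic n)%:E)%E.
  set c : R := n.+1%:R; have c0 : 0 < c by rewrite ltr0n.
  have -> : (\int[mu2]_a (f_ n a) = \int[mu2]_a (trunc c (partial ord0 h0 \o @point2 R) a)%:E
      + \int[mu2]_a (trunc c (partial ord_max h1 \o @point2 R) a)%:E)%E.
    rewrite -(integralD measurableT (integrable_trunc c (continuous_point2 cp0))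
      (integrable_trunc c (continuous_point2 cp1))).
    apply: eq_integral => a _; rewrite /f_ /trunc -EFinD; congr EFin.
    by case: ifP; rewrite ?addr0.
  have flux_le C u : 0 <= C -> c ^+ 2 <= sqn u -> C / (1 + sqn u) <= C / (1 + c ^+ 2).
    move=> C_0 cu; rewrite ler_wpM2l// lef_pV2 ?posrE ?sqn1_gt0 ?lerD2l//.
    by rewrite ltr_pwDl// sqr_ge0.
  have b0 := @integral_trunc_partial h0 ord0 c (C0 / (1 + c ^+ 2)) s0 c0
    (fun u cu => le_trans (H0 u) (flux_le C0 u C00 cu)).
  have b1 := @integral_trunc_partial h1 ord_max c (C1 / (1 + c ^+ 2)) s1 c0
    (fun u cu => le_trans (H1 u) (flux_le C1 u C10 cu)).
  apply: le_trans (lee_abs_add _ _) _; apply: le_trans (leeD b0 b1) _.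
  rewrite -EFinD lee_fin /harmonic /= -/c.
  rewrite (_ : _ + _ = K * (c / (1 + c ^+ 2))); last first.
    by rewrite /K; field; rewrite gt_eqF// ltr_pwDl// sqr_ge0.
  rewrite ler_wpM2l// ler_pdivrMr ?ltr_pwDl ?sqr_ge0// ler_pdivlMl//.
  by rewrite -expr2 lerDr.
have cv0 : (\int[mu2]_a f_ n a @[n --> \oo] --> 0)%E.
  apply/cvg_abse0P.
  have cK : ((K * harmonic n)%:E @[n --> \oo] --> 0)%E.
    apply: cvg_EFin; first by near=> n.
    by rewrite -[X in _ --> X](mulr0 K); apply: cvgMl_tmp; exact: cvg_harmonic.
  apply: (squeeze_cvge _ (cvg_cst 0%E) cK).
  by near=> n; rewrite /= abse_ge0 bound.
exact: (cvg_unique (@ereal_hausdorff R) cv cv0).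
Unshelve. all: by end_near. Qed.

End Divergence.

Theorem theorem4p15 (R : realType) (g : 'rV[R]_3 -> 'M[R]_3) (r : 'rV[R]_3 -> R)
  (g_metric : riemannian_metric g)
  (r_gt0 : forall x, sphere2 x -> 0 < r x)
  (r_smooth : smooth_on_sphere r)
  (grad_r_lt1 : forall s u, grad_norm g r s u < 1) :
  HE g r = integral_M g r (fun u =>
    height g r u *
      (gauss_curvature (induced_metric g r) u + \det (shape_operator g r u))).
Proof.
have [G GE] : {G | sphere_metric g = G} by exists (sphere_metric g).
have mG : smooth_metric G by rewrite -GE; exact: smooth_metric_pullback.
have G00 u : 0 < G u ord0 ord0 by rewrite -GE; exact: pullback00_gt0.
have sr : smooth (Defs.radius r) by exact: r_smooth.
have rr_gt0 u : 0 < Defs.radius r u by apply: r_gt0; exact: stereo_sphere.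
have grad_lt u : adj_norm G (Defs.radius r) u < \det (G u).
  by rewrite -GE; exact: adj_norm_chart.
have dS := scal_density_decay g_metric r_gt0 r_smooth grad_r_lt1.
have dM := mean_density_decay g_metric r_gt0 r_smooth grad_r_lt1.
have dH := height_density_decay g_metric r_gt0 r_smooth grad_r_lt1.
have f0 := flux0_decay g_metric r_gt0 r_smooth grad_r_lt1.
have f1 := flux1_decay g_metric r_gt0 r_smooth grad_r_lt1.
(* In this chart [chart_half_sqr] is convertible to [half_sqr r], so these bounds concern the same f
   as below. *)
rewrite -/(sphere_metric g) GE in dS dM dH f0 f1.
pose f := half_sqr r.
have sf : smooth f by exact: smooth_half_sqr.
have Y0 u : 0 < height_det G f u by exact: height_det_gt0.
have sS := smooth_scal_density mG sf Y0; have sM := smooth_mean_density mG sf Y0.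
have sH := smooth_height_density mG sf Y0.
have iS := integrable_point2 (smooth_continuous sS) dS.
have iM := integrable_point2 (smooth_continuous sM) dM.
have iH := integrable_point2 (smooth_continuous sH) dH.
(* By [scal_dvol] the integrand is constant on each segment 0 < rho <= r, so radial integration
   cancels the division by r. *)
have PE : integral_P g r (scal (gtilde g r)) =
    (2%:E * \int[lebesgue_measure \x lebesgue_measure]_a (scal_density G f (point2 a))%:E)%E.
  have sk : smooth (fun u => 2 * scal_density G f u) by apply: smoothM => //; exact: smooth_cst.
  have sw : smooth (fun u => 2 * scal_density G f u / Defs.radius r u).
    by apply: smoothM => //; apply: smoothV => // u; rewrite gt_eqF.
  have SE p : 0 < rho p -> scal (gtilde g r) p * dvol (gtilde g r p) =
      2 * scal_density G f (rsubmx p) / Defs.radius r (rsubmx p).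
    exact: scal_dvol GE mG sr rr_gt0 grad_lt p.
  have rp (a : R * (R * R)) : rsubmx (point3 a) = point2 a.2 by exact: row_mxKr.
  have rho3 (a : R * (R * R)) : rho (point3 a) = a.1.
    by rewrite /rho row_mxKl mxE eqxx mulr1n.
  have DE a : (@point3 R @^-1` P_ r) a = ((0 < a.1) && (a.1 <= Defs.radius r (point2 a.2))).
    by rewrite /P_ /= rho3 rp.
  have hE a : (@point3 R @^-1` P_ r) a ->
      scal (gtilde g r) (point3 a) * dvol (gtilde g r (point3 a)) =
      2 * scal_density G f (point2 a.2) / Defs.radius r (point2 a.2).
    by rewrite DE => /andP[a0 _]; rewrite SE ?rho3// rp.
  have ik : (lebesgue_measure \x lebesgue_measure)%E.-integrable setT
      (EFin \o (fun a : R * R => 2 * scal_density G f (point2 a))).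
    exact: (integrableZl measurableT 2 iS).
  have key := @integral_cone_plane R (fun a => 2 * scal_density G f (point2 a))
    (Defs.radius r \o @point2 R) _ _ (fun a => rr_gt0 (point2 a)) DE hE
    (measurable_point2 (smooth_continuous sr))
    (measurable_point2 (smooth_continuous sw)) ik.
  by rewrite -integralZl// -[RHS]key.
have ME : integral_M g r (mean_curvature g r) =
    ((2^-1)%:E * \int[lebesgue_measure \x lebesgue_measure]_a (mean_density G f (point2 a))%:E)%E.
  rewrite -integralZl//; apply: eq_integral => a _; rewrite -EFinM; congr EFin.
  exact: (mean_curvature_dvol GE mG sr rr_gt0 grad_lt).
have HEE : integral_M g r (fun u => height g r u *
      (gauss_curvature (induced_metric g r) u + \det (shape_operator g r u))) =
    (\int[lebesgue_measure \x lebesgue_measure]_a (height_density G f (point2 a))%:E)%E.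
  apply: eq_integral => a _; congr EFin.
  exact: (height_curvature_dvol GE mG sr rr_gt0 G00 grad_lt).
rewrite /HE PE ME HEE !muleA -!EFinM mulVf ?pnatr_eq0// divff ?pnatr_eq0// !mul1e.
rewrite -integralD//.
have iSM := integrableD measurableT iS iM.
have dE a : (partial ord0 (flux0 G f) (point2 a) + partial ord_max (flux1 G f) (point2 a))%:E =
    ((scal_density G f (point2 a))%:E + (mean_density G f (point2 a))%:E
     - (height_density G f (point2 a))%:E)%E.
  by rewrite (div_flux_density mG sf Y0) EFinB EFinD.
have iD := integrableB measurableT iSM iH.
have /= := integral_divergence (smooth_flux0 mG sf Y0) (smooth_flux1 mG sf Y0) f0 f1.
under eq_fun do rewrite dE.
move=> /(_ iD); rewrite (integralB measurableT iSM iH) => /eqP.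
(* A vanishing difference of extended reals gives equality once the integrals are finite, which
   integrability provides. *)
rewrite sube_eq ?add0e; last 2 first.
- exact: integrable_fin_num iSM.
- by rewrite fin_num_adde_defl//; exact: integrable_fin_num iH.
by move=> /eqP.
Qed.
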